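(* Let $n\ge2$, let $q\in\mathbb{C}^\times$ be not a root of unity, and let $\mathbb{H}^{\mathfrak{gl}_n}$ be the subalgebra, over the field $\mathbb{C}(\tau)$, of the $GL_n$-type double affine Hecke algebra $\mathbb{H}_n$ generated by $T_k$, $Y_i^{\pm1}$ and $e_{ij}=X_iD_j$ ($i\neq j$). Then the centre $\mathcal{Z}(\mathbb{H}^{\mathfrak{gl}_n})$ is generated, as a $\mathbb{C}(\tau)$-algebra, by $\widetilde Y^{\pm1}$, where $\widetilde Y=\prod_{i=1}^nY_i$.
   Context: $\mathbb{H}_n$ is the unital associative algebra over $\mathbb{C}(\tau)$ ($\tau$ a formal variable) generated by $T_k$ ($1\le k\le n-1$), $X_i^{\pm1}$, $Y_i^{\pm1}$ ($1\le i\le n$) with relations: $(T_k-\tau)(T_k+\tau^{-1})=0$; $T_lT_{l+1}T_l=T_{l+1}T_lT_{l+1}$ ($1\le l\le n-2$); $[T_k,T_l]=0$ if $|k-l|>1$; $T_kX_kT_k=X_{k+1}$, $[T_k,X_i]=0$ for $i\ne k,k+1$; $T_k^{-1}Y_kT_k^{-1}=Y_{k+1}$, $[T_k,Y_i]=0$ for $i\neq k,k+1$; $\widetilde Y X_i=qX_i\widetilde Y$ with $\widetilde Y=\prod_{i=1}^nY_i$; $Y_2^{-1}X_1Y_2X_1^{-1}=T_1^2$; the $X_i^{\pm1}$ are mutually inverse and commute with each other, and likewise the $Y_i^{\pm1}$. $D_n=(q-q^{-1})^{-1}X_n^{-1}(Y_n-Y_n^{-1})$ and, for $1\le i\le n-1$,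 $D_i=T_iT_{i+1}\cdots T_{n-1}\,D_n\,T_{n-1}\cdots T_{i+1}T_i$. $e_{ij}=X_iD_j$. $\mathbb{H}^{\mathfrak{gl}_n}=\langle T_k,\,Y_i^{\pm1},\,e_{ij}: 1\le k\le n-1,\ 1\le i,j\le n,\ i\ne j\rangle\subset\mathbb{H}_n$. *)

(* Defs.v *)
From HB Require Import structures.
From mathcomp Require Import all_boot all_order all_algebra.
From mathcomp Require Import generic_quotient.
From mathcomp Require Import boolp classical_sets reals complex.
From mathcomp Require Import finmap monalg.

Set Implicit Arguments.
Unset Strict Implicit.
Unset Printing Implicit Defensive.

Import GRing.Theory.
Local Open Scope ring_scope.
Local Open Scope quotient_scope.
Local Open Scope classical_set_scope.

(* {malg K[M]} is only registered as an algType for commutative monoids M;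
   the free algebra on G is the monoid algebra of the free monoid on G. *)
Definition fmonom_alg (K : comNzRingType) (G : choiceType) : Type :=
  {malg K[{fmonom G}]}.

HB.instance Definition _ (K : comNzRingType) (G : choiceType) :=
  GRing.Lalgebra.on (fmonom_alg K G).

Fact fmonom_alg_scalerAr (K : comNzRingType) (G : choiceType) (c : K)
  (x y : {malg K[{fmonom G}]}) : c *: (x * y) = x * (c *: y).
Proof.
apply/malgP => k; rewrite [LHS]mcoeffZ [in LHS]mcoeffMl.
rewrite [RHS](mcoeffMlw k (fsubset_refl (msupp x)) (msuppZ_le c y)).
rewrite mulr_sumr; apply: eq_bigr => i _; rewrite mulr_sumr.
by apply: eq_bigr => j _; rewrite mcoeffZ mulrnAr !mulrA (mulrC c).
Qed.

HB.instance Definition _ (K : comNzRingType) (G : choiceType) :=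
  GRing.Lalgebra_isAlgebra.Build K (fmonom_alg K G)
    (@fmonom_alg_scalerAr K G).

Record alg_with_gens (K : comNzRingType) (G : Type) := AlgWithGens {
  alg_carrier :> algType K;
  alg_gen : G -> alg_carrier
}.

(* Locked: unfolding malg during unification is prohibitively slow. *)
HB.lock Definition free_alg (K : comNzRingType) (G : choiceType)
    : alg_with_gens K G :=
  AlgWithGens (fun g : G => mkmalgU (fmu g) 1 : fmonom_alg K G).

Definition fgen (K : comNzRingType) (G : choiceType) (g : G) : free_alg K G :=
  alg_gen (free_alg K G) g.

(* The quotient A / (r) of an algebra by the two-sided ideal generated by the
   differences a - b with r a b.  MathComp's ideal_quot only handles proper
   ideals of commutative rings.  Since nothing is assumed on r the quotient
   may be trivial, hence only a pzRingType and lmodType; the compatibility of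
   scaling with the product is alg_quot_scalerAl and alg_quot_scalerAr. *)
Section AlgQuotientType.
Variables (K : comNzRingType) (A : algType K) (r : A -> A -> Prop).

Inductive rel_ideal : A -> Prop :=
| rel_ideal_gen a b : r a b -> rel_ideal (a - b)
| rel_ideal0 : rel_ideal 0
| rel_idealD a b : rel_ideal a -> rel_ideal b -> rel_ideal (a + b)
| rel_idealMl a b : rel_ideal b -> rel_ideal (a * b)
| rel_idealMr a b : rel_ideal a -> rel_ideal (a * b).

Definition rel_cong : rel A := fun a b => `[< rel_ideal (a - b) >].

Lemma rel_congP a b : reflect (rel_ideal (a - b)) (rel_cong a b).
Proof. exact: asboolP. Qed.

Fact rel_cong_class : equiv_class_of rel_cong.
Proof.
have sym a b : rel_cong a b -> rel_cong b a.
  by move=> /rel_congP h; apply/rel_congP; rewrite -opprB -mulN1r; exact: rel_idealMl.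
split=> [a|a b|b a c /rel_congP ab /rel_congP bc].
- by apply/rel_congP; rewrite subrr; exact: rel_ideal0.
- by apply/idP/idP; exact: sym.
- by apply/rel_congP; rewrite -(subrK b a) -addrA; exact: rel_idealD.
Qed.

Canonical rel_cong_equiv := EquivRelPack rel_cong_class.
Canonical rel_cong_encModRel := defaultEncModRel rel_cong.

Definition alg_quot : Type := {eq_quot rel_cong}.

HB.instance Definition _ := Choice.on alg_quot.
HB.instance Definition _ := EqQuotient.on alg_quot.

End AlgQuotientType.

HB.lock Definition quot_pi (K : comNzRingType) (A : algType K)
  (r : A -> A -> Prop) (a : A) : alg_quot r := \pi_(alg_quot r) a.

Section AlgQuotientTheory.
Variables (K : comNzRingType) (A : algType K) (r : A -> A -> Prop).
Local Notation alg_quot := (alg_quot r).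
Local Notation quot_pi := (quot_pi r).
Local Notation rel_ideal := (rel_ideal r).

Lemma quot_pi_repr (x : alg_quot) : quot_pi (repr x) = x.
Proof. by rewrite unlock reprK. Qed.

Lemma alg_quotP (a b : A) : quot_pi a = quot_pi b <-> rel_ideal (a - b).
Proof.
by rewrite unlock; split=> [/eqmodP/rel_congP //|h]; apply/eqmodP/rel_congP.
Qed.

Lemma alg_quotW (P : alg_quot -> Prop) :
  (forall a, P (quot_pi a)) -> forall x, P x.
Proof. by move=> h x; rewrite -[x]quot_pi_repr. Qed.

Definition quot_zero : alg_quot := quot_pi 0.
Definition quot_one : alg_quot := quot_pi 1.
Definition quot_opp (x : alg_quot) : alg_quot := quot_pi (- repr x).
Definition quot_add (x y : alg_quot) : alg_quot := quot_pi (repr x + repr y).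
Definition quot_mul (x y : alg_quot) : alg_quot := quot_pi (repr x * repr y).
Definition quot_scale (c : K) (x : alg_quot) : alg_quot := quot_pi (c *: repr x).

Lemma pi_repr (a : A) : rel_ideal (repr (quot_pi a) - a).
Proof. by apply/alg_quotP; rewrite quot_pi_repr. Qed.

Lemma quot_oppE a : quot_opp (quot_pi a) = quot_pi (- a).
Proof.
by apply/alg_quotP; rewrite -opprD -mulN1r; apply: rel_idealMl; exact: pi_repr.
Qed.

Lemma quot_addE a b : quot_add (quot_pi a) (quot_pi b) = quot_pi (a + b).
Proof.
by apply/alg_quotP; rewrite opprD addrACA; apply: rel_idealD; exact: pi_repr.
Qed.

Lemma quot_mulE a b : quot_mul (quot_pi a) (quot_pi b) = quot_pi (a * b).
Proof.
apply/alg_quotP; set a' := repr _; set b' := repr _.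
have -> : a' * b' - a * b = (a' - a) * b' + a * (b' - b).
  by rewrite mulrBl mulrBr addrA subrK.
by apply: rel_idealD; [apply: rel_idealMr|apply: rel_idealMl]; exact: pi_repr.
Qed.

Lemma quot_scaleE c a : quot_scale c (quot_pi a) = quot_pi (c *: a).
Proof.
apply/alg_quotP; rewrite -scalerBr -mulr_algl.
by apply: rel_idealMl; exact: pi_repr.
Qed.

Let quotE := (quot_oppE, quot_addE, quot_mulE, quot_scaleE).

Fact quot_addA : associative quot_add.
Proof. by move=> x y z; elim/alg_quotW: x => a; elim/alg_quotW: y => b; elim/alg_quotW: z => c;
rewrite !quotE addrA. Qed.
Fact quot_addC : commutative quot_add.
Proof. by move=> x y; elim/alg_quotW: x => a; elim/alg_quotW: y => b; rewrite !quotE addrC. Qed.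
Fact quot_add0 : left_id quot_zero quot_add.
Proof. by move=> x; elim/alg_quotW: x => a; rewrite !quotE add0r. Qed.
Fact quot_addN : left_inverse quot_zero quot_opp quot_add.
Proof. by move=> x; elim/alg_quotW: x => a; rewrite !quotE addNr. Qed.

HB.instance Definition _ :=
  GRing.isZmodule.Build alg_quot quot_addA quot_addC quot_add0 quot_addN.

Fact quot_mulA : associative quot_mul.
Proof. by move=> x y z; elim/alg_quotW: x => a; elim/alg_quotW: y => b; elim/alg_quotW: z => c;
rewrite !quotE mulrA. Qed.
Fact quot_mul1l : left_id quot_one quot_mul.
Proof. by move=> x; elim/alg_quotW: x => a; rewrite !quotE mul1r. Qed.
Fact quot_mul1r : right_id quot_one quot_mul.
Proof. by move=> x; elim/alg_quotW: x => a; rewrite !quotE mulr1. Qed.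
Fact quot_mulDl : left_distributive quot_mul quot_add.
Proof. by move=> x y z; elim/alg_quotW: x => a; elim/alg_quotW: y => b; elim/alg_quotW: z => c;
rewrite !quotE mulrDl. Qed.
Fact quot_mulDr : right_distributive quot_mul quot_add.
Proof. by move=> x y z; elim/alg_quotW: x => a; elim/alg_quotW: y => b; elim/alg_quotW: z => c;
rewrite !quotE mulrDr. Qed.

HB.instance Definition _ := GRing.Zmodule_isPzRing.Build alg_quot
  quot_mulA quot_mul1l quot_mul1r quot_mulDl quot_mulDr.

Fact quot_scaleA c d x : quot_scale c (quot_scale d x) = quot_scale (c * d) x.
Proof. by elim/alg_quotW: x => a; rewrite !quotE scalerA. Qed.
Fact quot_scale1 : left_id 1 quot_scale.
Proof. by move=> x; elim/alg_quotW: x => a; rewrite !quotE scale1r. Qed.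
Fact quot_scaleDr : right_distributive quot_scale quot_add.
Proof. by move=> c x y; elim/alg_quotW: x => a; elim/alg_quotW: y => b; rewrite !quotE scalerDr. Qed.
Fact quot_scaleDl x c d :
  quot_scale (c + d) x = quot_add (quot_scale c x) (quot_scale d x).
Proof. by elim/alg_quotW: x => a; rewrite !quotE scalerDl. Qed.

HB.instance Definition _ := GRing.Zmodule_isLmodule.Build K alg_quot
  quot_scaleA quot_scale1 quot_scaleDr quot_scaleDl.

Lemma alg_quot_scalerAl (c : K) (x y : alg_quot) : c *: (x * y) = (c *: x) * y.
Proof.
elim/alg_quotW: x => a; elim/alg_quotW: y => b.
by rewrite /GRing.scale /GRing.mul /= !quotE scalerAl.
Qed.

Lemma alg_quot_scalerAr (c : K) (x y : alg_quot) : c *: (x * y) = x * (c *: y).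
Proof.
elim/alg_quotW: x => a; elim/alg_quotW: y => b.
by rewrite /GRing.scale /GRing.mul /= !quotE scalerAr.
Qed.

Fact quot_pi_zmod_morphism : zmod_morphism quot_pi.
Proof.
move=> a b; apply: esym.
by apply: etrans (quot_addE a (- b)); congr quot_add; exact: quot_oppE.
Qed.
Fact quot_pi_monoid_morphism : monoid_morphism quot_pi.
Proof. by split=> // a b; apply: esym; exact: quot_mulE. Qed.
Fact quot_pi_scalable : scalable quot_pi.
Proof. by move=> c a; apply: esym; exact: quot_scaleE. Qed.

HB.instance Definition _ :=
  GRing.isZmodMorphism.Build A alg_quot quot_pi quot_pi_zmod_morphism.
HB.instance Definition _ :=
  GRing.isMonoidMorphism.Build A alg_quot quot_pi quot_pi_monoid_morphism.
HB.instance Definition _ :=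
  GRing.isScalable.Build K A alg_quot *:%R quot_pi quot_pi_scalable.

Lemma quot_pi_rel a b : r a b -> quot_pi a = quot_pi b.
Proof. by move=> rab; apply/alg_quotP; exact: rel_ideal_gen. Qed.

(* The unital K-subalgebra generated by S. *)
Inductive subalg_gen (S : set alg_quot) : set alg_quot :=
| subalg_gen_mem x : S x -> subalg_gen S x
| subalg_gen1 : subalg_gen S 1
| subalg_genD x y : subalg_gen S x -> subalg_gen S y -> subalg_gen S (x + y)
| subalg_genM x y : subalg_gen S x -> subalg_gen S y -> subalg_gen S (x * y)
| subalg_genZ c x : subalg_gen S x -> subalg_gen S (c *: x).

End AlgQuotientTheory.

Definition centre_of (R : pzRingType) (B : set R) : set R :=
  [set z | B z /\ forall x, B x -> z * x = x * z].

(* Indices are shifted by one with respect to the usual numbering: X_1 ... X_n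
   is indexed by 'I_n, and T_1 ... T_(n-1) by 'I_n.-1, so that T_k acts on the
   positions k and k.+1. *)
Inductive daha_gen (n : nat) : Type :=
| GenT of 'I_n.-1
| GenX of 'I_n
| GenXinv of 'I_n
| GenY of 'I_n
| GenYinv of 'I_n.

HB.instance Definition _ n := gen_eqMixin (daha_gen n).
HB.instance Definition _ n := gen_choiceMixin (daha_gen n).

Section Daha.
Variables (K : fieldType) (n : nat) (q tau : K).

Local Notation F := (free_alg K (daha_gen n)).
Local Notation T k := (fgen K (GenT k) : F).
Local Notation X i := (fgen K (GenX i) : F).
Local Notation X' i := (fgen K (GenXinv i) : F).
Local Notation Y i := (fgen K (GenY i) : F).
Local Notation Y' i := (fgen K (GenYinv i) : F).
(* T_k^-1, as forced by the quadratic relation; see dahaT_Tinv below. *)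
Local Notation T' k := (T k - (tau - tau^-1)%:A).
Local Notation Yprod := (\prod_(i < n) Y i).

Inductive daha_rel : F -> F -> Prop :=
| daha_quadratic k : daha_rel ((T k - tau%:A) * (T k + tau^-1%:A)) 0
| daha_braid (k l : 'I_n.-1) : l = k.+1 :> nat ->
    daha_rel (T k * T l * T k) (T l * T k * T l)
| daha_TT (k l : 'I_n.-1) : (k.+1 < l)%N || (l.+1 < k)%N ->
    daha_rel (T k * T l) (T l * T k)
| daha_TXT (k : 'I_n.-1) (i j : 'I_n) : i = k :> nat -> j = k.+1 :> nat ->
    daha_rel (T k * X i * T k) (X j)
| daha_TX (k : 'I_n.-1) (i : 'I_n) : i != k :> nat -> i != k.+1 :> nat ->
    daha_rel (T k * X i) (X i * T k)
| daha_TYT (k : 'I_n.-1) (i j : 'I_n) : i = k :> nat -> j = k.+1 :> nat ->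
    daha_rel (T' k * Y i * T' k) (Y j)
| daha_TY (k : 'I_n.-1) (i : 'I_n) : i != k :> nat -> i != k.+1 :> nat ->
    daha_rel (T k * Y i) (Y i * T k)
| daha_YX i : daha_rel (Yprod * X i) (q *: (X i * Yprod))
| daha_YXYX (k : 'I_n.-1) (i j : 'I_n) :
    k = 0%N :> nat -> i = 0%N :> nat -> j = 1%N :> nat ->
    daha_rel (Y' j * X i * Y j * X' i) (T k ^+ 2)
| daha_XX i j : daha_rel (X i * X j) (X j * X i)
| daha_XXinv i : daha_rel (X i * X' i) 1
| daha_XinvX i : daha_rel (X' i * X i) 1
| daha_YY i j : daha_rel (Y i * Y j) (Y j * Y i)
| daha_YYinv i : daha_rel (Y i * Y' i) 1
| daha_YinvY i : daha_rel (Y' i * Y i) 1.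

Local Notation daha := (alg_quot daha_rel).

Definition dahaT k : daha := quot_pi daha_rel (T k).
Definition dahaX i : daha := quot_pi daha_rel (X i).
Definition dahaXinv i : daha := quot_pi daha_rel (X' i).
Definition dahaY i : daha := quot_pi daha_rel (Y i).
Definition dahaYinv i : daha := quot_pi daha_rel (Y' i).

Fact ltn_last (i : 'I_n) : (n.-1 < n)%N.
Proof. by rewrite prednK //; exact: leq_ltn_trans (ltn_ord i). Qed.

(* The last index of 'I_n; the argument only witnesses 0 < n. *)
Definition ord_last (i : 'I_n) : 'I_n := Ordinal (ltn_last i).

Definition dahaD_last (i : 'I_n) : daha :=
  (q - q^-1)^-1 *:
    (dahaXinv (ord_last i) * (dahaY (ord_last i) - dahaYinv (ord_last i))).

(* D_i = T_i T_(i+1) ... T_(n-1) D_n T_(n-1) ... T_(i+1) T_i; the second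
   product runs through the same factors in decreasing order. *)
Definition dahaD (i : 'I_n) : daha :=
  (\prod_(k < n.-1 | (i <= k)%N) dahaT k) * dahaD_last i *
  (\prod_(k < n.-1 | (i <= rev_ord k)%N) dahaT (rev_ord k)).

Definition daha_e (i j : 'I_n) : daha := dahaX i * dahaD j.

Definition daha_gl_gens : set daha :=
  [set x | [\/ exists k, x = dahaT k,
               exists i, x = dahaY i,
               exists i, x = dahaYinv i |
               exists i j, i != j /\ x = daha_e i j]].

Definition daha_gl : set daha := subalg_gen daha_gl_gens.

Definition dahaYtilde : daha := \prod_(i < n) dahaY i.
(* The inverse of dahaYtilde, since the Y_i commute; see dahaYtildeV. *)
Definition dahaYtilde_inv : daha := \prod_(i < n) dahaYinv i.

End Daha.

Arguments daha_gl {K} n q tau _.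

Notation daha n q tau := (alg_quot (@daha_rel _ n q tau)).

Section DahaInverses.
Variables (K : fieldType) (n : nat) (q tau : K).

Lemma dahaT_Tinv (k : 'I_n.-1) : tau != 0 ->
  dahaT q tau k * (dahaT q tau k - (tau - tau^-1) *: (1 : daha n q tau)) = 1 /\
  (dahaT q tau k - (tau - tau^-1) *: (1 : daha n q tau)) * dahaT q tau k = 1.
Proof.
move=> tau0; set t := dahaT q tau k.
have Zl c (x y : daha n q tau) : (c *: x) * y = c *: (x * y).
  by rewrite -alg_quot_scalerAl.
have Zr c (x y : daha n q tau) : x * (c *: y) = c *: (x * y).
  by rewrite -alg_quot_scalerAr.
have t2 : t * t = (tau - tau^-1) *: t + 1.
  have := quot_pi_rel (daha_quadratic q tau k).
  rewrite rmorphM rmorphB rmorphD /= !quot_pi_scalable rmorph1 rmorph0 -/t.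
  rewrite mulrDr !mulrBl !Zl !Zr !mul1r !mulr1 scalerA divff // scale1r.
  move/eqP; rewrite addrA subr_eq0 => /eqP e.
  by rewrite -e scalerBl [RHS]addrC addrA [X in X - _]addrAC subrK addrK.
by rewrite mulrBr mulrBl Zl Zr mul1r mulr1 t2 addrAC subrr add0r.
Qed.

Lemma dahaYtildeV :
  dahaYtilde n q tau * dahaYtilde_inv n q tau = 1 /\
  dahaYtilde_inv n q tau * dahaYtilde n q tau = 1.
Proof.
have YV i : dahaY q tau i * dahaYinv q tau i = 1.
  by have := quot_pi_rel (daha_YYinv q tau i); rewrite rmorphM rmorph1.
have VY i : dahaYinv q tau i * dahaY q tau i = 1.
  by have := quot_pi_rel (daha_YinvY q tau i); rewrite rmorphM rmorph1.
have YY i j : dahaY q tau i * dahaY q tau j = dahaY q tau j * dahaY q tau i.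
  by have := quot_pi_rel (daha_YY q tau i j); rewrite !rmorphM.
have comm i j : GRing.comm (dahaY q tau i) (dahaYinv q tau j).
  have e : dahaY q tau i = dahaYinv q tau j * (dahaY q tau i * dahaY q tau j).
    by rewrite YY mulrA VY mul1r.
  by rewrite /GRing.comm [in LHS]e -!mulrA YV mulr1.
split; rewrite -prodrM_comm.
- by rewrite big1.
- by move=> i j _ _; exact: comm.
- by rewrite big1.
- by move=> i j _ _; exact/commr_sym/comm.
Qed.

End DahaInverses.

(* The field C(tau), with C = R[i]. *)
Definition Ctau (R : realType) : fieldType := {fraction {poly R[i]}}.
Definition Cconst (R : realType) (c : R[i]) : Ctau R := tofrac c%:P.
Definition tauvar (R : realType) : Ctau R := tofrac 'X.

(* Main.v *)
(** The representation of the double affine Hecke algebra by Demazure-Lusztig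
    operators degenerates at tau = 1 to the quantum torus extended by the
    symmetric group, where the monomials X^a w Y^b act by linearly independent
    operators because q is not a root of unity.

    The straightening relations show that the monomials X^a T_w Y^b span the
    algebra over C(tau).  Expand a central element z of the subalgebra in these
    monomials and drop the terms that are powers of Ytilde, which are central;
    let z' be the rest.  If z' is nonzero, rescale it so that its coefficients
    are regular at tau = 1 and do not all vanish there.  The limit of z'
    commutes with every Y_i, which forces a = 0 and w = 1 in each surviving
    term, and with the limits X_i X_j^-1 (Y_j - Y_j^-1) of the e_ij, up to a
    scalar, which forces all b_i to be equal.  So only powers of Ytilde
    survive, although those were dropped: a contradiction.

    In both directions the relations between the X_i and the Y_j are handled
    through pi = (T_1 ... T_(n-1))^-1 Y_1, which satisfies pi X_(i+1) = X_i pi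
    and pi X_1 = q X_n pi. *)

From HB Require Import structures.
Require Import Defs.
From mathcomp Require Import all_boot all_order all_algebra.
From mathcomp Require Import generic_quotient.
From mathcomp Require Import boolp classical_sets reals complex.
From mathcomp Require Import finmap monalg.
From mathcomp Require Import zify ring.

Set Implicit Arguments.
Unset Strict Implicit.
Unset Printing Implicit Defensive.

Import Order.TTheory GRing.Theory Num.Theory.
Local Open Scope ring_scope.

(** * Universal properties *)

(** The operators act on arbitrary functions on a set of points of the torus instead of Laurent
    polynomials. A point is a vector h of integers, pairwise distinct modulo n, and has coordinates
    x_i = [w]^(h_i), where [w] is an n-th root of q; such a root exists because C is algebraically
    closed. The denominators of the Demazure-Lusztig operators become nonzero scalars, and
    multiplying x_i by q is shifting h_i by n. Distinct pairs of a permutation and a shift move a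
    point to distinct points, so delta functions separate these pairs and characters separate the
    exponents of X. Independence enters at tau = 1 alone: spanning yields some expansion of a
    central element, and the limit of that expansion already gives the contradiction. There,
    commutation with Y_i and with e_ij becomes a recurrence for the coefficients along a line of
    exponents b, and finite support stops a nonzero coefficient from propagating forever. The
    relations are derived for sequences indexed by natural numbers in an arbitrary ring, because
    they are needed both in the quotient algebra and for the operators. *)

Section FreeAlgebra.
Variables (K : fieldType) (G : choiceType).

Lemma free_alg_universal (A : algType K) (g : G -> A) :
  exists phi : {lrmorphism free_alg K G -> A},
    forall x, phi (fgen K x) = g x.
Proof.
rewrite /fgen unlock /=.
pose h (w : {fmonom G}) : A := \prod_(x <- (w : seq G)) g x.
have hM : mmorphism h.
  by split=> [u v|]; rewrite /h ?fmM ?big_cat // fm1 big_nil.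
pose hm : {mmorphism {fmonom G} -> A} :=
  HB.pack h (isMultiplicative.Build {fmonom G} A h hM).
pose phi (x : fmonom_alg K G) : A := mmap (in_alg A) hm x.
have phiD : zmod_morphism phi by move=> a b; exact: raddfB.
have phiM : monoid_morphism phi.
  have [hm1 hm2] : multiplicative (mmap (in_alg A) hm).
    apply: commr_mmap_is_multiplicative => a u v.
    by rewrite /GRing.comm mulr_algl mulr_algr.
  by split=> [|a b]; [exact: hm2|exact: hm1].
have phiZ : scalable phi.
  by move=> c a; rewrite /phi mmapZ /= mulr_algl.
pose phiL : {lrmorphism fmonom_alg K G -> A} :=
  HB.pack phi (GRing.isZmodMorphism.Build _ _ phi phiD)
   (GRing.isMonoidMorphism.Build _ _ phi phiM)
   (GRing.isScalable.Build _ _ _ _ phi phiZ).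
exists phiL => x; rewrite /= /phi mmapU /= /h fmU big_seq1.
by rewrite scale1r mul1r.
Qed.

(** Words grow by letters added on the left, so stability under left multiplication by generators
    suffices. This is the criterion by which the normal monomials are shown to span. *)
Lemma free_alg_ind (S : free_alg K G -> Prop) :
  S 1 -> (forall a b, S a -> S b -> S (a + b)) ->
  (forall c a, S a -> S (c *: a)) ->
  (forall x a, S a -> S (fgen K x * a)) -> forall a, S a.
Proof.
move: S; rewrite /fgen unlock /= => S S1 SD SZ SG a.
have S0 : S 0 by rewrite -(scale0r 1); exact: SZ.
have SU (w : {fmonom G}) : S (mkmalgU w 1 : fmonom_alg K G).
  case: w => w; elim: w => [|x w IH].
    suff -> : FMonom [::] = (@mone {fmonom G}) by exact: S1.
    by apply/eqP; rewrite fmP fm1.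
  suff -> : (mkmalgU (FMonom (x :: w)) 1 : fmonom_alg K G) =
     (mkmalgU (fmu x) 1 : fmonom_alg K G) * mkmalgU (FMonom w) 1 by exact: SG.
  rewrite [RHS]malgM_def fgmulUU mulr1; congr mkmalgU.
  by apply/eqP; rewrite fmP fmM fmU.
rewrite (monalgE a); elim: (finmap.enum_fset _) => [|w s IH].
  by rewrite big_nil.
rewrite big_cons; apply: SD => //.
suff -> : mkmalgU w a@_w = a@_w *: (mkmalgU w 1 : fmonom_alg K G) by exact: SZ.
by apply/malgP => k; rewrite [RHS]mcoeffZ !mcoeffU mulrnAr mulr1.
Qed.

End FreeAlgebra.

Section QuotientAlgebra.
Variables (K : fieldType) (A : algType K) (r : A -> A -> Prop).

(** The map is evaluated on chosen representatives; the ideal generated by the relations lies in the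
    kernel of [phi], so the choice is immaterial. Linearity is a separate clause because the
    quotient carries only a ring and a module structure. *)
Lemma alg_quot_universal (B : algType K) (phi : {lrmorphism A -> B}) :
  (forall a b, r a b -> phi a = phi b) ->
  exists psi : {rmorphism alg_quot r -> B},
   (forall c x, psi (c *: x) = c *: psi x) /\
   (forall a, psi (quot_pi r a) = phi a).
Proof.
move=> rphi.
have ideal0 a : rel_ideal r a -> phi a = 0.
  elim=> {a} [a b /rphi e||a b _ ea _ eb|a b _ e|a b _ e].
  - by rewrite rmorphB /= e subrr.
  - exact: rmorph0.
  - by rewrite rmorphD /= ea eb addr0.
  - by rewrite rmorphM /= e mulr0.
  - by rewrite rmorphM /= e mul0r.
pose psi (x : alg_quot r) := phi (repr x).
have psiE a : psi (quot_pi r a) = phi a.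
  by apply/eqP; rewrite -subr_eq0 -rmorphB; apply/eqP/ideal0/pi_repr.
have psiB : zmod_morphism psi.
  move=> x y; elim/alg_quotW: x => a; elim/alg_quotW: y => b.
  by rewrite -rmorphB !psiE rmorphB.
have psiM : monoid_morphism psi.
  split=> [|x y]; first by rewrite -(rmorph1 (quot_pi r)) psiE rmorph1.
  elim/alg_quotW: x => a; elim/alg_quotW: y => b.
  by rewrite -rmorphM !psiE rmorphM.
pose psiR : {rmorphism alg_quot r -> B} :=
  HB.pack psi (GRing.isZmodMorphism.Build _ _ psi psiB)
   (GRing.isMonoidMorphism.Build _ _ psi psiM).
exists psiR; split=> [c x|a]; last exact: psiE.
by elim/alg_quotW: x => a /=; rewrite -quot_pi_scalable !psiE linearZ.
Qed.

End QuotientAlgebra.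

(** * Braid and cross relations *)

Section Inverses.
Variable A : pzRingType.
Implicit Types x y z : A.

(** Inverses are carried throughout as explicit elements with their two equations, since the rings
    in use have no inversion operation. *)
Lemma commr_inverse x y yi :
  y * yi = 1 -> yi * y = 1 -> x * y = y * x -> x * yi = yi * x.
Proof.
by move=> yV Vy e; rewrite -[LHS]mul1r -Vy -!mulrA (mulrA y) -e -mulrA yV mulr1.
Qed.

Lemma conjr_inverse x y yi z :
  y * yi = 1 -> yi * y = 1 -> x * y = y * z -> yi * x = z * yi.
Proof.
by move=> yV Vy e; rewrite -[LHS]mulr1 -yV !mulrA -(mulrA yi x) e !mulrA Vy mul1r.
Qed.

Lemma mulKr_inverse x y yi : yi * y = 1 -> yi * (y * x) = x.
Proof. by move=> Vy; rewrite mulrA Vy mul1r. Qed.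

Lemma mulrK_inverse x y yi : y * yi = 1 -> x * y * yi = x.
Proof. by move=> yV; rewrite -mulrA yV mulr1. Qed.

Lemma commr_prod_nat x (F : nat -> A) i j :
  (forall k, (i <= k < j)%N -> x * F k = F k * x) ->
  x * (\prod_(i <= k < j) F k) = (\prod_(i <= k < j) F k) * x.
Proof.
move=> h; rewrite big_seq; apply: commr_prod => k.
by rewrite mem_index_iota; exact: h.
Qed.

End Inverses.

(** * Sliding braid generators along ascending runs *)

Section BraidGroup.
Variables (A : pzRingType) (m : nat) (T Ti : nat -> A).
Hypothesis TTi : forall k, (k < m)%N -> T k * Ti k = 1.
Hypothesis TiT : forall k, (k < m)%N -> Ti k * T k = 1.
Hypothesis TTT : forall k, (k.+1 < m)%N ->
  T k * T k.+1 * T k = T k.+1 * T k * T k.+1.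
Hypothesis TT : forall k l, (k.+1 < l)%N -> (l < m)%N -> T k * T l = T l * T k.

Definition ascT i j := \prod_(i <= k < j) T k.
Fixpoint descT k : A := if k is k'.+1 then T k' * descT k' else 1.
(** Inverse of [ascT 0 k], not of [descT k]: both the order and the letters are inverted. *)
Fixpoint descTi k : A := if k is k'.+1 then Ti k' * descTi k' else 1.

Lemma ascT_inv k : (k <= m)%N -> ascT 0 k * descTi k = 1.
Proof.
elim: k => [|k IH] km; first by rewrite /ascT big_geq // mulr1.
rewrite /ascT big_nat_recr //= mulrA (mulrK_inverse _ (TTi km)).
by apply: IH; lia.
Qed.

Lemma descTi_inv k : (k <= m)%N -> descTi k * ascT 0 k = 1.
Proof.
elim: k => [|k IH] km; first by rewrite /ascT big_geq // mulr1.
rewrite /ascT big_nat_recr //= -mulrA (mulrA (descTi k)) IH ?mul1r ?TiT //; lia.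
Qed.

Lemma ascT_comm i j k : (k < i.-1)%N || (j < k)%N -> (j <= m)%N -> (k < m)%N ->
  T k * ascT i j = ascT i j * T k.
Proof.
move=> kij jm km; apply: commr_prod_nat => l lij.
have [kl|lk] := ltnP k l; first by (apply: TT; lia).
by apply/esym/TT; lia.
Qed.

(** T_(k+1) commutes with the letters below k, the braid relation carries it through T_k T_(k+1),
    where it comes out as T_k, and T_k commutes with the letters above k+1. *)
Lemma ascT_shift i j k : (i <= k)%N -> (k.+1 < j)%N -> (j <= m)%N ->
  T k.+1 * ascT i j = ascT i j * T k.
Proof.
move=> ik kj jm.
have -> : ascT i j = ascT i k * (T k * T k.+1) * ascT k.+2 j.
  rewrite /ascT (big_cat_nat (n := k)) /=; [|lia|lia].
  by rewrite (@big_ltn _ _ _ k) ?(@big_ltn _ _ _ k.+1) ?mulrA //; lia.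
have e1 : T k.+1 * ascT i k = ascT i k * T k.+1 by apply: ascT_comm; lia.
have e2 : T k * ascT k.+2 j = ascT k.+2 j * T k by apply: ascT_comm; lia.
rewrite !mulrA e1 -(mulrA _ (ascT k.+2 j)) -e2 !mulrA; congr (_ * _).
by rewrite -!mulrA; congr (_ * _); rewrite !mulrA TTT //; lia.
Qed.

Lemma descTi_shift k : (k.+1 < m)%N -> descTi m * T k.+1 = T k * descTi m.
Proof.
move=> km; apply: (conjr_inverse (y := ascT 0 m)).
- exact: ascT_inv.
- exact: descTi_inv.
- exact: ascT_shift.
Qed.

Lemma commr_descT x k :
  (forall l, (l < k)%N -> x * T l = T l * x) -> x * descT k = descT k * x.
Proof.
elim: k => [|k IH] h /=; first by rewrite mulr1 mul1r.
by rewrite mulrA h // -!mulrA IH // => l lk; apply: h; lia.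
Qed.

End BraidGroup.

(** * Passing X_0 through products of the Y_i *)

Section CrossRelation.
Variables (A : pzRingType) (m : nat) (T Ti X Y : nat -> A).
Hypothesis TTi : forall k, (k < m)%N -> T k * Ti k = 1.
Hypothesis TiT : forall k, (k < m)%N -> Ti k * T k = 1.
Hypothesis TTT : forall k, (k.+1 < m)%N ->
  T k * T k.+1 * T k = T k.+1 * T k * T k.+1.
Hypothesis TT : forall k l, (k.+1 < l)%N -> (l < m)%N -> T k * T l = T l * T k.
Hypothesis TX : forall k i, (k < m)%N -> (i <= m)%N -> i != k -> i != k.+1 ->
  T k * X i = X i * T k.
Hypothesis TYT : forall k, (k < m)%N -> Ti k * Y k * Ti k = Y k.+1.
Hypothesis TY : forall k i, (k < m)%N -> (i <= m)%N -> i != k -> i != k.+1 ->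
  T k * Y i = Y i * T k.
Hypothesis X0Y1 : (0 < m)%N -> X 0 * Y 1 = Y 1 * (T 0 * T 0) * X 0.

(** The pure braid T_k ... T_1 T_0^2 T_1^-1 ... T_k^-1, which measures the failure of X_0 and
    Y_(k+1) to commute. *)
Fixpoint crossT k : A :=
  if k is k'.+1 then T k'.+1 * crossT k' * Ti k'.+1 else T 0 * T 0.

Lemma X0_Ti k : (0 < k < m)%N -> X 0 * Ti k = Ti k * X 0.
Proof.
move=> km; apply: (commr_inverse (y := T k)).
- by apply: TTi; lia.
- by apply: TiT; lia.
- by rewrite TX //; lia.
Qed.

Lemma X0_Y k : (k < m)%N -> X 0 * Y k.+1 = Y k.+1 * crossT k * X 0.
Proof.
elim: k => [|k IH] km; first exact: X0Y1.
rewrite -(TYT km) !mulrA X0_Ti; last by lia.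
rewrite -(mulrA _ (X 0)) IH; last by lia.
rewrite /= -!mulrA X0_Ti; last by lia.
by rewrite (mulrA (Ti k.+1) (T k.+1)) TiT // mul1r.
Qed.

(** In the induction T_(k+1) commutes with [descT k], and two braid moves turn T_k T_(k+1) T_k T_k
    T_(k+1)^-1 into T_(k+1)^2 T_k. This is what makes the cross terms telescope in a product of
    Y_i. *)
Lemma descT_crossT k : (k < m)%N ->
  descT T k * crossT k = T k * T k * descT T k.
Proof.
elim: k => [|k IH] km; first by rewrite /= mul1r mulr1.
have comm x : (forall l, (l < k)%N -> x * T l = T l * x) ->
   x * descT T k = descT T k * x by exact: commr_descT.
rewrite /= !mulrA -(mulrA (T k)) -comm; last first.
  by move=> l lk; apply/esym/TT; lia.
rewrite -!mulrA (mulrA (descT T k)) IH; last by lia.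
rewrite -mulrA -comm; last first.
  move=> l lk; apply/esym; apply: (commr_inverse (TTi km) (TiT km)).
  by rewrite TT //; lia.
rewrite !mulrA; congr (_ * _).
rewrite TTT // -!mulrA; congr (_ * _).
by rewrite !mulrA TTT // -mulrA TTi // mulr1.
Qed.

(** Each new factor Y_(k+1) contributes a [crossT k], which [descT_crossT] merges into the
    palindrome T_0 ... T_k T_k ... T_0. *)
Lemma X0_prodY k : (k <= m)%N ->
  X 0 * (\prod_(1 <= i < k.+1) Y i) =
  (\prod_(1 <= i < k.+1) Y i) * (ascT T 0 k * descT T k) * X 0.
Proof.
elim: k => [|k IH] km; first by rewrite /ascT !big_geq // !mulr1 mul1r.
rewrite big_nat_recr //= mulrA IH; last by lia.
rewrite -(mulrA _ (X 0)) X0_Y // -!mulrA; congr (_ * _).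
have Yasc : Y k.+1 * ascT T 0 k = ascT T 0 k * Y k.+1.
  by apply: commr_prod_nat => l lk; rewrite TY //; lia.
have Ydesc : Y k.+1 * descT T k = descT T k * Y k.+1.
  by apply: commr_descT => l lk; rewrite TY //; lia.
rewrite (mulrA (descT T k)) -Ydesc -(mulrA (Y k.+1)) (mulrA (ascT T 0 k)) -Yasc.
rewrite -mulrA (mulrA (descT T k)) descT_crossT // /ascT big_nat_recr //=.
by rewrite -!mulrA.
Qed.

End CrossRelation.

Lemma conjr_prod_nat (A : pzRingType) (x : A) (F G : nat -> A) j :
  (forall k, (k < j)%N -> x * F k = G k * x) ->
  x * (\prod_(0 <= k < j) F k) = (\prod_(0 <= k < j) G k) * x.
Proof.
elim: j => [|j IH] h; first by rewrite !big_geq // mulr1 mul1r.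
rewrite !big_nat_recr //= mulrA IH; last by (move=> k kj; apply: h; lia).
by rewrite -!mulrA h.
Qed.

Lemma mulr_prod_inj (A : pzRingType) (F G : nat -> A) i j (a b : A) :
  (forall k, (i <= k < j)%N -> G k * F k = 1) ->
  (\prod_(i <= k < j) F k) * a = (\prod_(i <= k < j) F k) * b -> a = b.
Proof.
elim: j a b => [|j IH] a b GF; first by rewrite !big_geq // !mul1r.
have [ij|ji] := leqP i j; last by rewrite !big_geq // !mul1r.
rewrite !big_nat_recr //= -!mulrA => /IH e.
rewrite -(mulKr_inverse a (GF j _)) ?e ?mulKr_inverse // ?GF //; try lia.
by move=> k kj; apply: GF; lia.
Qed.

Section XConjugation.
Variables (A : pzRingType) (m : nat) (T X : nat -> A).
Hypothesis TXT : forall k, (k < m)%N -> T k * X k * T k = X k.+1.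

Lemma X_descT_ascT k : (k <= m)%N -> X k = descT T k * X 0 * ascT T 0 k.
Proof.
elim: k => [|k IH] km; first by rewrite /ascT big_geq //= mulr1 mul1r.
rewrite -TXT // IH; last by lia.
by rewrite /ascT big_nat_recr //= -!mulrA.
Qed.

End XConjugation.

Section YConjugation.
Variables (A : pzRingType) (m : nat) (T Ti Y : nat -> A).
Hypothesis TTi : forall k, (k < m)%N -> T k * Ti k = 1.
Hypothesis TiT : forall k, (k < m)%N -> Ti k * T k = 1.
Hypothesis TYT : forall k, (k < m)%N -> Ti k * Y k * Ti k = Y k.+1.

Hypothesis TY : forall k i, (k < m)%N -> (i <= m)%N -> i != k -> i != k.+1 ->
  T k * Y i = Y i * T k.
Hypothesis YY : forall i j, (i <= m)%N -> (j <= m)%N -> Y i * Y j = Y j * Y i.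

(** With Y_(k+1) = T_k^-1 Y_k T_k^-1, both sides are Y_k T_k^-1 Y_k. *)
Lemma T_YY k : (k < m)%N -> T k * (Y k * Y k.+1) = Y k * Y k.+1 * T k.
Proof.
move=> km; rewrite {1}YY; [|lia|lia].
rewrite -TYT // !mulrA TTi // mul1r -!mulrA; congr (_ * _).
by rewrite TiT // mulr1.
Qed.

Lemma T_prodY k : (k < m)%N ->
  T k * (\prod_(0 <= i < m.+1) Y i) = (\prod_(0 <= i < m.+1) Y i) * T k.
Proof.
move=> km.
have -> : \prod_(0 <= i < m.+1) Y i =
   (\prod_(0 <= i < k) Y i) * (Y k * Y k.+1) * (\prod_(k.+2 <= i < m.+1) Y i).
  rewrite (big_cat_nat (n := k)) /=; [|lia|lia].
  by rewrite (@big_ltn _ _ _ k) ?(@big_ltn _ _ _ k.+1) ?mulrA //; lia.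
have e1 : T k * (\prod_(0 <= i < k) Y i) = (\prod_(0 <= i < k) Y i) * T k.
  by apply: commr_prod_nat => i ik; apply: TY; lia.
have e2 : T k * (\prod_(k.+2 <= i < m.+1) Y i) =
    (\prod_(k.+2 <= i < m.+1) Y i) * T k.
  by apply: commr_prod_nat => i ik; apply: TY; lia.
by apply: commrM e2; apply: commrM e1 _; exact: T_YY.
Qed.

End YConjugation.

(** * From the Y_i to pi *)

Section ForwardPi.
Variables (A : pzRingType) (m : nat) (T Ti X Y Yi : nat -> A) (Q : A).
Hypothesis m_gt0 : (0 < m)%N.
Hypothesis TTi : forall k, (k < m)%N -> T k * Ti k = 1.
Hypothesis TiT : forall k, (k < m)%N -> Ti k * T k = 1.
Hypothesis TTT : forall k, (k.+1 < m)%N ->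
  T k * T k.+1 * T k = T k.+1 * T k * T k.+1.
Hypothesis TT : forall k l, (k.+1 < l)%N -> (l < m)%N -> T k * T l = T l * T k.
Hypothesis TXT : forall k, (k < m)%N -> T k * X k * T k = X k.+1.
Hypothesis TX : forall k i, (k < m)%N -> (i <= m)%N -> i != k -> i != k.+1 ->
  T k * X i = X i * T k.
Hypothesis TYT : forall k, (k < m)%N -> Ti k * Y k * Ti k = Y k.+1.
Hypothesis TY : forall k i, (k < m)%N -> (i <= m)%N -> i != k -> i != k.+1 ->
  T k * Y i = Y i * T k.
Hypothesis YY : forall i j, (i <= m)%N -> (j <= m)%N -> Y i * Y j = Y j * Y i.
Hypothesis YiY : forall i, (i <= m)%N -> Yi i * Y i = 1.
Hypothesis X0Y1 : X 0 * Y 1 = Y 1 * (T 0 * T 0) * X 0.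
Hypothesis Qcomm : forall x, Q * x = x * Q.
Hypothesis YX0 : (\prod_(0 <= i < m.+1) Y i) * X 0 =
  Q * (X 0 * (\prod_(0 <= i < m.+1) Y i)).

(* The length-zero generator of the extended affine Weyl group. *)
Definition cyclicT := descTi Ti m * Y 0.

Lemma cyclicT_T k : (k.+1 < m)%N -> cyclicT * T k.+1 = T k * cyclicT.
Proof.
move=> km; rewrite /cyclicT -mulrA -TY // mulrA.
by rewrite (descTi_shift TTi TiT TTT TT) // -!mulrA.
Qed.

(** Conjugation by the T_i carries the relation from each index to the next, so only X_1 remains.
    There the cross relation takes the form X_0 T_0^-1 Y_0 = T_0^-1 Y_0 X_1, and the other letters
    of pi commute with X_0. *)
Lemma cyclicT_X i : (i < m)%N -> cyclicT * X i.+1 = X i * cyclicT.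
Proof.
have descasc := descTi_inv TiT (leqnn m).
have ascdesc := ascT_inv TTi (leqnn m).
elim: i => [|i IH] im; last first.
  move: cyclicT cyclicT_T IH => c cT IH.
  rewrite -(TXT im) !mulrA cT // -(mulrA _ c) IH; last by lia.
  by rewrite -mulrA -mulrA cT // !mulrA TXT //; lia.
have asc0 : ascT T 0 m = T 0 * ascT T 1 m by rewrite /ascT big_ltn.
(* [D] is the inverse of T_1 ... T_(m-1), whose letters all commute with X_0. *)
pose D := descTi Ti m * T 0.
have DX0 : X 0 * D = D * X 0.
  apply: (commr_inverse (y := ascT T 1 m)).
  - have -> : ascT T 1 m = Ti 0 * ascT T 0 m by rewrite asc0 mulrA TiT // mul1r.
    by rewrite /D -mulrA (mulrA (ascT T 0 m)) ascdesc mul1r TiT.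
  - by rewrite /D -mulrA -asc0.
  - by apply: commr_prod_nat => k km; rewrite TX //; lia.
have DE : descTi Ti m = D * Ti 0 by rewrite /D -mulrA TTi // mulr1.
have e : X 0 * Ti 0 * Y 0 = Ti 0 * Y 0 * X 1.
  have := X0Y1; rewrite -TYT // => /(congr1 (fun z => z * T 0)).
  rewrite -!mulrA TiT // mulr1 => ->.
  by rewrite (mulrA (Ti 0) (T 0)) TiT // mul1r -TXT // !mulrA.
rewrite /cyclicT DE; clearbody D.
by rewrite -!mulrA (mulrA (Ti 0)) -e !mulrA DX0 -!mulrA.
Qed.

(** Ytilde is Z Y_0 with Z = Y_1 ... Y_m. Moving X_0 through Z in the relation for Ytilde X_0 leaves
    Z as a common left factor, which is cancelled. *)
Lemma Y0_X0 : Y 0 * X 0 = Q * (ascT T 0 m * descT T m) * X 0 * Y 0.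
Proof.
have X0Z := X0_prodY TTi TiT TTT TT TX TYT TY (fun=> X0Y1) (leqnn m).
set Z := \prod_(1 <= i < m.+1) Y i in X0Z.
have YZ : \prod_(0 <= i < m.+1) Y i = Z * Y 0.
  rewrite big_ltn // -/Z; apply: commr_prod_nat => i im; apply: YY; lia.
apply: (@mulr_prod_inj _ Y Yi 1 m.+1) => [k km|]; first by (apply: YiY; lia).
rewrite -/Z mulrA -YZ YX0 YZ (mulrA (X 0)) X0Z.
by rewrite !mulrA (Qcomm Z).
Qed.

Lemma cyclicT_X0 : cyclicT * X 0 = Q * X m * cyclicT.
Proof.
have descasc := descTi_inv TiT (leqnn m).
have ascdesc := ascT_inv TTi (leqnn m).
rewrite /cyclicT -mulrA Y0_X0 (X_descT_ascT TXT (leqnn m)).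
rewrite -!mulrA (mulrA (ascT T 0 m) (descTi Ti m)) ascdesc mul1r.
by rewrite mulrA -Qcomm -!mulrA; congr (_ * _); rewrite mulrA descasc mul1r.
Qed.

End ForwardPi.

(** * From pi to the Y_i *)

Section BackwardPi.
Variables (A : pzRingType) (m : nat) (T Ti X : nat -> A) (pi Q : A).
Hypothesis m_gt0 : (0 < m)%N.
Hypothesis TTi : forall k, (k < m)%N -> T k * Ti k = 1.
Hypothesis TiT : forall k, (k < m)%N -> Ti k * T k = 1.
Hypothesis TTT : forall k, (k.+1 < m)%N ->
  T k * T k.+1 * T k = T k.+1 * T k * T k.+1.
Hypothesis TT : forall k l, (k.+1 < l)%N -> (l < m)%N -> T k * T l = T l * T k.
Hypothesis TXT : forall k, (k < m)%N -> T k * X k * T k = X k.+1.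
Hypothesis TX : forall k i, (k < m)%N -> (i <= m)%N -> i != k -> i != k.+1 ->
  T k * X i = X i * T k.
Hypothesis piT : forall k, (k.+1 < m)%N -> pi * T k.+1 = T k * pi.
Hypothesis pi2T : pi * pi * T 0 = T m.-1 * (pi * pi).
Hypothesis piX : forall i, (i < m)%N -> pi * X i.+1 = X i * pi.
Hypothesis piX0 : pi * X 0 = Q * X m * pi.
Hypothesis Qcomm : forall x, Q * x = x * Q.

(** The inverse of the construction of [cyclicT]: pi is given and the Y_k are built from it. In the
    representation only T, X and pi have explicit formulas, so the relations of the Y_k have to be
    derived from those of pi. *)
Fixpoint jucysY k : A :=
  if k is k'.+1 then Ti k' * jucysY k' * Ti k' else ascT T 0 m * pi.
Local Notation Y := jucysY.

Lemma T_jucysY_gt i k : (i < k)%N -> (k < m)%N -> T k * Y i = Y i * T k.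
Proof.
elim: i => [|i IH] ik km.
  case: k ik km => // k _ km /=.
  by rewrite mulrA (ascT_shift TTT TT) // -!mulrA piT.
have TTik : T k * Ti i = Ti i * T k.
  apply: commr_inverse; [apply: TTi; lia|apply: TiT; lia|].
  by apply/esym/TT; lia.
by rewrite /= !mulrA TTik -(mulrA _ (T k)) IH ?mulrA -?(mulrA _ (T k)) ?TTik ?mulrA //; lia.
Qed.

(** T_k passes T_(k+1)^-1 T_k^-1 as T_(k+1), commutes with Y_k, and turns back into T_k on passing
    T_k^-1 T_(k+1)^-1. *)
Lemma T_jucysY2 k : (k.+1 < m)%N -> T k * Y k.+2 = Y k.+2 * T k.
Proof.
move=> km.
have [h1 h2 h3 h4] : [/\ T k * Ti k = 1, Ti k * T k = 1,
    T k.+1 * Ti k.+1 = 1 & Ti k.+1 * T k.+1 = 1].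
  by split; (apply: TTi || apply: TiT); lia.
have e1 : (Ti k.+1 * Ti k) * T k.+1 = T k * (Ti k.+1 * Ti k).
  apply: (conjr_inverse (y := T k * T k.+1)).
  - by rewrite !mulrA (mulrK_inverse _ h3).
  - by rewrite !mulrA (mulrK_inverse _ h2).
  - by rewrite TTT // !mulrA.
have e2 : (Ti k * Ti k.+1) * T k = T k.+1 * (Ti k * Ti k.+1).
  apply: (conjr_inverse (y := T k.+1 * T k)).
  - by rewrite !mulrA (mulrK_inverse _ h1).
  - by rewrite !mulrA (mulrK_inverse _ h4).
  - by rewrite -TTT // !mulrA.
have -> : Y k.+2 = Ti k.+1 * Ti k * Y k * (Ti k * Ti k.+1) by rewrite /= !mulrA.
have e3 : T k.+1 * Y k = Y k * T k.+1 by apply: T_jucysY_gt.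
move: (Ti k.+1 * Ti k) (Ti k * Ti k.+1) (Y k) e1 e2 e3 => a b y e1 e2 e3.
by rewrite -[RHS]mulrA e2 !mulrA -e1 -(mulrA a) e3 !mulrA.
Qed.

Lemma T_jucysY k i : (k < m)%N -> (i <= m)%N -> i != k -> i != k.+1 ->
  T k * Y i = Y i * T k.
Proof.
elim: i => [|i IH] km im ik ik1; first by (apply: T_jucysY_gt; lia).
have [ltik|leki] := ltnP i k; first by (apply: T_jucysY_gt; lia).
have [->|ne] := eqVneq i k.+1; first by (apply: T_jucysY2; lia).
have TTik : T k * Ti i = Ti i * T k.
  apply: commr_inverse; [apply: TTi; lia|apply: TiT; lia|].
  by apply: TT; lia.
rewrite /= !mulrA TTik -(mulrA _ (T k)) IH ?mulrA -?(mulrA _ (T k)) ?TTik ?mulrA //; lia.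
Qed.

Let W := ascT T 1 m * pi.

Let jucysY0E : Y 0 = T 0 * W.
Proof. by rewrite /= /W mulrA /ascT [X in X * pi]big_ltn. Qed.

Let jucysY1E : Y 1 = W * Ti 0.
Proof. by rewrite [LHS]/= -/(Y 0) jucysY0E mulrA TiT // mul1r. Qed.

Let asc1E : ascT T 1 m = \prod_(0 <= k < m.-1) T k.+1.
Proof. by rewrite /ascT -{1}(prednK m_gt0) big_add1. Qed.

(** W^2 is T_1 ... T_(m-1) T_0 ... T_(m-2) pi^2. A T_0 in front completes the first run; sliding
    that run through the second makes a T_(m-1) appear at the end, which crosses pi^2 and becomes
    T_0. *)
Lemma T0_WW : T 0 * (W * W) = W * W * T 0.
Proof.
have WW : W * W = ascT T 1 m * ascT T 0 m.-1 * (pi * pi).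
  have e : pi * ascT T 1 m = ascT T 0 m.-1 * pi.
    by rewrite asc1E; apply: conjr_prod_nat => k km; apply: piT; lia.
  by rewrite /W mulrA -(mulrA (ascT T 1 m) pi) e !mulrA.
have e1 : ascT T 0 m = T 0 * ascT T 1 m by rewrite /ascT big_ltn.
have e2 : ascT T 0 m = ascT T 0 m.-1 * T m.-1.
  by rewrite /ascT -{1}(prednK m_gt0) big_nat_recr.
have e3 : ascT T 0 m * ascT T 0 m.-1 = ascT T 1 m * ascT T 0 m.
  rewrite asc1E; apply: conjr_prod_nat => k km.
  by apply/esym; apply: (ascT_shift TTT TT); lia.
rewrite WW -[RHS]mulrA pi2T !mulrA -e1 e3 -(mulrA _ (ascT T 0 m.-1) (T m.-1)).
by rewrite -e2.
Qed.

(** Y_0 = T_0 W and Y_1 = W T_0^-1, so both products equal W^2. *)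
Lemma jucysY01 : Y 0 * Y 1 = Y 1 * Y 0.
Proof.
rewrite jucysY0E jucysY1E mulrA -(mulrA (T 0)) T0_WW.
by rewrite -!mulrA TTi // mulr1 (mulrA (Ti 0)) TiT // mul1r.
Qed.

(** [comm_step] lowers the smaller index to 0 and then the larger one to 1, which leaves the
    commutation of Y_0 and Y_1. *)
Lemma jucysY_comm i j : (i <= m)%N -> (j <= m)%N -> Y i * Y j = Y j * Y i.
Proof.
have lt : forall i j, (i < j)%N -> (j <= m)%N -> Y i * Y j = Y j * Y i.
  have comm_step a k x : (k < m)%N -> T k * x = x * T k -> a * x = x * a ->
      Ti k * a * Ti k * x = x * (Ti k * a * Ti k).
    move=> km eT ea.
    have e : x * Ti k = Ti k * x.
      by apply: (commr_inverse (TTi km) (TiT km)).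
    by rewrite -mulrA -e mulrA -(mulrA _ a) ea !mulrA e.
  elim=> [|{}i IH] {}j ij jm; last first.
    by apply: comm_step; [lia|apply: T_jucysY; lia|apply: IH; lia].
  elim: j ij jm => // -[|j] IH _ jm; first exact: jucysY01.
  rewrite -/(Y 0); apply/esym; apply: comm_step; first by [].
    by apply: T_jucysY; lia.
  by apply/esym/IH; lia.
move=> im jm; have [ij|ji|->//] := ltngtP i j; first exact: lt.
by apply/esym/lt.
Qed.

Lemma X0_jucysY1 : X 0 * Y 1 = Y 1 * (T 0 * T 0) * X 0.
Proof.
have X0asc : X 0 * ascT T 1 m = ascT T 1 m * X 0.
  by apply: commr_prod_nat => k km; rewrite TX //; lia.
rewrite jucysY1E -!mulrA (mulrA (Ti 0)) TiT // mul1r /W !mulrA X0asc.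
rewrite -(mulrA _ (X 0)) -piX // -TXT // -!mulrA TTi // mulr1.
by [].
Qed.

(** The derivation of [Y0_X0] read backwards: pi X_0 = Q X_m pi gives Y_0 X_0, and multiplication by
    Y_1 ... Y_m on the left gives Ytilde X_0. *)
Lemma prod_jucysY_X0 : (\prod_(0 <= i < m.+1) Y i) * X 0 =
  Q * (X 0 * (\prod_(0 <= i < m.+1) Y i)).
Proof.
have X0Z := X0_prodY TTi TiT TTT TT TX (fun k _ => erefl (Y k.+1)) T_jucysY
  (fun=> X0_jucysY1) (leqnn m).
set Z := \prod_(1 <= i < m.+1) Y i in X0Z.
have YZ : \prod_(0 <= i < m.+1) Y i = Z * Y 0.
  by rewrite big_ltn // -/Z; apply: commr_prod_nat => i im; apply: jucysY_comm; lia.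
have YX : Y 0 * X 0 = Q * (ascT T 0 m * descT T m) * X 0 * Y 0.
  rewrite /= -mulrA piX0 (X_descT_ascT TXT (leqnn m)) !mulrA.
  by rewrite -Qcomm.
by rewrite YZ -mulrA YX (mulrA (X 0)) X0Z !mulrA -Qcomm.
Qed.

Lemma prod_jucysY_X i : (i <= m)%N -> (\prod_(0 <= i < m.+1) Y i) * X i =
  Q * (X i * (\prod_(0 <= i < m.+1) Y i)).
Proof.
elim: i => [|i IH] im; first exact: prod_jucysY_X0.
have e : T i * (\prod_(0 <= i < m.+1) Y i) = (\prod_(0 <= i < m.+1) Y i) * T i.
  by apply: (T_prodY TTi TiT (fun k _ => erefl) T_jucysY jucysY_comm).
rewrite -TXT // !mulrA -e -(mulrA (T i)) IH; last by lia.
by rewrite mulrA -Qcomm -!mulrA -e.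
Qed.

End BackwardPi.

(** * Normal forms and spanning *)

(* One word for each permutation of {0, ..., j}: a permutation is uniquely
   s_i s_(i+1) ... s_(j-1) times a permutation fixing j. *)
Fixpoint nfwords j : seq (seq nat) :=
  if j is j'.+1 then
    [seq iota i (j'.+1 - i) ++ u | i <- iota 0 j'.+2, u <- nfwords j']
  else [:: [::]].

Lemma nfwordsSP j w : reflect
  (exists i u, [/\ (i <= j.+1)%N, u \in nfwords j & w = iota i (j.+1 - i) ++ u])
  (w \in nfwords j.+1).
Proof.
have -> : nfwords j.+1 =
  [seq iota i (j.+1 - i) ++ u | i <- iota 0 j.+2, u <- nfwords j] by [].
move: (iota 0 j.+2) (mem_iota 0 j.+2) (nfwords j) => r rE s.
apply: (iffP allpairsP) => [[[i u] /= [ij uj ->]]|[i [u [ij uj ->]]]].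
  by exists i, u; rewrite rE in ij; split=> //; lia.
by exists (i, u); rewrite /= rE.
Qed.

Definition swapn k x : nat :=
  if x == k then k.+1 else if x == k.+1 then k else x.

Lemma swapnK k : involutive (swapn k).
Proof. by move=> x; rewrite /swapn; do ?case: eqP; lia. Qed.

Definition actw (u : seq nat) x : nat := foldr swapn x u.

Lemma actw_cat u v x : actw (u ++ v) x = actw u (actw v x).
Proof. exact: foldr_cat. Qed.

Lemma actw_inj u : injective (actw u).
Proof.
by elim: u => [|k u IH] x y //= /(can_inj (swapnK k)); exact: IH.
Qed.

Lemma actw_gt (u : seq nat) j x : all (fun k => k < j)%N u -> (j < x)%N ->
  actw u x = x.
Proof.
move=> + jx; elim: u => //= k u IH /andP[kj /IH ->].
by rewrite /swapn; do ?case: eqP; lia.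
Qed.

Lemma actw_iota i l : actw (iota i l) (i + l)%N = i.
Proof.
elim: l i => [|l IH] i /=; first by rewrite addn0.
by rewrite -addSnnS IH /swapn; do ?case: eqP; lia.
Qed.

Lemma nfwords_lt j u : u \in nfwords j -> all (fun k => k < j)%N u.
Proof.
elim: j u => [|j IH] w; first by rewrite inE => /eqP ->.
case/nfwordsSP => i [u [ij uj ->]]; rewrite all_cat.
apply/andP; split; first by apply/allP => k; rewrite mem_iota; lia.
by apply/allP => k /(allP (IH _ uj)); lia.
Qed.

(** The tail of a normal word fixes j+1 and its initial run i, ..., j sends j+1 to i, so the image
    of the largest point determines the run. Cancelling the run leaves the case of j. *)
Lemma nfwords_inj j u v : u \in nfwords j -> v \in nfwords j ->
  (forall x, (x <= j)%N -> actw u x = actw v x) -> u = v.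
Proof.
elim: j u v => [|j IH] w w'; first by rewrite !inE => /eqP -> /eqP ->.
move=> /nfwordsSP[i [u [ij uj ->]]].
move=> /nfwordsSP[i' [u' [i'j u'j ->]]] e.
have top i0 u0 : u0 \in nfwords j -> (i0 <= j.+1)%N ->
    actw (iota i0 (j.+1 - i0) ++ u0) j.+1 = i0.
  move=> /nfwords_lt u0j i0j; rewrite actw_cat (actw_gt u0j) //.
  by rewrite -{2}(subnKC i0j) actw_iota.
have := e _ (leqnn _); rewrite !top // => ii'; subst i'.
congr (_ ++ _); apply: IH => // x xj.
apply: (@actw_inj (iota i (j.+1 - i))).
by rewrite -!actw_cat e // leqW.
Qed.

(** * Linear spans over a central scalar ring *)

Section LinearSpan.
Variables (K A : pzRingType) (iota_ : {rmorphism K -> A}).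
Local Notation "c %:s" := (iota_ c) (at level 2, format "c %:s").
Hypothesis iotaC : forall c x, c%:s * x = x * c%:s.

(** Scalars act as multiplication by central elements, so that all scalar manipulations are
    computations in the ring. *)
Inductive lin_span (S : A -> Prop) : A -> Prop :=
| lin_span_mem x : S x -> lin_span S x
| lin_span0 : lin_span S 0
| lin_spanD x y : lin_span S x -> lin_span S y -> lin_span S (x + y)
| lin_spanZ c x : lin_span S x -> lin_span S (c%:s * x).

Lemma lin_span_mull (S S' : A -> Prop) x y :
  (forall z, S z -> lin_span S' (x * z)) -> lin_span S y -> lin_span S' (x * y).
Proof.
move=> h; elim=> {y} [z /h //||y z _ hy _ hz|c z _ hz].
- by rewrite mulr0; exact: lin_span0.
- by rewrite mulrDr; exact: lin_spanD.
- by rewrite mulrA -iotaC -mulrA; exact: lin_spanZ.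
Qed.

Lemma lin_span_mulr (S S' : A -> Prop) x y :
  (forall z, S z -> lin_span S' (z * x)) -> lin_span S y -> lin_span S' (y * x).
Proof.
move=> h; elim=> {y} [z /h //||y z _ hy _ hz|c z _ hz].
- by rewrite mul0r; exact: lin_span0.
- by rewrite mulrDl; exact: lin_spanD.
- by rewrite -mulrA; exact: lin_spanZ.
Qed.

Lemma lin_span_sub (S S' : A -> Prop) x :
  (forall z, S z -> lin_span S' z) -> lin_span S x -> lin_span S' x.
Proof.
by move=> h; move: x => y hy; rewrite -(mul1r y); apply: lin_span_mull hy => z; rewrite mul1r; apply: h.
Qed.

Lemma lin_spanB (S : A -> Prop) x y :
  lin_span S x -> lin_span S y -> lin_span S (x - y).
Proof.
move=> hx hy; apply: lin_spanD => //; rewrite -mulN1r.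
by rewrite -(rmorphN1 iota_); exact: lin_spanZ.
Qed.

(** Repeated indices are merged by adding their coefficients, so that each index carries one
    coefficient. *)
Lemma lin_span_sum (I : eqType) (G : I -> A) (D : I -> Prop) x :
  lin_span (fun z => exists2 i, D i & z = G i) x ->
  exists (s : seq I) (c : I -> K), [/\ uniq s, forall i, i \in s -> D i &
    x = \sum_(i <- s) (c i)%:s * G i].
Proof.
move=> h.
have [s [sD ->]] : exists s : seq (K * I), (forall t, t \in map snd s -> D t) /\
    x = \sum_(t <- s) t.1%:s * G t.2.
  elim: h => {x} [z [i Di ->]||x y _ [s [sD ->]] _ [s' [s'D ->]]|c x _ [s [sD ->]]].
  - exists [:: (1, i)]; split; last by rewrite big_seq1 rmorph1 mul1r.
    by move=> t; rewrite inE => /eqP ->.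
  - by exists [::]; rewrite big_nil.
  - exists (s ++ s'); split; last by rewrite big_cat.
    by move=> t; rewrite map_cat mem_cat => /orP[/sD|/s'D].
  - exists [seq (c * t.1, t.2) | t <- s]; split.
      by move=> t; rewrite -map_comp; exact: sD.
    by rewrite big_map mulr_sumr; apply: eq_bigr => t _; rewrite mulrA -rmorphM.
exists (undup (map snd s)), (fun i => \sum_(t <- s | t.2 == i) t.1).
split; [exact: undup_uniq|by move=> i; rewrite mem_undup; exact: sD|].
transitivity (\sum_(i <- undup (map snd s)) \sum_(t <- s | t.2 == i) t.1%:s * G i).
  under [RHS]eq_bigr => i _ do rewrite big_mkcond.
  rewrite exchange_big /= big_seq [RHS]big_seq; apply: eq_bigr => t ts.
  rewrite (bigD1_seq t.2) ?undup_uniq ?mem_undup ?map_f //= eqxx big1 ?addr0 //.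
  by move=> i; rewrite eq_sym => /negPf ->.
by apply: eq_bigr => i _; rewrite rmorph_sum mulr_suml.
Qed.

End LinearSpan.

Section HeckeNormalForm.
Variables (K A : pzRingType) (iota_ : {rmorphism K -> A}) (m : nat).
Variables (T : nat -> A) (c : K).
Local Notation "c %:s" := (iota_ c) (at level 2, format "c %:s").
Hypothesis iotaC : forall c x, c%:s * x = x * c%:s.
Hypothesis T2 : forall k, (k < m)%N -> T k * T k = c%:s * T k + 1.
Hypothesis TTT : forall k, (k.+1 < m)%N ->
  T k * T k.+1 * T k = T k.+1 * T k * T k.+1.
Hypothesis TT : forall k l, (k.+1 < l)%N -> (l < m)%N -> T k * T l = T l * T k.

Definition Tword (u : seq nat) := \prod_(k <- u) T k.

Lemma Tword_cat u v : Tword (u ++ v) = Tword u * Tword v.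
Proof. exact: big_cat. Qed.

Lemma Tword_iota i j : Tword (iota i (j - i)) = ascT T i j.
Proof. by []. Qed.

Definition nfspan j := lin_span iota_ (fun x => exists2 u, u \in nfwords j & x = Tword u).

Lemma nfspan_asc j i x : (i <= j.+1)%N -> nfspan j x -> nfspan j.+1 (ascT T i j.+1 * x).
Proof.
move=> ij; apply: (lin_span_mull iotaC) => _ [u uj ->]; apply: lin_span_mem.
exists (iota i (j.+1 - i) ++ u); last by rewrite Tword_cat Tword_iota.
by apply/nfwordsSP; exists i, u.
Qed.

(** In T_k (T_i ... T_j) u, the factor T_k commutes with the run if k+1 < i, extends it if k+1 = i,
    meets the quadratic relation if k = i, and emerges behind the run as T_(k-1) if k > i. In the
    first and last cases the induction on j applies to u. *)
Lemma nfspan_T j k x : (j <= m)%N -> (k < j)%N -> nfspan j x -> nfspan j (T k * x).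
Proof.
elim: j k x => // j IH k x jm kj; apply: (lin_span_mull iotaC) => _ [w wj ->].
case/nfwordsSP: wj => i [u [ij uj ->]].
have uspan : nfspan j (Tword u) by apply: lin_span_mem; exists u.
rewrite Tword_cat Tword_iota mulrA.
have [ki|ik] := ltnP k.+1 i.
  rewrite (ascT_comm TT) -?mulrA; [|lia|lia|lia].
  by apply: nfspan_asc; [lia|apply: IH => //; lia].
have [->|ki1] := eqVneq i k.+1.
  rewrite -/(ascT T k.+1 j.+1) /ascT -big_ltn //; apply: nfspan_asc => //; lia.
have [->|ki] := eqVneq i k.
  rewrite {1}/ascT big_ltn // -/(ascT T k.+1 j.+1) mulrA T2 ?mulrDl ?mul1r; last by lia.
  apply: lin_spanD; last by apply: nfspan_asc => //; lia.
  rewrite -!mulrA; apply: lin_spanZ; rewrite mulrA.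
  have -> : T k * ascT T k.+1 j.+1 = ascT T k j.+1 by rewrite /ascT [RHS]big_ltn.
  by apply: nfspan_asc => //; lia.
case: k kj ik ki1 ki => [|k] kj ik ki1 ki; first by lia.
rewrite (ascT_shift TTT TT) -?mulrA; [|lia|lia|lia].
by apply: nfspan_asc; [lia|apply: IH => //; lia].
Qed.

Lemma nfspan_word u : all (fun k => k < m)%N u -> nfspan m (Tword u).
Proof.
elim: u => [|k u IH] /=.
  move=> _; have : nfspan 0 (Tword [::]) by apply: lin_span_mem; exists [::].
  elim: m => // j IH h; have := nfspan_asc (leqnn _) (IH h).
  by rewrite /ascT big_geq // mul1r.
by case/andP=> km /IH h; rewrite /Tword big_cons; exact: nfspan_T.
Qed.

End HeckeNormalForm.

Section IntVectors.
Variable m : nat.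
Local Notation vec := {ffun 'I_m -> int}.

Definition unitv (i : 'I_m) : vec := [ffun j => (j == i)%:Z].

Lemma vec_ind (P : vec -> Prop) : P 0 ->
  (forall a i, P a -> P (a + unitv i)) -> (forall a i, P a -> P (a - unitv i)) ->
  forall a, P a.
Proof.
move=> P0 PD PB a; have [k] := ubnP (\sum_i `|a i|)%N.
elim: k a => // k IH a; rewrite ltnS => ak.
have [->//|] := eqVneq a 0.
move=> /eqP/ffunP a0; have [i ai] : exists i, a i != 0.
  apply/existsP; apply: contraPT a0; rewrite negb_exists => /forallP h.
  by case=> i; rewrite ffunE; apply/eqP; rewrite -[_ == _]negbK.
have less (b : vec) : (`|b i| < `|a i|)%N -> (forall j, j != i -> b j = a j) -> P b.
  move=> bi bj; apply: IH; apply: leq_trans ak.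
  rewrite (bigD1 i) //= [X in (_ < X)%N](bigD1 i) //= -addSn leq_add //.
  by apply: leq_sum => j ji; rewrite bj.
have [ai_gt0|ai_le0] := ltrP 0 (a i).
  rewrite -(subrK (unitv i) a); apply: PD; apply: less.
    by rewrite !ffunE eqxx /=; lia.
  by move=> j /negPf ji; rewrite !ffunE ji subr0.
rewrite -(addrK (unitv i) a); apply: PB; apply: less.
  by rewrite !ffunE eqxx /=; lia.
by move=> j /negPf ji; rewrite !ffunE ji addr0.
Qed.

End IntVectors.

Section Monomials.
Variables (A : pzRingType) (m : nat) (X Xi : nat -> A).
Local Notation vec := {ffun 'I_m -> int}.

Definition zpow (x xi : A) (z : int) : A :=
  match z with Posz k => x ^+ k | Negz k => xi ^+ k.+1 end.

Lemma zpowD1 x xi z : x * xi = 1 -> x * zpow x xi z = zpow x xi (z + 1).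
Proof.
move=> xV; case: z => [k|[|k]].
- by rewrite -exprS -PoszD addn1.
- by rewrite /= expr1 xV.
- have -> : Negz k.+1 + 1 = Negz k by lia.
  by rewrite [zpow _ _ (Negz k.+1)]exprS mulrA xV mul1r.
Qed.

Lemma zpowB1 x xi z : xi * x = 1 -> xi * zpow x xi z = zpow x xi (z - 1).
Proof.
move=> xV; case: z => [[|k]|k].
- by rewrite mulr1.
- have -> : Posz k.+1 - 1 = Posz k by lia.
  by rewrite [zpow _ _ (Posz k.+1)]exprS mulrA xV mul1r.
- have -> : Negz k - 1 = Negz k.+1 by lia.
  by rewrite -exprS.
Qed.

Definition monom (a : vec) := \prod_(i < m) zpow (X i) (Xi i) (a i).

Lemma monom0 : monom 0 = 1.
Proof. by rewrite /monom big1 // => i _; rewrite ffunE. Qed.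

Hypothesis XXi : forall i, (i < m)%N -> X i * Xi i = 1.
Hypothesis XiX : forall i, (i < m)%N -> Xi i * X i = 1.
Hypothesis XX : forall i j, (i < m)%N -> (j < m)%N -> X i * X j = X j * X i.

Lemma comm_zpow x y yi z : y * yi = 1 -> yi * y = 1 -> x * y = y * x ->
  x * zpow y yi z = zpow y yi z * x.
Proof.
move=> yV Vy e; case: z => k /=; apply: commrX => //.
exact: (commr_inverse yV Vy).
Qed.

(** The element x travels past the preceding factors up to the i-th one, which absorbs it. *)
Lemma mulr_prod_update (I : eqType) (s : seq I) (i : I) (x : A) (F G : I -> A) :
  uniq s -> i \in s -> (forall j, x * F j = F j * x) -> G i = x * F i ->
  (forall j, j != i -> G j = F j) ->
  x * (\prod_(j <- s) F j) = \prod_(j <- s) G j.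
Proof.
move=> + + xF Gi Gj; elim: s => //= j s IH /andP[js us].
rewrite inE !big_cons; have [ij _|ij /=] := eqVneq i j.
  rewrite -ij in js *; rewrite mulrA -Gi; congr (_ * _); apply: eq_big_seq => k ks; rewrite Gj //.
  by apply: contraNneq js => <-.
by move=> /(IH us) e; rewrite mulrA xF -mulrA e Gj // eq_sym //.
Qed.

Lemma monomD a (i : 'I_m) : X i * monom a = monom (a + unitv i).
Proof.
apply: (mulr_prod_update (i := i)).
- exact: index_enum_uniq.
- by rewrite mem_index_enum.
- by move=> j; apply: comm_zpow; rewrite ?XXi ?XiX // XX.
- by rewrite zpowD1 ?XXi // !ffunE eqxx.
- by move=> j /negPf ji; rewrite !ffunE ji addr0.
Qed.

Lemma monomB a (i : 'I_m) : Xi i * monom a = monom (a - unitv i).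
Proof.
apply: (mulr_prod_update (i := i)).
- exact: index_enum_uniq.
- by rewrite mem_index_enum.
- move=> j; apply: comm_zpow; rewrite ?XXi ?XiX //; apply/esym.
  by apply: (commr_inverse (XXi (ltn_ord i)) (XiX (ltn_ord i))); rewrite XX.
- by rewrite zpowB1 ?XiX // !ffunE eqxx.
- by move=> j /negPf ji; rewrite !ffunE ji subr0.
Qed.

End Monomials.

(** * Exchange rules between the T_k and the lattice generators *)

Section Exchange.
Variables (K A : pzRingType) (iota_ : {rmorphism K -> A}) (m : nat).
Variables (T Ti E Ei : nat -> A) (c : K).
Local Notation "c %:s" := (iota_ c) (at level 2, format "c %:s").
Hypothesis iotaC : forall c x, c%:s * x = x * c%:s.
Hypothesis TTi : forall k, (k < m)%N -> T k * Ti k = 1.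
Hypothesis TiT : forall k, (k < m)%N -> Ti k * T k = 1.
Hypothesis TE : forall k, (k < m)%N -> T k = Ti k + c%:s.
Hypothesis TET : forall k, (k < m)%N -> Ti k * E k * Ti k = E k.+1.
Hypothesis TcommE : forall k i, (k < m)%N -> (i <= m)%N -> i != k -> i != k.+1 ->
  T k * E i = E i * T k.
Hypothesis EEi : forall i, (i <= m)%N -> E i * Ei i = 1.
Hypothesis EiE : forall i, (i <= m)%N -> Ei i * E i = 1.

(** Inverting T_k X_k T_k = X_(k+1) gives the relation satisfied by the Y_i. The pairs (Y_i, Y_i^-1)
    and (X_i^-1, X_i) thus satisfy the same hypotheses, and one set of rules serves both. *)
Definition pm_gen (x : A) := exists2 i, (i <= m)%N & x = E i \/ x = Ei i.

Lemma TEiT k : (k < m)%N -> T k * Ei k * T k = Ei k.+1.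
Proof.
move=> km; rewrite -[LHS]mulr1 -(EEi km) -TET // !mulrA.
rewrite (mulrK_inverse _ (TTi km)) (mulrK_inverse _ (EiE (ltnW km))).
by rewrite TTi // mul1r.
Qed.

(** The rules come from replacing one T_k by T_k^-1 + c in the conjugation relations. The error term
    contains no T_k, which keeps the later inductions on words and exponents going. *)
Lemma pm_gen_exchange k x : (k < m)%N -> pm_gen x ->
  (exists x' x'' d, [/\ pm_gen x', pm_gen x'' &
    x * T k = T k * x' + d%:s * x'']) /\
  (exists x' x'' d, [/\ pm_gen x', pm_gen x'' &
    T k * x = x' * T k + d%:s * x'']).
Proof.
move=> km; have k0 := ltnW km.
have gE i : (i <= m)%N -> pm_gen (E i) by move=> im; exists i => //; left.
have gEi i : (i <= m)%N -> pm_gen (Ei i) by move=> im; exists i => //; right.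
have TiE : Ti k = T k - c%:s by rewrite TE // addrK.
have T2 : T k * T k = 1 + c%:s * T k by rewrite {1}TE // mulrDl TiT.
have ET : E k * T k = T k * E k.+1 + c%:s * E k.
  by rewrite {1}TE // mulrDr -iotaC -TET // !mulrA TTi // mul1r.
have TE' : T k * E k = E k.+1 * T k + c%:s * E k.
  by rewrite {1}TE // mulrDl -TET // -!mulrA TiT // mulr1.
have ET1 : E k.+1 * T k = T k * E k + (- c)%:s * E k.
  rewrite -TET // -!mulrA TiT // mulr1 TiE mulrBl rmorphN mulNr.
  by [].
have TE1 : T k * E k.+1 = E k * T k + (- c)%:s * E k.
  by rewrite -TET // !mulrA TTi // mul1r TiE mulrBr rmorphN mulNr iotaC.
have EiT : Ei k * T k = T k * Ei k.+1 + (- c)%:s * Ei k.+1.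
  rewrite -{1}[Ei k]mul1r -(TiT km) -!mulrA (mulrA (T k)) TEiT // TiE.
  by rewrite mulrBl rmorphN mulNr.
have TEi : T k * Ei k = Ei k.+1 * T k + (- c)%:s * Ei k.+1.
  rewrite -{1}[Ei k]mulr1 -(TTi km) !mulrA TEiT // TiE.
  by rewrite mulrBr rmorphN mulNr iotaC.
have EiT1 : Ei k.+1 * T k = T k * Ei k + c%:s * Ei k.+1.
  by rewrite -TEiT // -mulrA T2 mulrDr mulr1 mulrA -iotaC -!mulrA.
have TEi1 : T k * Ei k.+1 = Ei k * T k + c%:s * Ei k.+1.
  by rewrite -TEiT // !mulrA T2 !mulrDl mul1r -!mulrA.
case=> i im xE; have [ik|ik] := eqVneq i k.
  subst i; case: xE => ->; split.
  - by exists (E k.+1), (E k), c; split=> //; apply: gE.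
  - by exists (E k.+1), (E k), c; split=> //; apply: gE.
  - by exists (Ei k.+1), (Ei k.+1), (- c); split=> //; apply: gEi.
  - by exists (Ei k.+1), (Ei k.+1), (- c); split=> //; apply: gEi.
have [ik1|ik1] := eqVneq i k.+1.
  subst i; case: xE => ->; split.
  - by exists (E k), (E k), (- c); split=> //; apply: gE.
  - by exists (E k), (E k), (- c); split=> //; apply: gE.
  - by exists (Ei k), (Ei k.+1), c; split=> //; apply: gEi.
  - by exists (Ei k), (Ei k.+1), c; split=> //; apply: gEi.
have e : T k * x = x * T k.
  case: xE => ->; first exact: TcommE.
  by apply: (commr_inverse (EEi im) (EiE im)); exact: TcommE.
have gx : pm_gen x by exists i.
by split; exists x, x, 0; split=> //; rewrite rmorph0 mul0r addr0.
Qed.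

End Exchange.

(** * Straightening into monomials X^a T_u Y^b *)

Section Spanning.
Variables (K A : pzRingType) (iota_ : {rmorphism K -> A}) (m : nat).
Variables (T Ti X Xi Y Yi : nat -> A) (c q qi : K).
Local Notation "c %:s" := (iota_ c) (at level 2, format "c %:s").
Local Notation vec := {ffun 'I_m.+1 -> int}.
Hypothesis iotaC : forall c x, c%:s * x = x * c%:s.
Hypothesis qqi : q * qi = 1.
Hypothesis qiq : qi * q = 1.
Hypothesis m_gt0 : (0 < m)%N.
Hypothesis TTi : forall k, (k < m)%N -> T k * Ti k = 1.
Hypothesis TiT : forall k, (k < m)%N -> Ti k * T k = 1.
Hypothesis TE : forall k, (k < m)%N -> T k = Ti k + c%:s.
Hypothesis TTT : forall k, (k.+1 < m)%N ->
  T k * T k.+1 * T k = T k.+1 * T k * T k.+1.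
Hypothesis TT : forall k l, (k.+1 < l)%N -> (l < m)%N -> T k * T l = T l * T k.
Hypothesis TXT : forall k, (k < m)%N -> T k * X k * T k = X k.+1.
Hypothesis TX : forall k i, (k < m)%N -> (i <= m)%N -> i != k -> i != k.+1 ->
  T k * X i = X i * T k.
Hypothesis TYT : forall k, (k < m)%N -> Ti k * Y k * Ti k = Y k.+1.
Hypothesis TY : forall k i, (k < m)%N -> (i <= m)%N -> i != k -> i != k.+1 ->
  T k * Y i = Y i * T k.
Hypothesis XX : forall i j, (i <= m)%N -> (j <= m)%N -> X i * X j = X j * X i.
Hypothesis XXi : forall i, (i <= m)%N -> X i * Xi i = 1.
Hypothesis XiX : forall i, (i <= m)%N -> Xi i * X i = 1.
Hypothesis YY : forall i j, (i <= m)%N -> (j <= m)%N -> Y i * Y j = Y j * Y i.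
Hypothesis YYi : forall i, (i <= m)%N -> Y i * Yi i = 1.
Hypothesis YiY : forall i, (i <= m)%N -> Yi i * Y i = 1.
Hypothesis X0Y1 : X 0 * Y 1 = Y 1 * (T 0 * T 0) * X 0.
Hypothesis YX0 : (\prod_(0 <= i < m.+1) Y i) * X 0 =
  q%:s * (X 0 * (\prod_(0 <= i < m.+1) Y i)).

Local Notation monX := (@monom A m.+1 X Xi).
Local Notation monY := (@monom A m.+1 Y Yi).
Local Notation valid u := (all (fun k => k < m)%N u).
Local Notation span := (lin_span iota_).

Let TXiT k : (k < m)%N -> Ti k * Xi k * Ti k = Xi k.+1.
Proof.
move=> km; rewrite -[LHS]mulr1 -(XXi km) -TXT // !mulrA.
rewrite (mulrK_inverse _ (TiT km)) (mulrK_inverse _ (XiX (ltnW km))).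
by rewrite TiT // mul1r.
Qed.

Let TXi k i : (k < m)%N -> (i <= m)%N -> i != k -> i != k.+1 ->
  T k * Xi i = Xi i * T k.
Proof.
move=> km im ik ik1; apply: (commr_inverse (XXi im) (XiX im)); exact: TX.
Qed.

Let Xgen x := pm_gen m Xi X x.
Let Ygen x := pm_gen m Y Yi x.

Let Xgen_exchange k x (km : (k < m)%N) (gx : Xgen x) :=
  (pm_gen_exchange iotaC TTi TiT TE TXiT TXi XiX XXi km gx).2.
Let Ygen_exchange k x (km : (k < m)%N) (gx : Ygen x) :=
  (pm_gen_exchange iotaC TTi TiT TE TYT TY YYi YiY km gx).1.

Let Xgen_monX x a : Xgen x -> exists a', x * monX a = monX a'.
Proof.
case=> i im [] ->.
  by exists (a - unitv (Ordinal (im : (i < m.+1)%N))); rewrite -monomB.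
by exists (a + unitv (Ordinal (im : (i < m.+1)%N))); rewrite -monomD.
Qed.

Let Ygen_monY x b : Ygen x -> exists b', x * monY b = monY b'.
Proof.
case=> i im [] ->.
  by exists (b + unitv (Ordinal (im : (i < m.+1)%N))); rewrite -monomD.
by exists (b - unitv (Ordinal (im : (i < m.+1)%N))); rewrite -monomB.
Qed.

(** [HY] is the part generated by the T_k and Y_i, and [N] puts the X-monomials in front of it. Both
    admit arbitrary words in the T_k; the passage to one word per permutation is postponed to
    [pbw_spanning]. *)
Let HY := span (fun x => exists u b, valid u /\ x = Tword T u * monY b).
Let N := span (fun x => exists a u b,
  valid u /\ x = monX a * (Tword T u * monY b)).

Let HY_T k x : (k < m)%N -> HY x -> HY (T k * x).
Proof.
move=> km; apply: (lin_span_mull iotaC) => _ [u [b [uv ->]]].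
apply: lin_span_mem; exists (k :: u), b; split; first by rewrite /= km.
by rewrite /Tword big_cons mulrA.
Qed.

Let HY_Ti k x : (k < m)%N -> HY x -> HY (Ti k * x).
Proof.
move=> km hx; have -> : Ti k = T k - c%:s by rewrite TE // addrK.
rewrite mulrBl; apply: lin_spanB; first exact: HY_T.
exact: lin_spanZ.
Qed.

Let HY_Ygen x y : Ygen x -> HY y -> HY (x * y).
Proof.
move=> gx; apply: (lin_span_mull iotaC) => _ [u [b [uv ->]]].
elim: u x gx uv => [|k u IH] x gx /=.
  have [b' e] := Ygen_monY b gx.
  rewrite /Tword big_nil mul1r e => _; apply: lin_span_mem.
  by exists [::], b'; rewrite /Tword big_nil mul1r.
case/andP=> km uv; rewrite /Tword big_cons -mulrA mulrA.
have [x' [x'' [d [gx' gx'' ->]]]] := Ygen_exchange km gx.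
rewrite mulrDl -!mulrA; apply: lin_spanD; first by apply: HY_T => //; apply: IH.
by apply: lin_spanZ; apply: IH.
Qed.

Let N_HY a x : HY x -> N (monX a * x).
Proof.
apply: (lin_span_mull iotaC) => _ [u [b [uv ->]]].
by apply: lin_span_mem; exists a, u, b.
Qed.

Let N_mull x : (forall a y, HY y -> N (x * (monX a * y))) ->
  forall y, N y -> N (x * y).
Proof.
move=> h y; apply: (lin_span_mull iotaC) => _ [a [u [b [uv ->]]]].
by apply: h; apply: lin_span_mem; exists u, b.
Qed.

Let N_Xgen x y : Xgen x -> N y -> N (x * y).
Proof.
move=> gx; apply: N_mull => a {}y hy; rewrite mulrA.
by have [a' ->] := Xgen_monX a gx; exact: N_HY.
Qed.

Let T_monX k a y : (k < m)%N -> HY y -> N (T k * (monX a * y)).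
Proof.
move=> km hy; elim/vec_ind: a => [|a i|a i].
- rewrite monom0 mul1r -[T k * y]mul1r -(monom0 m.+1 X Xi).
  by apply: N_HY; exact: HY_T.
- have gx : Xgen (X i) by exists (val i); [exact: (ltn_ord i)|right].
  have [x' [x'' [d [gx' gx'' e]]]] := Xgen_exchange km gx.
  move=> h; rewrite -monomD // -(mulrA (X i)) mulrA e mulrDl -!mulrA.
  apply: lin_spanD; first exact: N_Xgen.
  by apply: lin_spanZ; apply: N_Xgen => //; exact: N_HY.
- have gx : Xgen (Xi i) by exists (val i); [exact: (ltn_ord i)|left].
  have [x' [x'' [d [gx' gx'' e]]]] := Xgen_exchange km gx.
  move=> h; rewrite -monomB // -(mulrA (Xi i)) mulrA e mulrDl -!mulrA.
  apply: lin_spanD; first exact: N_Xgen.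
  by apply: lin_spanZ; apply: N_Xgen => //; exact: N_HY.
Qed.

Let N_T k y : (k < m)%N -> N y -> N (T k * y).
Proof. by move=> km; apply: N_mull => a {}y hy; exact: T_monX. Qed.

Let N_Ti k y : (k < m)%N -> N y -> N (Ti k * y).
Proof.
move=> km hy; have -> : Ti k = T k - c%:s by rewrite TE // addrK.
rewrite mulrBl; apply: lin_spanB; first exact: N_T.
exact: lin_spanZ.
Qed.

Let desc_closed (S : A -> Prop) k y : (k <= m)%N ->
  (forall l z, (l < m)%N -> S z -> S (Ti l * z)) -> S y -> S (descTi Ti k * y).
Proof.
move=> + h; elim: k => [|k IH] km Sy /=; first by rewrite mul1r.
by rewrite -mulrA; apply: h => //; apply: IH => //; lia.
Qed.

Let asc_closed (S : A -> Prop) k y : (k <= m)%N ->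
  (forall l z, (l < m)%N -> S z -> S (T l * z)) -> S y -> S (ascT T 0 k * y).
Proof.
move=> + h; elim: k y => [|k IH] y km Sy; first by rewrite /ascT big_geq ?mul1r.
by rewrite /ascT big_nat_recr //= -mulrA; apply: IH; [lia|apply: h].
Qed.

Let pi := cyclicT m Ti Y.
Let pii := Yi 0 * ascT T 0 m.

Let pi_V : pi * pii = 1.
Proof.
rewrite /pi /pii /cyclicT -mulrA (mulrA (Y 0)) YYi // mul1r.
exact: (descTi_inv TiT).
Qed.

Let V_pi : pii * pi = 1.
Proof.
rewrite /pi /pii /cyclicT -mulrA (mulrA (ascT T 0 m)) (ascT_inv TTi) //.
by rewrite mul1r YiY.
Qed.

Let pi_HY y : HY y -> HY (pi * y).
Proof.
move=> hy; rewrite /pi /cyclicT -mulrA; apply: desc_closed => //.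
by apply: HY_Ygen => //; exists 0; [|left].
Qed.

Let pii_HY y : HY y -> HY (pii * y).
Proof.
move=> hy; rewrite /pii -mulrA.
apply: HY_Ygen; first by exists 0; [|right].
exact: asc_closed.
Qed.

Let pi_X i : (i < m)%N -> pi * X i.+1 = X i * pi.
Proof. exact: (cyclicT_X m_gt0 TTi TiT TTT TT TXT TX TYT TY X0Y1). Qed.

Let pi_X0 : pi * X 0 = q%:s * X m * pi.
Proof.
exact: (cyclicT_X0 m_gt0 TTi TiT TTT TT TXT TX TYT TY YY YiY X0Y1 (iotaC q) YX0).
Qed.

Let pi_Xi i : (i < m)%N -> pi * Xi i.+1 = Xi i * pi.
Proof.
move=> im; move: pi (pi_X im) => p e.
by rewrite -[RHS]mulr1 -(XXi im) mulrA -(mulrA (Xi i)) e !mulrA XiX ?mul1r // ltnW.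
Qed.

Let pi_Xi0 : pi * Xi 0 = qi%:s * Xi m * pi.
Proof.
have e : qi%:s * Xi m * pi * X 0 = pi.
  have XiX' : Xi m * X m = 1 by exact: XiX.
  rewrite -mulrA pi_X0; move: pi => p.
  by rewrite !mulrA -iotaC !mulrA -rmorphM qqi rmorph1 mul1r XiX' mul1r.
by rewrite -[in LHS]e (mulrK_inverse _ (XXi _)).
Qed.

Let pi_Xgen x : Xgen x -> exists d x', Xgen x' /\ pi * x = d%:s * x' * pi.
Proof.
case=> -[|i] im [] ->.
- by exists qi, (Xi m); split=> //; exists m; [|left].
- by exists q, (X m); split=> //; exists m; [|right].
- exists 1, (Xi i); rewrite rmorph1 mul1r pi_Xi //; split=> //.
  by exists i; [exact: ltnW|left].
- exists 1, (X i); rewrite rmorph1 mul1r pi_X //; split=> //.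
  by exists i; [exact: ltnW|right].
Qed.

Let pii_Xgen x : Xgen x -> exists d x', Xgen x' /\ pii * x = d%:s * x' * pii.
Proof.
case=> i im xE; have [e|im1] := eqVneq i m.
  subst i; case: xE => ->.
    exists q, (Xi 0); split; first by exists 0; [|left].
    apply: (conjr_inverse pi_V V_pi).
    by rewrite mulrA -iotaC -mulrA pi_Xi0 !mulrA -rmorphM qqi rmorph1 mul1r.
  exists qi, (X 0); split; first by exists 0; [|right].
  apply: (conjr_inverse pi_V V_pi).
  by rewrite mulrA -iotaC -mulrA pi_X0 !mulrA -rmorphM qiq rmorph1 mul1r.
have {}im : (i < m)%N by lia.
case: xE => ->.
  exists 1, (Xi i.+1); split; first by exists i.+1; [|left].
  by rewrite rmorph1 mul1r; apply: (conjr_inverse pi_V V_pi); rewrite pi_Xi.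
exists 1, (X i.+1); split; first by exists i.+1; [|right].
by rewrite rmorph1 mul1r; apply: (conjr_inverse pi_V V_pi); rewrite pi_X.
Qed.

(** Both pi and its inverse carry X-monomials to X-monomials up to a scalar. Through Y_0 = T_0 ...
    T_(m-1) pi this gives stability under Y_0, and conjugation by the T_k then gives it for the
    other Y_i. *)
Let conj_N p : (forall y, HY y -> HY (p * y)) ->
  (forall x, Xgen x -> exists d x', Xgen x' /\ p * x = d%:s * x' * p) ->
  forall y, N y -> N (p * y).
Proof.
move=> pHY pX; apply: N_mull => a y hy.
suff [d [a' e]] : exists d a', p * monX a = d%:s * monX a' * p.
  by rewrite mulrA e -!mulrA; apply: lin_spanZ; apply: N_HY; exact: pHY.
have step x b : Xgen x -> (exists d a', p * monX b = d%:s * monX a' * p) ->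
    exists d a', p * (x * monX b) = d%:s * monX a' * p.
  move=> gx [d [a' e]]; have [d' [x' [gx' e']]] := pX _ gx.
  have [a'' e''] := Xgen_monX a' gx'.
  exists (d' * d), a''; rewrite mulrA e' -mulrA e -e'' rmorphM.
  by rewrite !mulrA -(mulrA d'%:s x') -iotaC !mulrA.
elim/vec_ind: a => [|a i IH|a i IH].
- by exists 1, 0; rewrite !monom0 rmorph1 mulr1 !mul1r.
- rewrite -monomD //; apply: step => //.
  by exists (val i); [exact: (ltn_ord i)|right].
- rewrite -monomB //; apply: step => //.
  by exists (val i); [exact: (ltn_ord i)|left].
Qed.

Let N_Y0 y : N y -> N (Y 0 * y).
Proof.
move=> hy; have -> : Y 0 = ascT T 0 m * pi.
  by rewrite /pi /cyclicT mulrA (ascT_inv TTi) // mul1r.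
by rewrite -mulrA; apply: asc_closed => //; exact: conj_N.
Qed.

Let N_Yi0 y : N y -> N (Yi 0 * y).
Proof.
move=> hy; have -> : Yi 0 = pii * descTi Ti m.
  by rewrite /pii -mulrA (ascT_inv TTi) // mulr1.
by rewrite -mulrA; apply: conj_N => //; exact: desc_closed.
Qed.

Let N_Y i y : (i <= m)%N -> N y -> N (Y i * y).
Proof.
elim: i y => [|i IH] y im hy; first exact: N_Y0.
by rewrite -TYT // -!mulrA; apply: N_Ti => //; apply: IH; [lia|exact: N_Ti].
Qed.

Let N_Yi i y : (i <= m)%N -> N y -> N (Yi i * y).
Proof.
elim: i y => [|i IH] y im hy; first exact: N_Yi0.
rewrite -(TEiT TTi TYT YYi YiY) // -!mulrA.
by apply: N_T => //; apply: IH; [lia|exact: N_T].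
Qed.

Lemma pbw_spanning :
  let N := lin_span iota_ (fun x => exists2 t : vec * seq nat * vec,
    t.1.2 \in nfwords m & x = monX t.1.1 * (Tword T t.1.2 * monY t.2)) in
  [/\ N 1,
      forall k x, (k < m)%N -> N x -> N (T k * x),
      forall i x, (i <= m)%N -> N x -> N (X i * x) /\ N (Xi i * x) &
      forall i x, (i <= m)%N -> N x -> N (Y i * x) /\ N (Yi i * x)].
Proof.
have T2 k : (k < m)%N -> T k * T k = c%:s * T k + 1.
  by move=> km; rewrite {1}TE // mulrDl TiT // addrC.
move=> N'; have NE x : N' x <-> N x.
  split; apply: (lin_span_sub iotaC).
  - move=> _ [[[a u] b] /= uv ->]; apply: lin_span_mem.
    by exists a, u, b; split=> //; exact: nfwords_lt.
  - move=> _ [a [u [b [uv ->]]]].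
    rewrite /N' mulrA; apply: (lin_span_mulr (S := fun z : A =>
      exists2 v, v \in nfwords m & z = monX a * Tword T v)).
      move=> _ [v vm ->]; apply: lin_span_mem.
      by exists (a, v, b); rewrite //= mulrA.
    (* The word in the middle is expanded in normal words; the outer monomials are only carried
       along. *)
    apply: (lin_span_mull iotaC _ (nfspan_word iotaC T2 TTT TT uv)).
    by move=> _ [v vm ->]; apply: lin_span_mem; exists v.
split.
- apply/NE; apply: lin_span_mem; exists 0, [::], 0.
  by rewrite !monom0 /Tword big_nil !mul1r.
- by move=> k x km /NE ?; apply/NE; exact: N_T.
- move=> i x im /NE hx; split; apply/NE; apply: N_Xgen => //.
    by exists i; [|right].
  by exists i; [|left].
- by move=> i x im /NE hx; split; apply/NE; [exact: N_Y|exact: N_Yi].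
Qed.

End Spanning.

(** * The Demazure-Lusztig representation *)

Section Endomorphisms.
Variables (K : fieldType) (P : Type) (p0 : P).

(* The base point [p0] is only recorded in the type to make [1 != 0] hold. *)
Record endo (base : P) := Endo {
  efun :> (P -> K) -> P -> K;
  efun_linear : forall c f g p,
    efun (fun p => c * f p + g p) p = c * efun f p + efun g p
}.
Local Notation E := (endo p0).

HB.instance Definition _ := gen_eqMixin E.
HB.instance Definition _ := gen_choiceMixin E.

Lemma endoP (u v : E) : (forall f p, u f p = v f p) -> u = v.
Proof.
case: u v => [u hu] [v hv] /= e; have {}e : u = v.
  by apply/funext => f; apply/funext => p; exact: e.
by rewrite e in hu *; congr Endo; exact: Prop_irrelevance.
Qed.

Program Definition endo0 : E := @Endo p0 (fun _ _ => 0) _.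
Next Obligation. by rewrite mulr0 addr0. Qed.
Program Definition endo1 : E := @Endo p0 id _.
Program Definition endoN (u : E) : E := @Endo p0 (fun f p => - u f p) _.
Next Obligation. by rewrite efun_linear opprD mulrN. Qed.
Program Definition endoD (u v : E) : E := @Endo p0 (fun f p => u f p + v f p) _.
Next Obligation. by rewrite !efun_linear mulrDr addrACA. Qed.
Program Definition endoM (u v : E) : E := @Endo p0 (fun f => u (v f)) _.
Next Obligation.
have -> : v (fun p => c * f p + g p) = (fun p => c * v f p + v g p).
  by apply/funext => p'; exact: efun_linear.
exact: efun_linear.
Qed.
Program Definition endoZ (a : K) (u : E) : E := @Endo p0 (fun f p => a * u f p) _.
Next Obligation. by rewrite efun_linear mulrDr mulrCA. Qed.

Fact endo_addA : associative endoD.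
Proof. by move=> u v x; apply: endoP => f p /=; rewrite addrA. Qed.
Fact endo_addC : commutative endoD.
Proof. by move=> u v; apply: endoP => f p /=; rewrite addrC. Qed.
Fact endo_add0 : left_id endo0 endoD.
Proof. by move=> u; apply: endoP => f p /=; rewrite add0r. Qed.
Fact endo_addN : left_inverse endo0 endoN endoD.
Proof. by move=> u; apply: endoP => f p /=; rewrite addNr. Qed.

HB.instance Definition _ :=
  GRing.isZmodule.Build E endo_addA endo_addC endo_add0 endo_addN.

Fact endo_mulA : associative endoM.
Proof. by move=> u v x; exact: endoP. Qed.
Fact endo_mul1 : left_id endo1 endoM.
Proof. by move=> u; exact: endoP. Qed.
Fact endo_mulr1 : right_id endo1 endoM.
Proof. by move=> u; exact: endoP. Qed.
Fact endo_mulDl : left_distributive endoM endoD.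
Proof. by move=> u v x; exact: endoP. Qed.
Fact endo_mulDr : right_distributive endoM endoD.
Proof.
move=> u v x; apply: endoP => f p /=.
have -> : (fun p => v f p + x f p) = (fun p => 1 * v f p + x f p).
  by apply/funext => p'; rewrite mul1r.
by rewrite efun_linear mul1r.
Qed.
Fact endo_1_neq0 : endo1 != endo0.
Proof.
apply/eqP => /(congr1 (fun u : E => u (fun=> 1) p0)) /= /eqP.
by rewrite oner_eq0.
Qed.

HB.instance Definition _ := GRing.Zmodule_isNzRing.Build E
  endo_mulA endo_mul1 endo_mulr1 endo_mulDl endo_mulDr endo_1_neq0.

Fact endo_scaleA a b u : endoZ a (endoZ b u) = endoZ (a * b) u.
Proof. by apply: endoP => f p /=; rewrite mulrA. Qed.
Fact endo_scale1 : left_id 1 endoZ.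
Proof. by move=> u; apply: endoP => f p /=; rewrite mul1r. Qed.
Fact endo_scaleDr : right_distributive endoZ +%R.
Proof. by move=> a u v; apply: endoP => f p /=; rewrite mulrDr. Qed.
Fact endo_scaleDl u a b : endoZ (a + b) u = endoZ a u + endoZ b u.
Proof. by apply: endoP => f p /=; rewrite mulrDl. Qed.

HB.instance Definition _ := GRing.Zmodule_isLmodule.Build K E
  endo_scaleA endo_scale1 endo_scaleDr endo_scaleDl.

Fact endo_scalerAl (a : K) (u v : E) : a *: (u * v) = (a *: u) * v.
Proof. exact: endoP. Qed.

HB.instance Definition _ := GRing.Lmodule_isLalgebra.Build K E endo_scalerAl.

Fact endo_scalerAr (a : K) (u v : E) : a *: (u * v) = u * (a *: v).
Proof.
apply: endoP => f p /=.
have -> : (fun p => a * v f p) = (fun p => a * v f p + (endo0 f p)).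
  by apply/funext => p'; rewrite addr0.
rewrite efun_linear /=.
(* What remains is that u kills the zero function, which follows from linearity once zero is written
   as 0 f + (-f + f). *)
have -> : (fun p => 0 : K) = (fun p => 0 * f p + (-1 * f p + f p)).
  by apply/funext => p'; rewrite mul0r mulN1r addNr addr0.
by rewrite !efun_linear mul0r mulN1r addNr !addr0.
Qed.

HB.instance Definition _ := GRing.Lalgebra_isAlgebra.Build K E endo_scalerAr.

Lemma endoME (u v : E) f : (u * v) f = u (v f). Proof. by []. Qed.
Lemma endoDE (u v : E) f p : (u + v) f p = u f p + v f p. Proof. by []. Qed.
Lemma endoNE (u : E) f p : (- u) f p = - u f p. Proof. by []. Qed.
Lemma endoZE a (u : E) f p : (a *: u) f p = a * u f p. Proof. by []. Qed.
Lemma endo1E f : (1 : E) f = f. Proof. by []. Qed.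

Lemma endo_sumE (I : Type) (s : seq I) (Q : pred I) (F : I -> E) f p :
  (\sum_(i <- s | Q i) F i) f p = \sum_(i <- s | Q i) F i f p.
Proof. by elim/big_rec2: _ => // i x y _ <-. Qed.

(** Multiplication operators, substitutions and Demazure-Lusztig operators all have this form, so
    linearity and the limit at tau = 1 are treated once for the three of them. *)
Program Definition wpull (a b : P -> K) (s : P -> P) : E :=
  @Endo p0 (fun f p => a p * f p + b p * f (s p)) _.
Next Obligation. by ring. Qed.

Lemma wpullE a b s f p : wpull a b s f p = a p * f p + b p * f (s p).
Proof. by []. Qed.

Definition mulop a : E := wpull a (fun=> 0) id.
Definition pullback s : E := wpull (fun=> 0) (fun=> 1) s.

Lemma mulopE a f p : mulop a f p = a p * f p.
Proof. by rewrite wpullE mul0r addr0. Qed.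

Lemma pullbackE s f p : pullback s f p = f (s p).
Proof. by rewrite wpullE mul0r mul1r add0r. Qed.

End Endomorphisms.

(** * Points of the torus and extended affine permutations *)

Section Points.
Variable m : nat.
Local Notation vec := {ffun 'I_m.+1 -> int}.

(* Extended affine permutations: [h] stands for the point x_i = w ^ (h i) of the
   torus, where w ^ m.+1 = q; distinctness modulo m.+1 keeps every
   x_i / x_j off the powers of q, so the denominators of the
   Demazure-Lusztig operators never vanish. *)
Definition distinct_mod (h : vec) :=
  [forall i, forall j, (i != j) ==> ~~ (m.+1%:Z %| h i - h j)%Z].

Lemma distinct_modP (h : vec) : reflect
  (forall i j, (m.+1%:Z %| h i - h j)%Z -> i = j) (distinct_mod h).
Proof.
apply: (iffP forallP) => [H i j ij|H i]; last first.
  by apply/forallP => j; apply/implyP; apply: contra => /H ->.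
have /forallP/(_ j) := H i; rewrite ij implybF negbK.
by move/eqP.
Qed.

Definition point := {h : vec | distinct_mod h}.
Definition coord (i : nat) (p : point) : int := val p (inord i).

Lemma point_ext (p p' : point) :
  (forall i, (i <= m)%N -> coord i p = coord i p') -> p = p'.
Proof.
move=> e; apply/val_inj/ffunP => i.
by have := e i (ltn_ord i); rewrite /coord inord_val.
Qed.

Lemma coord_distinct i j p : (i <= m)%N -> (j <= m)%N ->
  (m.+1%:Z %| coord i p - coord j p)%Z -> i = j.
Proof.
move=> im jm /(distinct_modP _ (valP p))/(congr1 val).
by rewrite /= !inordK.
Qed.

Lemma point_build (c : nat -> int) :
  (forall i j, (i <= m)%N -> (j <= m)%N -> (m.+1%:Z %| c i - c j)%Z -> i = j) ->
  {p : point | forall i, (i <= m)%N -> coord i p = c i}.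
Proof.
move=> cd; pose h : vec := [ffun i : 'I_m.+1 => c i].
have hP : distinct_mod h.
  apply/distinct_modP => i j; rewrite !ffunE => /cd e; apply/val_inj/e.
    exact: (ltn_ord i).
  exact: (ltn_ord j).
by exists (exist _ h hP) => i im; rewrite /coord ffunE inordK.
Qed.

Lemma swapn_le k i : (k < m)%N -> (i <= m)%N -> (swapn k i <= m)%N.
Proof. by rewrite /swapn; do ?case: eqP; lia. Qed.

Definition point_map_spec (F : nat -> nat) (b : nat -> int) :=
  forall p : point, {p' : point | forall i, (i <= m)%N ->
    coord i p' = coord (F i) p + m.+1%:Z * b i}.

(** Adding multiples of m+1 changes no residue, so an injective relabelling of the coordinates keeps
    them distinct modulo m+1. *)
Lemma point_map (F : nat -> nat) (b : nat -> int) :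
  (forall i, (i <= m)%N -> (F i <= m)%N) ->
  (forall i j, (i <= m)%N -> (j <= m)%N -> F i = F j -> i = j) ->
  point_map_spec F b.
Proof.
move=> Fm Finj p; apply: point_build => i j im jm.
case/dvdzP => z e; apply: Finj => //.
apply: (@coord_distinct _ _ p); [exact: Fm|exact: Fm|].
by apply/dvdzP; exists (z - (b i - b j)); rewrite mulrBl -e; ring.
Qed.

(** The identity is the default for k out of range, so that [swapp] is total. *)
Lemma swap_spec k : point_map_spec (if (k < m)%N then swapn k else id) (fun=> 0).
Proof.
apply: point_map => [i im|i j im jm]; case: ifP => // km.
  exact: swapn_le.
exact: (can_inj (swapnK k)).
Qed.
Definition swapp k (p : point) : point := sval (swap_spec k p).

(** Pulling back along this map turns x_0 into q x_m and x_(i+1) into x_i, as required of pi; the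
    shift by m+1 produces q = w^(m+1). *)
Lemma rot_spec : point_map_spec (fun i => if i is i'.+1 then i' else m)
  (fun i => (i == 0%N)%:Z).
Proof. by apply: point_map => [[|i]|[|i] [|j]]; lia. Qed.
Definition rotp (p : point) : point := sval (rot_spec p).

Lemma unrot_spec : point_map_spec (fun i => if i == m then 0%N else i.+1)
  (fun i => - (i == m)%:Z).
Proof. by apply: point_map => [i|i j]; do ?case: eqP; lia. Qed.
Definition unrotp (p : point) : point := sval (unrot_spec p).

Lemma shift_spec (b : vec) : point_map_spec id (fun i => b (inord i)).
Proof. by apply: point_map. Qed.
Definition shiftp b (p : point) : point := sval (shift_spec b p).

Lemma coord_swapp k i p : (k < m)%N -> (i <= m)%N ->
  coord i (swapp k p) = coord (swapn k i) p.
Proof. by move=> km im; rewrite (svalP (swap_spec k p)) // km mulr0 addr0. Qed.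

Lemma coord_rotp0 p : coord 0 (rotp p) = coord m p + m.+1%:Z.
Proof. by rewrite (svalP (rot_spec p)) //= mulr1. Qed.

Lemma coord_rotpS i p : (i < m)%N -> coord i.+1 (rotp p) = coord i p.
Proof. by move=> im; rewrite (svalP (rot_spec p)) //= mulr0 addr0. Qed.

Lemma coord_shiftp b i p : (i <= m)%N ->
  coord i (shiftp b p) = coord i p + m.+1%:Z * b (inord i).
Proof. by move=> im; rewrite (svalP (shift_spec b p)). Qed.

Lemma rotpK : cancel rotp unrotp.
Proof.
move=> p; apply: point_ext => i im; rewrite (svalP (unrot_spec _)) //.
have [->|im'] := eqVneq i m; last by rewrite coord_rotpS ?oppr0 ?mulr0 ?addr0; lia.
by rewrite coord_rotp0 mulrN1 addrK.
Qed.

Lemma unrotpK : cancel unrotp rotp.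
Proof.
move=> p; apply: point_ext => -[|i] im; last first.
  rewrite coord_rotpS // (svalP (unrot_spec _)) ?(ltnW im) //.
  have -> : (i == m) = false by lia.
  by rewrite oppr0 mulr0 addr0.
rewrite coord_rotp0 (svalP (unrot_spec _)) // eqxx.
by rewrite mulrN1 subrK.
Qed.

Lemma swappK k : (k < m)%N -> involutive (swapp k).
Proof.
by move=> km p; apply: point_ext => i im; rewrite !coord_swapp ?swapnK ?swapn_le.
Qed.

Lemma swapp_braid k p : (k.+1 < m)%N ->
  swapp k (swapp k.+1 (swapp k p)) = swapp k.+1 (swapp k (swapp k.+1 p)).
Proof.
move=> km; have km' : (k < m)%N by lia.
apply: point_ext => i im; rewrite !coord_swapp ?swapn_le //.
by congr (coord _ p); rewrite /swapn; do ?case: eqP; lia.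
Qed.

Lemma swapp_comm k l p : (k.+1 < l)%N -> (l < m)%N ->
  swapp k (swapp l p) = swapp l (swapp k p).
Proof.
move=> kl lm; have km : (k < m)%N by lia.
apply: point_ext => i im; rewrite !coord_swapp ?swapn_le //.
by congr (coord _ p); rewrite /swapn; do ?case: eqP; lia.
Qed.

Lemma swapp_rotp k p : (k.+1 < m)%N -> swapp k.+1 (rotp p) = rotp (swapp k p).
Proof.
move=> km; have km' : (k < m)%N by lia.
apply: point_ext => i im; rewrite coord_swapp //.
case: i im => [|i] im.
  rewrite /= !coord_rotp0 coord_swapp //; congr (coord _ p + _).
  by rewrite /swapn; do ?case: eqP; lia.
have -> : swapn k.+1 i.+1 = (swapn k i).+1.
  by rewrite /swapn; do ?case: eqP; lia.
rewrite coord_rotpS; last by rewrite /swapn; do ?case: eqP; lia.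
by rewrite coord_rotpS // coord_swapp // ltnW.
Qed.

(** After two rotations the coordinates 0 and 1 are the former m-1 and m, both shifted by m+1, so
    exchanging them is exchanging m-1 and m beforehand. *)
Lemma swapp_rotp2 p : (0 < m)%N -> swapp 0 (rotp (rotp p)) = rotp (rotp (swapp m.-1 p)).
Proof.
move=> m0; have m1 : (m.-1 < m)%N by lia.
have rot2 i p' : (i <= m)%N -> coord i (rotp (rotp p')) =
    coord (if i is i'.+2 then i' else m.-1 + i)%N p' +
    m.+1%:Z * (i <= 1)%N%:Z.
  case: i => [|[|i]] im.
  - by rewrite coord_rotp0 -(prednK m0) coord_rotpS ?prednK // addn0 mulr1.
  - by rewrite coord_rotpS // coord_rotp0 addn1 prednK // mulr1.
  - by rewrite !coord_rotpS ?mulr0 ?addr0 //; lia.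
apply: point_ext => i im; rewrite coord_swapp // !rot2 ?swapn_le // coord_swapp //.
  by congr (coord _ p + _ * _); rewrite /swapn; case: i im => [|[|i]] /= im;
    do ?case: eqP; lia.
by case: i im => [|[|i]]; lia.
Qed.

Lemma point_exists : exists p : point, forall i, (i <= m)%N -> coord i p = i%:Z.
Proof.
have [|p pE] := @point_build (fun i => i%:Z); last by exists p.
move=> i j im jm /dvdzP [z]; have [z0|z0|->] := ltrgtP z 0; [nia|nia|lia].
Qed.

End Points.

(** * Relations of the operators T, X and pi *)

Section Representation.
Variables (K : fieldType) (m : nat) (p0 : point m) (w tau : K).
Hypothesis m_gt0 : (0 < m)%N.
Hypothesis w0 : w != 0.
Hypothesis w_inf : forall z : int, w ^ z = 1 -> z = 0.
Hypothesis tau0 : tau != 0.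

Local Notation E := (endo K p0).
Local Notation wp := (@wpull K (point m) p0).
Definition tdiff := tau - tau^-1.
Definition coordX i (p : point m) : K := w ^ coord i p.
(** The operator T_k is tau s_k + alpha (1 - s_k) with this alpha. The factor tau - tau^-1 makes
    alpha vanish at tau = 1, where T_k becomes s_k. *)
Definition alphaT k p := tdiff * coordX k.+1 p / (coordX k.+1 p - coordX k p).

(* Demazure-Lusztig operators. *)
Definition opT k : E := wpull p0 (alphaT k) (fun p => tau - alphaT k p) (swapp k).
Definition opTi k : E := opT k - tdiff%:A.
Definition opX i : E := mulop p0 (coordX i).
Definition opXi i : E := mulop p0 (fun p => (coordX i p)^-1).
Definition oppi : E := pullback K p0 (@rotp m).
Definition oppii : E := pullback K p0 (@unrotp m).
Definition opq : E := (w ^+ m.+1)%:A.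

Lemma opTE k f p : opT k f p =
  alphaT k p * f p + (tau - alphaT k p) * f (swapp k p).
Proof. exact: wpullE. Qed.
Lemma opXE i f p : opX i f p = coordX i p * f p.
Proof. exact: mulopE. Qed.
Lemma opXiE i f p : opXi i f p = (coordX i p)^-1 * f p.
Proof. exact: mulopE. Qed.
Lemma oppiE f p : oppi f p = f (rotp p). Proof. exact: pullbackE. Qed.
Lemma oppiiE f p : oppii f p = f (unrotp p). Proof. exact: pullbackE. Qed.

Lemma coordX_neq0 i p : coordX i p != 0.
Proof. exact: expfz_neq0. Qed.

(** Equal values would force equal exponents, since no nonzero power of w is 1, and this contradicts
    distinctness modulo m+1. *)
Lemma coordX_sub i j p : (i <= m)%N -> (j <= m)%N -> i != j ->
  coordX i p - coordX j p != 0.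
Proof.
move=> im jm ij; rewrite subr_eq0; apply: contraNneq ij => e.
have : w ^ (coord i p - coord j p) = 1.
  by rewrite expfzDr // -invr_expz -/(coordX i p) e mulfV // coordX_neq0.
move/w_inf => e0; apply/eqP; apply: (@coord_distinct m i j p) => //.
by rewrite e0 dvdz0.
Qed.

Lemma coordX_swapp k i p : (k < m)%N -> (i <= m)%N ->
  coordX i (swapp k p) = coordX (swapn k i) p.
Proof. by move=> km im; rewrite /coordX coord_swapp. Qed.

Lemma swapn1 k : swapn k k = k.+1. Proof. by rewrite /swapn eqxx. Qed.
Lemma swapn2 k : swapn k k.+1 = k.
Proof. by rewrite /swapn eqxx; case: eqP => //; lia. Qed.
Lemma swapn_id k i : i != k -> i != k.+1 -> swapn k i = i.
Proof. by rewrite /swapn => /negPf -> /negPf ->. Qed.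

Lemma coordX_swapp1 k p : (k < m)%N -> coordX k (swapp k p) = coordX k.+1 p.
Proof. by move=> km; rewrite coordX_swapp ?swapn1 // ltnW. Qed.
Lemma coordX_swapp2 k p : (k < m)%N -> coordX k.+1 (swapp k p) = coordX k p.
Proof. by move=> km; rewrite coordX_swapp ?swapn2. Qed.
Lemma coordX_swapp_id k i p : (k < m)%N -> (i <= m)%N -> i != k -> i != k.+1 ->
  coordX i (swapp k p) = coordX i p.
Proof. by move=> km im ik ik1; rewrite coordX_swapp ?swapn_id. Qed.

Lemma opT2 k : (k < m)%N -> opT k * opT k = tdiff *: opT k + 1.
Proof.
move=> km; apply: endoP => f p; rewrite endoDE endoZE endoME endo1E !opTE.
rewrite /alphaT coordX_swapp1 // coordX_swapp2 // swappK // /tdiff.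
have := coordX_sub p km (ltnW km) (negbT (gtn_eqF (ltnSn k))).
move: (coordX k p) (coordX k.+1 p) => x y xy.
have yx : x - y != 0 by rewrite -opprB oppr_eq0.
by field; rewrite xy yx tau0.
Qed.

Lemma opT_Ti k : (k < m)%N -> opT k * opTi k = 1.
Proof.
by move=> km; rewrite /opTi mulrBr opT2 // mulr_algr addrC addKr.
Qed.

Lemma opTi_T k : (k < m)%N -> opTi k * opT k = 1.
Proof.
by move=> km; rewrite /opTi mulrBl opT2 // mulr_algl addrC addKr.
Qed.

Lemma opTTT k : (k.+1 < m)%N ->
  opT k * opT k.+1 * opT k = opT k.+1 * opT k * opT k.+1.
Proof.
move=> km; have km' := ltnW km.
apply: endoP => f p; rewrite !endoME !opTE.
rewrite swapp_braid // !swappK //.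
rewrite /alphaT.
have n1 : k != k.+2 by lia.
have n2 : k.+2 != k by lia.
have n3 : k.+2 != k.+1 by lia.
have n4 : k != k.+1 by lia.
have id1 p' : coordX k.+2 (swapp k p') = coordX k.+2 p'.
  by apply: coordX_swapp_id; lia.
have id2 p' : coordX k (swapp k.+1 p') = coordX k p'.
  by apply: coordX_swapp_id; lia.
have d1 := coordX_sub p km' (ltnW km') (negbT (gtn_eqF (ltnSn k))).
have d2 := coordX_sub p km km' n3.
have d3 := coordX_sub p km (ltnW km') n2.
rewrite !(id1, id2, coordX_swapp1, coordX_swapp2) //.
move: (coordX k p) (coordX k.+1 p) (coordX k.+2 p) d1 d2 d3 => x y z d1 d2 d3.
have d1' : x - y != 0 by rewrite -opprB oppr_eq0.
have d2' : y - z != 0 by rewrite -opprB oppr_eq0.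
have d3' : x - z != 0 by rewrite -opprB oppr_eq0.
(* The values of f on the orbit of p under the two swaps are now free variables, and the relation is
   an identity of rational functions in x, y, z. *)
move: (f p) (f (swapp k p)) (f (swapp k.+1 p)) => f0 f1 f2.
move: (f _) (f _) (f _) => f3 f4 f5.
rewrite /tdiff.
by field; rewrite ?d1 ?d2 ?d3 ?d1' ?d2' ?d3' ?tau0.
Qed.

Lemma opTT k l : (k.+1 < l)%N -> (l < m)%N -> opT k * opT l = opT l * opT k.
Proof.
move=> kl lm; have km : (k < m)%N by lia.
apply: endoP => f p; rewrite !endoME !opTE -(swapp_comm p kl lm).
have e1 : alphaT k (swapp l p) = alphaT k p.
  by rewrite /alphaT !coordX_swapp_id //; lia.
have e2 : alphaT l (swapp k p) = alphaT l p.
  by rewrite /alphaT !coordX_swapp_id //; lia.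
by rewrite e1 e2; ring.
Qed.

Lemma opTXT k : (k < m)%N -> opT k * opX k * opT k = opX k.+1.
Proof.
move=> km; apply: endoP => f p.
rewrite !endoME !(opTE, opXE).
rewrite /alphaT !coordX_swapp1 // coordX_swapp2 // swappK // /tdiff.
have := coordX_sub p km (ltnW km) (negbT (gtn_eqF (ltnSn k))).
move: (coordX k p) (coordX k.+1 p) => x y xy.
have yx : x - y != 0 by rewrite -opprB oppr_eq0.
by field; rewrite xy yx tau0.
Qed.

Lemma opTX k i : (k < m)%N -> (i <= m)%N -> i != k -> i != k.+1 ->
  opT k * opX i = opX i * opT k.
Proof.
move=> km im ik ik1; apply: endoP => f p.
rewrite !endoME !(opTE, opXE) coordX_swapp_id //.
by ring.
Qed.

Lemma opXXi i : opX i * opXi i = 1.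
Proof.
by apply: endoP => f p; rewrite endoME !(opXE, opXiE) mulVKf ?coordX_neq0.
Qed.

Lemma opXiX i : opXi i * opX i = 1.
Proof.
by apply: endoP => f p; rewrite endoME !(opXE, opXiE) mulKf ?coordX_neq0.
Qed.

Lemma opXX i j : opX i * opX j = opX j * opX i.
Proof. by apply: endoP => f p; rewrite !endoME !opXE mulrCA. Qed.

Lemma oppiV : oppi * oppii = 1.
Proof. by apply: endoP => f p; rewrite endoME !(oppiE, oppiiE) (rotpK, unrotpK). Qed.

Lemma oppVi : oppii * oppi = 1.
Proof. by apply: endoP => f p; rewrite endoME !(oppiE, oppiiE) (rotpK, unrotpK). Qed.

Lemma oppiX i : (i < m)%N -> oppi * opX i.+1 = opX i * oppi.
Proof.
move=> im; apply: endoP => f p.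
by rewrite !endoME oppiE !opXE oppiE /coordX coord_rotpS.
Qed.

Lemma oppiX0 : oppi * opX 0 = opq * opX m * oppi.
Proof.
apply: endoP => f p.
rewrite /opq mulr_algl !endoME endoZE oppiE !opXE oppiE /coordX.
by rewrite coord_rotp0 expfzDr // mulrA [_ * w ^+ _]mulrC.
Qed.

Lemma oppiT k : (k.+1 < m)%N -> oppi * opT k.+1 = opT k * oppi.
Proof.
move=> km; apply: endoP => f p.
rewrite !endoME oppiE !opTE !oppiE swapp_rotp // /alphaT /coordX.
by rewrite !coord_rotpS // ltnW.
Qed.

Lemma oppi2T : oppi * oppi * opT 0 = opT m.-1 * (oppi * oppi).
Proof.
have m1 : (m.-1 < m)%N by lia.
apply: endoP => f p; rewrite !endoME !oppiE !opTE !oppiE.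
(* Two rotations multiply both coordinates concerned by q, and alpha is homogeneous of degree 0. *)
rewrite swapp_rotp2 //; suff -> : alphaT 0 (rotp (rotp p)) = alphaT m.-1 p by [].
rewrite /alphaT /coordX coord_rotp0 coord_rotpS // coord_rotp0.
have -> : coord m (rotp p) = coord m.-1 p.
  by have := coord_rotpS p m1; rewrite prednK.
rewrite prednK // !expfzDr // -mulrBl mulrA -mulf_div divff ?mulr1 //.
exact: expfz_neq0.
Qed.

Lemma opq_comm x : opq * x = x * opq.
Proof. by rewrite /opq mulr_algl mulr_algr. Qed.

End Representation.

(** * The representation of the whole algebra *)

Section DahaRepresentation.
Variables (K : fieldType) (m' : nat).
Local Notation m := m'.+1.
Variables (p0 : point m) (w tau : K).
Hypothesis w0 : w != 0.
Hypothesis w_inf : forall z : int, w ^ z = 1 -> z = 0.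
Hypothesis tau0 : tau != 0.

Local Notation E := (endo K p0).
Local Notation opT := (@opT K m p0 w tau).
Local Notation opTi := (@opTi K m p0 w tau).
Local Notation opX := (@opX K m p0 w).
Local Notation opXi := (@opXi K m p0 w).

Let m0 : (0 < m)%N := isT.
Let TTi := opT_Ti p0 w0 w_inf tau0.
Let TiT := opTi_T p0 w0 w_inf tau0.
Let TTT := opTTT p0 m0 w0 w_inf tau0.
Let TT := opTT p0 m0 w0 tau0.
Let TXT := opTXT p0 w0 w_inf tau0.
Let TX := @opTX K m p0 w tau.
Let piT := oppiT p0 w tau.
Let pi2T := @oppi2T K m p0 w tau m0 w0 tau0.
Let piX := oppiX p0 w.
Let piX0 := oppiX0 p0 w0.
Let qC := @opq_comm K m p0 w.

Definition opY := jucysY m opT opTi (oppi K p0).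
Fixpoint opYi k : E := if k is k'.+1 then opT k' * opYi k' * opT k'
  else oppii K p0 * descTi opTi m.

Lemma opYYi k : (k <= m)%N -> opY k * opYi k = 1.
Proof.
elim: k => [|k IH] km.
  rewrite /= -mulrA (mulrA (oppi K p0)) oppiV mul1r.
  exact: (ascT_inv TTi).
rewrite /= -!mulrA (mulrA (opTi k) (opT k)) TiT // mul1r (mulrA (opY k)).
by rewrite IH ?mul1r ?TiT // ltnW.
Qed.

Lemma opYiY k : (k <= m)%N -> opYi k * opY k = 1.
Proof.
elim: k => [|k IH] km.
  rewrite -[opYi 0]/(oppii K p0 * descTi opTi m).
  rewrite -[opY 0]/(ascT opT 0 m * oppi K p0).
  rewrite -mulrA (mulrA (descTi _ _)) (descTi_inv TiT) // mul1r.
  exact: oppVi.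
rewrite /= -!mulrA (mulrA (opT k) (opTi k)) TTi // mul1r (mulrA (opYi k)).
by rewrite IH ?mul1r ?TTi // ltnW.
Qed.

Lemma opYY i j : (i <= m)%N -> (j <= m)%N -> opY i * opY j = opY j * opY i.
Proof. exact: (jucysY_comm m0 TTi TiT TTT TT piT pi2T). Qed.

Definition op_gen (x : daha_gen m.+1) : E :=
  match x with
  | GenT k => opT k | GenX i => opX i | GenXinv i => opXi i
  | GenY i => opY i | GenYinv i => opYi i
  end.

(** The parameter is w^(m+1) because a rotation shifts exponents by m+1. The relations of T and X
    are identities of operators, and those of the Y_i come from their construction out of pi. *)
Lemma daha_representation :
  exists psi : {rmorphism daha m.+1 (w ^+ m.+1) tau -> E},
  [/\ forall c x, psi (c *: x) = c *: psi x,
      forall k, psi (dahaT _ _ k) = opT k,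
      forall i, psi (dahaX _ _ i) = opX i /\ psi (dahaXinv _ _ i) = opXi i &
      forall i, psi (dahaY _ _ i) = opY i /\ psi (dahaYinv _ _ i) = opYi i].
Proof.
have [phi phiE] := free_alg_universal op_gen.
have phiA c : phi c%:A = c%:A by rewrite linearZ rmorph1.
have phi_rel a b : @daha_rel K m.+1 (w ^+ m.+1) tau a b -> phi a = phi b.
  case=> {a b}.
  - move=> k; rewrite rmorphM rmorphB rmorphD /= !phiA phiE /= rmorph0.
    rewrite mulrBl mulrDr (opT2 p0 w0 w_inf tau0 (ltn_ord k)) mulr_algr mulr_algl.
    rewrite scalerDr scalerA divff // /tdiff scalerBl.
    by rewrite scale1r [X in X - _]addrAC subrK subrr.
  - move=> k l kl; rewrite !rmorphM /= !phiE /= kl; apply: TTT; rewrite -kl.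
    exact: ltn_ord.
  - move=> k l /orP[] kl; rewrite !rmorphM /= !phiE /=; first by apply: TT.
    by apply/esym/TT.
  - move=> k i j ik jk; rewrite !rmorphM /= !phiE /= ik jk; exact: TXT.
  - move=> k i ik ik1; rewrite !rmorphM /= !phiE /=; apply: TX => //.
    exact: (ltn_ord i).
  - move=> k i j ik jk; rewrite !rmorphM rmorphB /= !phiA !phiE /= ik jk.
    by [].
  - move=> k i ik ik1; rewrite !rmorphM /= !phiE /=.
    apply: (T_jucysY m0 TTi TiT TTT TT piT) => //; exact: (ltn_ord i).
  - move=> i; rewrite rmorphM linearZ rmorphM /= rmorph_prod /= !phiE /=.
    under eq_bigr do rewrite phiE.
    have := prod_jucysY_X m0 TTi TiT TTT TT TXT TX piT pi2T piX piX0 qC.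
    move=> /(_ i (ltn_ord i)); rewrite big_mkord -/opY /opq mulr_algl.
    by [].
  - move=> k i j k0 i0 j1; rewrite !rmorphM /= !phiE /= k0 i0 j1.
    have : opYi 1 * opX 0 * opY 1 * opXi 0 = opT 0 * opT 0; last by [].
    have e : opX 0 * opY 1 = opY 1 * (opT 0 * opT 0) * opX 0.
      exact: (X0_jucysY1 m0 TTi TiT TXT TX piX).
    move: (opYi 1) (opY 1) (@opYiY 1 isT) e => yi y yV e.
    by rewrite -(mulrA yi) e !mulrA yV mul1r -mulrA opXXi // mulr1.
  - by move=> i j; rewrite !rmorphM /= !phiE /=; exact: opXX.
  - by move=> i; rewrite rmorphM rmorph1 /= !phiE /=; exact: opXXi.
  - by move=> i; rewrite rmorphM rmorph1 /= !phiE /=; exact: opXiX.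
  - move=> i j; rewrite !rmorphM /= !phiE /=.
    by apply: opYY; [exact: (ltn_ord i)|exact: (ltn_ord j)].
  - by move=> i; rewrite rmorphM rmorph1 /= !phiE /=; exact: (opYYi (ltn_ord i)).
  - by move=> i; rewrite rmorphM rmorph1 /= !phiE /=; exact: (opYiY (ltn_ord i)).
have [psi [psiZ psiE]] := alg_quot_universal phi_rel.
by exists psi; split=> [//|k|i|i]; rewrite ?psiE ?phiE.
Qed.

End DahaRepresentation.

(** * Spanning monomials of the double affine Hecke algebra *)

Section DahaSpanning.
Variables (K : fieldType) (m' : nat) (q tau : K).
Local Notation m := m'.+1.
Local Notation H := (daha m.+1 q tau).
Local Notation vec := {ffun 'I_m.+1 -> int}.
Hypothesis tau0 : tau != 0.
Hypothesis q0 : q != 0.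

Definition daha_scalar (c : K) : H := c *: (1 : H).

Fact daha_scalar_zmod : zmod_morphism daha_scalar.
Proof. by move=> a b; rewrite /daha_scalar scalerBl. Qed.
Fact daha_scalar_monoid : monoid_morphism daha_scalar.
Proof.
split=> [|a b]; first by rewrite /daha_scalar scale1r.
by rewrite /daha_scalar -alg_quot_scalerAl mul1r scalerA.
Qed.
HB.instance Definition _ :=
  GRing.isZmodMorphism.Build K H daha_scalar daha_scalar_zmod.
HB.instance Definition _ :=
  GRing.isMonoidMorphism.Build K H daha_scalar daha_scalar_monoid.

Lemma daha_scalarE c x : daha_scalar c * x = c *: x.
Proof. by rewrite /daha_scalar -alg_quot_scalerAl mul1r. Qed.

Lemma daha_scalarC c x : daha_scalar c * x = x * daha_scalar c.
Proof. by rewrite daha_scalarE /daha_scalar -alg_quot_scalerAr mulr1. Qed.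

(* Generators indexed by natural numbers; [inord] sends an index out of range
   to 0, so every statement needs its bounds. *)
Definition natT k : H := @dahaT K m.+1 q tau (inord k : 'I_m'.+1).
Definition natTi k : H := natT k - daha_scalar (tau - tau^-1).
Definition natX i : H := @dahaX K m.+1 q tau (inord i).
Definition natXi i : H := @dahaXinv K m.+1 q tau (inord i).
Definition natY i : H := @dahaY K m.+1 q tau (inord i).
Definition natYi i : H := @dahaYinv K m.+1 q tau (inord i).


Lemma hT_Ti k : natT k * natTi k = 1.
Proof. by have [] := @dahaT_Tinv K m.+1 q tau (inord k : 'I_m'.+1) tau0. Qed.

Lemma hTi_T k : natTi k * natT k = 1.
Proof. by have [] := @dahaT_Tinv K m.+1 q tau (inord k : 'I_m'.+1) tau0. Qed.

Lemma hTE k : natT k = natTi k + daha_scalar (tau - tau^-1).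
Proof. by rewrite /natTi subrK. Qed.

Lemma hTTT k : (k.+1 < m)%N -> natT k * natT k.+1 * natT k = natT k.+1 * natT k * natT k.+1.
Proof.
move=> km; have e : (inord k.+1 : 'I_m'.+1) = (inord k : 'I_m'.+1).+1 :> nat.
  by rewrite !inordK //; lia.
by have := quot_pi_rel (@daha_braid K m.+1 q tau _ _ e); rewrite !rmorphM.
Qed.

Lemma hTT k l : (k.+1 < l)%N -> (l < m)%N -> natT k * natT l = natT l * natT k.
Proof.
move=> kl lm; have e : ((inord k : 'I_m'.+1).+1 < (inord l : 'I_m'.+1))%N ||
    ((inord l : 'I_m'.+1).+1 < (inord k : 'I_m'.+1))%N.
  by rewrite !inordK //; lia.
by have := quot_pi_rel (@daha_TT K m.+1 q tau _ _ e); rewrite !rmorphM.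
Qed.

Let inord_T k : (k < m)%N -> (inord k : 'I_m'.+1) = k :> nat.
Proof. exact: inordK. Qed.
Let inord_X i : (i <= m)%N -> (inord i : 'I_m.+1) = i :> nat.
Proof. exact: inordK. Qed.

Lemma hTXT k : (k < m)%N -> natT k * natX k * natT k = natX k.+1.
Proof.
move=> km.
have := quot_pi_rel (@daha_TXT K m.+1 q tau (inord k : 'I_m'.+1) (inord k) (inord k.+1) _ _).
by rewrite !rmorphM inord_T // !inord_X //; [apply|apply: ltnW].
Qed.

Lemma hTX k i : (k < m)%N -> (i <= m)%N -> i != k -> i != k.+1 ->
  natT k * natX i = natX i * natT k.
Proof.
move=> km im ik ik1.
have := quot_pi_rel (@daha_TX K m.+1 q tau (inord k : 'I_m'.+1) (inord i) _ _).
by rewrite !rmorphM inord_T // !inord_X //; apply.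
Qed.

Lemma hTYT k : (k < m)%N -> natTi k * natY k * natTi k = natY k.+1.
Proof.
move=> km.
have TiE : natTi k = quot_pi _ (fgen K (@GenT m.+1 (inord k : 'I_m'.+1)) - (tau - tau^-1)%:A).
  by rewrite rmorphB /= quot_pi_scalable rmorph1.
have := quot_pi_rel (@daha_TYT K m.+1 q tau (inord k : 'I_m'.+1) (inord k) (inord k.+1) _ _).
by rewrite 2!rmorphM /= -TiE inord_T // !inord_X //; [apply|apply: ltnW].
Qed.

Lemma hTY k i : (k < m)%N -> (i <= m)%N -> i != k -> i != k.+1 ->
  natT k * natY i = natY i * natT k.
Proof.
move=> km im ik ik1.
have := quot_pi_rel (@daha_TY K m.+1 q tau (inord k : 'I_m'.+1) (inord i) _ _).
by rewrite !rmorphM inord_T // !inord_X //; apply.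
Qed.

Lemma hXX i j : natX i * natX j = natX j * natX i.
Proof.
by have := quot_pi_rel (@daha_XX K m.+1 q tau (inord i) (inord j)); rewrite !rmorphM.
Qed.

Lemma hXXi i : natX i * natXi i = 1.
Proof.
by have := quot_pi_rel (@daha_XXinv K m.+1 q tau (inord i)); rewrite rmorphM rmorph1.
Qed.

Lemma hXiX i : natXi i * natX i = 1.
Proof.
by have := quot_pi_rel (@daha_XinvX K m.+1 q tau (inord i)); rewrite rmorphM rmorph1.
Qed.

Lemma hYY i j : natY i * natY j = natY j * natY i.
Proof.
by have := quot_pi_rel (@daha_YY K m.+1 q tau (inord i) (inord j)); rewrite !rmorphM.
Qed.

Lemma hYYi i : natY i * natYi i = 1.
Proof.
by have := quot_pi_rel (@daha_YYinv K m.+1 q tau (inord i)); rewrite rmorphM rmorph1.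
Qed.

Lemma hYiY i : natYi i * natY i = 1.
Proof.
by have := quot_pi_rel (@daha_YinvY K m.+1 q tau (inord i)); rewrite rmorphM rmorph1.
Qed.

Lemma hX0Y1 : natX 0 * natY 1 = natY 1 * (natT 0 * natT 0) * natX 0.
Proof.
have e : natYi 1 * natX 0 * natY 1 * natXi 0 = natT 0 * natT 0.
  have := quot_pi_rel (@daha_YXYX K m.+1 q tau (inord 0 : 'I_m'.+1) (inord 0) (inord 1) _ _ _).
  by rewrite expr2 !rmorphM inord_T // !inord_X //; apply.
rewrite -e !mulrA hYYi mul1r.
by rewrite -(mulrA _ (natXi 0)) hXiX mulr1.
Qed.

Lemma hYtildeE : dahaYtilde m.+1 q tau = \prod_(0 <= i < m.+1) natY i.
Proof. by rewrite big_mkord; apply: eq_bigr => i _; rewrite /natY inord_val. Qed.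

Lemma hYX i : dahaYtilde m.+1 q tau * natX i = q *: (natX i * dahaYtilde m.+1 q tau).
Proof.
have := quot_pi_rel (daha_YX q tau (inord i : 'I_m.+1)).
by rewrite quot_pi_scalable !rmorphM /= rmorph_prod.
Qed.

Definition pbw_elt (t : vec * seq nat * vec) : H :=
  monom natX natXi t.1.1 * (Tword natT t.1.2 * monom natY natYi t.2).

(** The span contains 1 and is stable under left multiplication by every generator, so
    [free_alg_ind] shows that it is everything. *)
Lemma daha_pbw (x : H) : exists (s : seq (vec * seq nat * vec)) (c : _ -> K),
  [/\ uniq s, forall t, t \in s -> t.1.2 \in nfwords m &
   x = \sum_(t <- s) c t *: pbw_elt t].
Proof.
have YX0 : (\prod_(0 <= i < m.+1) natY i) * natX 0 =
    daha_scalar q * (natX 0 * (\prod_(0 <= i < m.+1) natY i)).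
  by rewrite -hYtildeE hYX daha_scalarE.
have [N1 NT NX NY] := pbw_spanning daha_scalarC (mulfV q0) (mulVf q0) (ltn0Sn m')
  (fun k _ => hT_Ti k) (fun k _ => hTi_T k) (fun k _ => hTE k) hTTT hTT hTXT hTX
  hTYT hTY (fun i j _ _ => hXX i j) (fun i _ => hXXi i)
  (fun i _ => hXiX i) (fun i j _ _ => hYY i j)
  (fun i _ => hYYi i) (fun i _ => hYiY i) hX0Y1 YX0.
set N := lin_span _ _ in N1 NT NX NY.
suff /lin_span_sum [s [c [us sD e]]] : N x.
  by exists s, c; split=> //; rewrite e; apply: eq_bigr => t _; rewrite daha_scalarE.
elim/alg_quotW: x => a; elim/free_alg_ind: a => [|a b Na Nb|c a Na|g a Na].
- by rewrite rmorph1.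
- by rewrite rmorphD; exact: lin_spanD.
- by rewrite quot_pi_scalable -daha_scalarE; exact: lin_spanZ.
rewrite rmorphM; case: g => i.
- by have := NT i _ (ltn_ord i) Na; rewrite /natT inord_val.
- by have [+ _] := NX i _ (ltn_ord i) Na; rewrite /natX inord_val.
- by have [_ +] := NX i _ (ltn_ord i) Na; rewrite /natXi inord_val.
- by have [+ _] := NY i _ (ltn_ord i) Na; rewrite /natY inord_val.
- by have [_ +] := NY i _ (ltn_ord i) Na; rewrite /natYi inord_val.
Qed.

End DahaSpanning.


(** * The limit tau = 1 *)

Section Fractions.
Local Open Scope quotient_scope.
Variable R : idomainType.

Lemma fraction_numden (x : {fraction R}) :
  exists n d : R, d != 0 /\ x = tofrac n / tofrac d.
Proof.
elim/quotW: x => x; exists (frac x).1, (frac x).2; have d0 := denom_ratioP x.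
split=> //; have dF : tofrac (frac x).2 != 0 by rewrite tofrac_eq0.
apply: (mulIf dF); rewrite divfK //.
rewrite !piE; apply/eqmodP; rewrite /= FracField.equivfE /FracField.mulf.
by rewrite !numden_Ratio ?oner_eq0 ?mulf_neq0 // ?oner_eq0 // !mulr1 mulrC.
Qed.

End Fractions.

(** * Values of rational functions at tau = 1 *)

Section Reduction.
Variable F : fieldType.
Local Notation K := {fraction {poly F}}.
Local Notation "p %:F" := (@FracField.tofrac _ p).

(* [k] is regular at 1 with value [c]. *)
Definition red (k : K) (c : F) := exists n d : {poly F},
  [/\ d.[1] != 0, k = n%:F / d%:F & c = n.[1] / d.[1]].

Let horner_neq0 (d : {poly F}) : d.[1] != 0 -> d%:F != 0.
Proof. by apply: contraNneq => /eqP; rewrite tofrac_eq0 => /eqP ->; rewrite horner0. Qed.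

Lemma red_inj k c c' : red k c -> red k c' -> c = c'.
Proof.
move=> [n [d [d0 -> ->]]] [n' [d' [d'0 e ->]]].
have /eqP : n%:F * d'%:F = n'%:F * d%:F.
  by apply/eqP; rewrite -eqr_div ?horner_neq0 // e.
rewrite -!tofracM tofrac_eq => /eqP /(congr1 (horner^~ 1)).
by rewrite !hornerM => e'; apply/eqP; rewrite eqr_div // e'.
Qed.

Lemma red_poly p : red p%:F p.[1].
Proof.
by exists p, 1; rewrite hornerC tofrac1 !divr1; split=> //; exact: oner_neq0.
Qed.

Lemma red_const c : red c%:P%:F c.
Proof. by have := red_poly c%:P; rewrite hornerC. Qed.

Lemma red0 : red 0 0.
Proof. by have := red_const 0; rewrite tofrac0. Qed.

Lemma red1 : red 1 1.
Proof. by have := red_const 1; rewrite tofrac1. Qed.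

Lemma redD k k' c c' : red k c -> red k' c' -> red (k + k') (c + c').
Proof.
move=> [n [d [d0 -> ->]]] [n' [d' [d'0 -> ->]]].
exists (n * d' + n' * d), (d * d'); rewrite hornerM mulf_neq0 //.
split=> //; last by rewrite hornerD !hornerM addf_div.
by rewrite addf_div ?horner_neq0 // tofracD !tofracM.
Qed.

Lemma redM k k' c c' : red k c -> red k' c' -> red (k * k') (c * c').
Proof.
move=> [n [d [d0 -> ->]]] [n' [d' [d'0 -> ->]]].
exists (n * n'), (d * d'); rewrite !hornerM mulf_neq0 //.
by split=> //; rewrite ?tofracM mulf_div.
Qed.

Lemma redN k c : red k c -> red (- k) (- c).
Proof.
by move=> [n [d [d0 -> ->]]]; exists (- n), d; rewrite hornerN tofracN !mulNr.
Qed.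

Lemma redB k k' c c' : red k c -> red k' c' -> red (k - k') (c - c').
Proof. by move=> h h'; apply: redD => //; exact: redN. Qed.

Lemma redV k c : c != 0 -> red k c -> red k^-1 c^-1.
Proof.
move=> c0 [n [d [d0 -> e]]]; exists d, n; split; rewrite ?e ?invf_div //.
by apply: contraNneq c0; rewrite e => ->; rewrite mul0r.
Qed.

Lemma common_denominator (I : eqType) (s : seq I) (c : I -> K) :
  exists (d : {poly F}) (p : I -> {poly F}), d != 0 /\
    forall t, t \in s -> d%:F * c t = (p t)%:F.
Proof.
elim: s => [|i s [d [p [d0 IH]]]]; first by exists 1, (fun=> 0); rewrite oner_neq0.
have [n [e [e0 ce]]] := fraction_numden (c i).
have eF : e%:F != 0 by rewrite tofrac_eq0.
exists (d * e), (fun t => if t == i then d * n else e * p t).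
split=> [|t]; first by rewrite mulf_neq0.
rewrite inE; case: eqP => [-> _|_ /= /IH h].
  by rewrite ce !tofracM -mulrA [e%:F * _]mulrC divfK.
by rewrite !tofracM -h mulrAC mulrC mulrA.
Qed.

(** As long as all the polynomials vanish at 1, a common factor X - 1 is divided out; each division
    lowers the size of the nonzero [p t0], so the process stops. *)
Lemma normalise_at1 (I : eqType) (s : seq I) (p : I -> {poly F}) :
  (exists2 t, t \in s & p t != 0) ->
  exists (k : nat) (p' : I -> {poly F}),
    (forall t, t \in s -> p t = ('X - 1%:P) ^+ k * p' t) /\
    exists2 t, t \in s & (p' t).[1] != 0.
Proof.
case=> t0 t0s; have [n] := ubnP (size (p t0)).
elim: n p => // n IH p; rewrite ltnS => pn pt0.
have [/hasP [t ts pt]|/hasPn h] := boolP (has (fun t => (p t).[1] != 0) s).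
  by exists 0, p; split; [move=> t' _; rewrite expr0 mul1r|exists t].
have [p' pE] : exists p' : I -> {poly F}, forall t, t \in s ->
    p t = p' t * ('X - 1%:P).
  exists (fun t => p t %/ ('X - 1%:P)) => t ts; rewrite divpK // dvdp_XsubCl.
  by have := h t ts; rewrite negbK.
have p't0 : p' t0 != 0 by apply: contraNneq pt0 => e; rewrite pE // e mul0r.
have [|k [p'' [e hp]]] := IH p' _ p't0.
  by apply: leq_trans pn; rewrite (pE _ t0s) size_Mmonic ?monicXsubC // size_XsubC addn2.
exists k.+1, p''; split=> // t ts.
by rewrite pE // e // exprS mulrC mulrA.
Qed.

Lemma normalise_family (I : eqType) (s : seq I) (c : I -> K) :
  (exists2 t, t \in s & c t != 0) ->
  exists (l : K) (d : I -> F), (forall t, t \in s -> red (l * c t) (d t)) /\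
    exists2 t, t \in s & d t != 0.
Proof.
case=> t0 t0s c0; have [e [p [e0 pE]]] := common_denominator s c.
have eF : e%:F != 0 by rewrite tofrac_eq0.
have pt0 : p t0 != 0.
  by rewrite -tofrac_eq0 -(pE _ t0s); exact: (mulf_neq0 eF c0).
have [k [p' [p'E [t1 t1s p't1]]]] := normalise_at1 (ex_intro2 _ _ t0 t0s pt0).
have X0 : (('X - 1%:P : {poly F}) ^+ k)%:F != 0.
  by rewrite tofrac_eq0; apply: expf_neq0; rewrite polyXsubC_eq0.
(* The scalar clears the denominators and then removes the largest common power of X - 1. *)
exists (e%:F / (('X - 1%:P) ^+ k)%:F), (fun t => (p' t).[1]); split; last by exists t1.
move=> t ts; have -> : e%:F / (('X - 1%:P) ^+ k)%:F * c t = (p' t)%:F.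
  by rewrite mulrAC (pE _ ts) (p'E _ ts) tofracM mulrAC (mulfV X0) mul1r.
exact: red_poly.
Qed.

End Reduction.

(** * Limits of operators *)

Section OperatorReduction.
Variables (F : fieldType) (P : Type) (p0 : P).
Local Notation K := {fraction {poly F}}.
Local Notation EK := (endo K p0).
Local Notation EF := (endo F p0).

(** A relation and not a map, since an operator over K may send regular functions to singular ones.
    Testing on all regular functions makes it compatible with composition. *)
Definition redop (u : EK) (v : EF) := forall f g,
  (forall p, red (f p) (g p)) -> forall p, red (u f p) (v g p).

Lemma redop1 : redop 1 1. Proof. by []. Qed.
Lemma redop0 : redop 0 0. Proof. by move=> *; exact: red0. Qed.
Lemma redopM u u' v v' : redop u v -> redop u' v' -> redop (u * u') (v * v').
Proof. by move=> h h' f g fg; apply: h; exact: h'. Qed.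
Lemma redopD u u' v v' : redop u v -> redop u' v' -> redop (u + u') (v + v').
Proof. by move=> h h' f g fg p; apply: redD; [exact: h|exact: h']. Qed.
Lemma redopN u v : redop u v -> redop (- u) (- v).
Proof. by move=> h f g fg p; apply: redN; exact: h. Qed.
Lemma redopZ a b u v : red a b -> redop u v -> redop (a *: u) (b *: v).
Proof. by move=> ab h f g fg p; apply: redM => //; exact: h. Qed.

Lemma redop_wpull a b a' b' s : (forall p, red (a p) (a' p)) ->
  (forall p, red (b p) (b' p)) -> redop (wpull p0 a b s) (wpull p0 a' b' s).
Proof. by move=> ha hb f g fg p; rewrite !wpullE; apply: redD; exact: redM. Qed.

Lemma redop_prod (I : eqType) (s : seq I) (u : I -> EK) (v : I -> EF) :
  (forall i, i \in s -> redop (u i) (v i)) ->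
  redop (\prod_(i <- s) u i) (\prod_(i <- s) v i).
Proof.
move=> h; rewrite big_seq [\prod_(i <- s) v i]big_seq.
apply: (big_ind2 (fun x y => redop x y)) => [|a b c d|i].
- exact: redop1.
- exact: redopM.
- exact: h.
Qed.

Lemma redop_sum (I : eqType) (s : seq I) (u : I -> EK) (v : I -> EF) :
  (forall i, i \in s -> redop (u i) (v i)) ->
  redop (\sum_(i <- s) u i) (\sum_(i <- s) v i).
Proof.
move=> h; rewrite big_seq [\sum_(i <- s) v i]big_seq.
apply: (big_ind2 (fun x y => redop x y)) => [|a b c d|i].
- exact: redop0.
- exact: redopD.
- exact: h.
Qed.

Lemma redopX u v k : redop u v -> redop (u ^+ k) (v ^+ k).
Proof.
by move=> h; elim: k => [|k IH]; rewrite ?exprS; [exact: redop1|exact: redopM].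
Qed.

(** Every function over F lifts to a regular one with constant values, so it can be used to test the
    limit. *)
Lemma redop_inj u v v' : redop u v -> redop u v' -> v = v'.
Proof.
move=> h h'; apply: endoP => g p.
have fg p' : red (@FracField.tofrac _ (g p')%:P) (g p') by exact: red_const.
exact: red_inj (h _ _ fg p) (h' _ _ fg p).
Qed.

End OperatorReduction.

Section GeneratorReduction.
Variables (F : fieldType) (m' : nat).
Local Notation m := m'.+1.
Variables (p0 : point m) (w : F).
Hypothesis w0 : w != 0.
Hypothesis w_inf : forall z : int, w ^ z = 1 -> z = 0.
Local Notation K := {fraction {poly F}}.
Local Notation tofrac := (@FracField.tofrac {poly F}).
Definition wfrac : K := tofrac w%:P.
Definition taufrac : K := tofrac 'X.

Lemma wfrac_exp z : wfrac ^ z = tofrac (w ^ z)%:P.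
Proof.
pose f : {rmorphism F -> K} := tofrac \o polyC.
exact/esym/(fmorphXz f).
Qed.

Lemma wfrac_neq0 : wfrac != 0.
Proof. by rewrite tofrac_eq0 polyC_eq0. Qed.

Lemma wfrac_inf z : wfrac ^ z = 1 -> z = 0.
Proof.
rewrite wfrac_exp -tofrac1 => /eqP; rewrite tofrac_eq -polyC1 => /eqP/polyC_inj.
exact: w_inf.
Qed.

Lemma taufrac_neq0 : taufrac != 0.
Proof. by rewrite tofrac_eq0 polyX_eq0. Qed.

Lemma red_taufrac : red taufrac 1.
Proof. by have := red_poly ('X : {poly F}); rewrite hornerX. Qed.

Lemma red_tdiff : red (tdiff taufrac) (tdiff 1).
Proof.
by apply: redB; [|apply: redV; first exact: oner_neq0]; exact: red_taufrac.
Qed.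

Lemma red_coordX i (p : point m) : red (coordX wfrac i p) (coordX w i p).
Proof. by rewrite /coordX wfrac_exp; exact: red_const. Qed.

Lemma redop_T k : (k < m)%N ->
  redop (opT p0 wfrac taufrac k) (opT p0 w 1 k).
Proof.
move=> km.
have ra (p : point m) : red (alphaT wfrac taufrac k p) (alphaT w 1 k p).
  apply: redM; first by (apply: redM; [exact: red_tdiff|exact: red_coordX]).
  (* The denominator has no tau in it: its limit is a difference of two coordinates of a point,
     hence nonzero. *)
  apply: redV; last by (apply: redB; exact: red_coordX).
  by apply: (coordX_sub w0 w_inf) => //; [exact: ltnW|lia].
apply: redop_wpull => // p; apply: redB => //; exact: red_taufrac.
Qed.

Lemma redop_Ti k : (k < m)%N ->
  redop (opTi p0 wfrac taufrac k) (opTi p0 w 1 k).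
Proof.
move=> km; apply: redopD; first exact: redop_T.
by apply: redopN; apply: redopZ; [exact: red_tdiff|exact: redop1].
Qed.

Lemma redop_X i : redop (opX p0 wfrac i) (opX p0 w i).
Proof.
apply: redop_wpull => p; [exact: red_coordX|exact: red0].
Qed.

Lemma redop_Xi i : redop (opXi p0 wfrac i) (opXi p0 w i).
Proof.
apply: redop_wpull => p; last exact: red0.
by apply: redV; [exact: coordX_neq0|exact: red_coordX].
Qed.

Lemma redop_pullback s : redop (pullback K p0 s) (pullback F p0 s).
Proof. by apply: redop_wpull => p; [exact: red0|exact: red1]. Qed.

Lemma redop_Y i : (i <= m)%N ->
  redop (opY p0 wfrac taufrac i) (opY p0 w 1 i).
Proof.
elim: i => [|i IH] im.
  apply: redopM; last exact: redop_pullback.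
  rewrite /ascT !big_mkord.
  by apply: redop_prod => k _; exact: redop_T.
apply: redopM; last exact: redop_Ti.
by apply: redopM; [exact: redop_Ti|apply: IH; lia].
Qed.

Lemma redop_Yi i : (i <= m)%N ->
  redop (opYi p0 wfrac taufrac i) (opYi p0 w 1 i).
Proof.
elim: i => [|i IH] im.
  apply: redopM; first exact: redop_pullback.
  have h k : (k <= m)%N -> redop (descTi (opTi p0 wfrac taufrac) k)
      (descTi (opTi p0 w 1) k).
    elim: k => [|k IHk] km; first exact: redop1.
    by apply: redopM; [exact: redop_Ti|apply: IHk; lia].
  exact: h.
apply: redopM; last exact: redop_T.
by apply: redopM; [exact: redop_T|apply: IH; lia].
Qed.

End GeneratorReduction.

(** * The operators at tau = 1 *)

Section ClassicalLimit.
Variables (F : fieldType) (m' : nat).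
Local Notation m := m'.+1.
Local Notation vec := {ffun 'I_m.+1 -> int}.
Variables (p0 : point m) (w : F).
Hypothesis w0 : w != 0.
Hypothesis w_inf : forall z : int, w ^ z = 1 -> z = 0.
Local Notation T := (opT p0 w 1).
Local Notation Ti := (opTi p0 w 1).
Local Notation Y := (opY p0 w 1).
Local Notation Yi := (opYi p0 w 1).
Local Notation X := (opX p0 w).
Local Notation Xi := (opXi p0 w).

Let tdiff1 : tdiff (1 : F) = 0.
Proof. by rewrite /tdiff invr1 subrr. Qed.

Lemma opT_at1 k f p : T k f p = f (swapp k p).
Proof. by rewrite opTE /alphaT tdiff1 !mul0r add0r subr0 mul1r. Qed.

Lemma opTi_at1 k : Ti k = T k.
Proof. by rewrite /opTi tdiff1 scale0r subr0. Qed.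

Lemma opTT_at1 k : (k < m)%N -> T k * T k = 1.
Proof. by move=> km; apply: endoP => f p; rewrite endoME !opT_at1 swappK. Qed.

Fixpoint swapps k (p : point m) : point m :=
  if k is k'.+1 then swapp k' (swapps k' p) else p.

Lemma coord_swapps k i p : (k <= m)%N -> (i <= m)%N -> coord i (swapps k p) =
  coord (if i < k then i.+1 else if i == k then 0 else i)%N p.
Proof.
elim: k i => [|k IH] i km im /=.
  by case: i im => [|i] im.
rewrite coord_swapp // IH; [|lia|exact: swapn_le].
by congr (coord _ p); rewrite /swapn; repeat case: ifP; lia.
Qed.

Lemma ascT_at1 k f p : (k <= m)%N -> ascT T 0 k f p = f (swapps k p).
Proof.
elim: k f => [|k IH] f km; first by rewrite /ascT big_geq.
by rewrite /ascT big_nat_recr // endoME IH ?opT_at1 // ltnW.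
Qed.

Lemma opY_at1 i f p : Y (i : 'I_m.+1) f p = f (shiftp (unitv i) p).
Proof.
have vE (j : nat) : (j <= m)%N -> unitv i (inord j) = (j == i)%:Z.
  by move=> jm; rewrite ffunE -val_eqE /= inordK.
case: i vE => i im vE.
have {vE} h j q : (j <= m)%N -> coord j (shiftp (unitv (Ordinal im)) q) =
    coord j q + m.+1%:Z * (j == i)%:Z.
  by move=> jm; rewrite coord_shiftp // vE.
(* The shift is generalised to any map with the same effect on coordinates, so that the induction on
   the index is free of the bound carried by the ordinal. *)
rewrite [nat_of_ord _]/=; move: (shiftp _) h => sh.
elim: i {im} (im : (i <= m)%N) f p sh => [|i IH] im f p sh h.
  rewrite -[Y 0]/(ascT T 0 m * oppi F p0) endoME ascT_at1 // oppiE.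
  congr f; apply: point_ext => -[|j] jm; rewrite h //.
    by rewrite coord_rotp0 coord_swapps // ltnn eqxx mulr1.
  by rewrite coord_rotpS // coord_swapps ?jm ?mulr0 ?addr0 // ltnW.
have [sh' h'] : exists sh' : point m -> point m, forall j q, (j <= m)%N ->
    coord j (sh' q) = coord j q + m.+1%:Z * (j == i)%:Z.
  exists (shiftp [ffun j : 'I_m.+1 => (val j == i)%:Z]) => j q jm.
  by rewrite coord_shiftp // ffunE /= inordK.
rewrite -[Y i.+1]/(Ti i * Y i * Ti i) !opTi_at1 !endoME opT_at1.
rewrite (IH _ _ _ sh') //; last exact: ltnW.
rewrite opT_at1; congr f; apply: point_ext => j jm.
rewrite coord_swapp // h' ?swapn_le // coord_swapp ?swapn_le // swapnK h //.
by congr (_ + _ * _); rewrite /swapn; do ?case: eqP; lia.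
Qed.

Lemma opYi_at1 (i : 'I_m.+1) f p : Yi i f p = f (shiftp (- unitv i) p).
Proof.
have e : pullback F p0 (shiftp (- unitv i)) * Y i = 1.
  apply: endoP => g q; rewrite endoME pullbackE opY_at1; congr g.
  apply: point_ext => j jm; rewrite !coord_shiftp // -addrA -mulrDr !ffunE.
  by rewrite addNr mulr0 addr0.
have := opYYi p0 w0 w_inf (oner_neq0 F) (ltn_ord i).
move=> /(congr1 (fun z => pullback F p0 (shiftp (- unitv i)) * z)).
by rewrite mulrA e mul1r mulr1 => ->; rewrite pullbackE.
Qed.

Lemma conjT_at1 k : (k < m)%N ->
  T k * (Xi k.+1 * (Y k.+1 - Yi k.+1)) * T k = Xi k * (Y k - Yi k).
Proof.
move=> km; have TT := opTT_at1 km.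
have eY : T k * Y k.+1 * T k = Y k.
  rewrite -[Y k.+1]/(Ti k * Y k * Ti k) opTi_at1; move: (Y k) => y.
  by rewrite !mulrA TT mul1r -mulrA TT mulr1.
have eYi : T k * Yi k.+1 * T k = Yi k.
  rewrite -[Yi k.+1]/(T k * Yi k * T k); move: (Yi k) => y.
  by rewrite !mulrA TT mul1r -mulrA TT mulr1.
have eX : T k * Xi k.+1 = Xi k * T k.
  apply: endoP => f p; rewrite !endoME opT_at1 !opXiE opT_at1.
  by rewrite coordX_swapp2.
by rewrite mulrA eX -!mulrA; congr (_ * _); rewrite mulrA mulrBr mulrBl eY eYi.
Qed.

(** This gives the limit of D_j for j = m - l, up to the scalar (q - q^-1)^-1. Each T_k is an
    involution at tau = 1, so the two products around X_m^-1 (Y_m - Y_m^-1) are inverse to each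
    other and conjugate the index m into m - l. *)
Lemma conj_ascT_at1 l : (l <= m)%N ->
  ascT T (m - l) m * (Xi m * (Y m - Yi m)) *
    (\prod_(0 <= k < l) T (m - k.+1)%N) =
  Xi (m - l)%N * (Y (m - l)%N - Yi (m - l)%N).
Proof.
elim: l => [|l IH] lm; first by rewrite subn0 /ascT !big_geq // mul1r mulr1.
have := IH (ltnW lm); have -> : (m - l = (m - l.+1).+1)%N by lia.
rewrite big_nat_recr // [ascT T (m - l.+1) m]big_ltn; last by lia.
rewrite -/(ascT T (m - l.+1).+1 m) => e.
rewrite -[RHS]conjT_at1; last by lia.
by rewrite -e -!mulrA.
Qed.

End ClassicalLimit.

(** * Linear independence at tau = 1 *)

Section Characters.
Variables (F : fieldType) (n : nat) (q : F).
Local Notation vec := {ffun 'I_n -> int}.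
Hypothesis q0 : q != 0.
Hypothesis q_inf : forall z : int, q ^ z = 1 -> z = 0.

Definition dotv (a v : vec) : int := \sum_i a i * v i.

Lemma dotvD a v i : dotv a (v + unitv i) = dotv a v + a i.
Proof.
rewrite /dotv; transitivity (\sum_j (a j * v j + a j * (j == i)%:Z)).
  by apply: eq_bigr => j _; rewrite !ffunE mulrDr.
rewrite big_split /=; congr (_ + _); rewrite (bigD1 i) //= eqxx mulr1 big1 ?addr0 //.
by move=> j /negPf ->; rewrite mulr0.
Qed.

Lemma dotv0 a : dotv a 0 = 0.
Proof. by rewrite /dotv big1 // => i _; rewrite ffunE mulr0. Qed.

(** Artin's elimination. If an exponent b other than a occurs, the relation at v + e_i minus q^(b_i)
    times the relation at v kills the terms of exponent b and multiplies those of exponent a by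
    q^(a_i) - q^(b_i), nonzero when a_i and b_i differ. Exponents may repeat in the list, hence the
    sum in the conclusion. *)
Lemma characters_independent (L : seq (F * vec)) :
  (forall v, \sum_(t <- L) t.1 * q ^ dotv t.2 v = 0) ->
  forall a, \sum_(t <- L | t.2 == a) t.1 = 0.
Proof.
move=> + a; have [k] := ubnP (size L); elim: k L => // k IH L; rewrite ltnS => Lk h.
have [/allP La|/allPn [t0 t0L t0a]] := boolP (all (fun t : F * vec => t.2 == a) L).
  have := h 0; rewrite big_seq_cond [X in _ -> X = 0]big_seq_cond => {2}<-.
  rewrite (eq_bigl (fun t => t \in L)); last first.
    by move=> t; case tL : (t \in L) => //=; rewrite La.
  rewrite [RHS](eq_bigl (fun t => t \in L)); last by move=> t; rewrite andbT.
  by apply: eq_bigr => t _; rewrite dotv0 expr0z mulr1.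
pose b := t0.2; have [i bi] : exists i, b i != a i.
  apply/existsP; apply: contraNT t0a; rewrite negb_exists => /forallP e.
  by apply/eqP/ffunP => j; apply/eqP; have := e j; rewrite negbK.
pose L' := map (fun t : F * vec => (t.1 * (q ^ (t.2 i) - q ^ (b i)), t.2))
  [seq t <- L | t.2 != b].
have : \sum_(t <- L' | t.2 == a) t.1 = 0.
  apply: IH => [|v].
    rewrite size_map size_filter; apply: leq_trans Lk.
    rewrite -(count_predC (fun t : F * vec => t.2 != b)) -[X in (X < _)%N]addn0.
    rewrite ltn_add2l -has_count; apply/hasP; exists t0 => //=.
    by rewrite /= negbK.
  have e : \sum_(t <- L) (t.1 * q ^ dotv t.2 (v + unitv i) -
      q ^ (b i) * (t.1 * q ^ dotv t.2 v)) = 0.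
    by rewrite sumrB -mulr_sumr !h mulr0 subr0.
  rewrite big_map big_filter big_mkcond /= -[RHS]e; apply: eq_bigr => t _.
  rewrite dotvD expfzDr //; case: eqP => /= [->|_]; first by ring.
  by ring.
rewrite big_map big_filter_cond /=.
rewrite (eq_bigl (fun t : F * vec => t.2 == a)); last first.
  move=> t /=; case: (t.2 =P a) => [->|]; rewrite ?andbF ?andbT //.
  by apply: contraNneq bi => ->.
under eq_bigr => t /eqP -> do [].
rewrite -mulr_suml => /eqP; rewrite mulf_eq0 => /orP[/eqP //|].
rewrite subr_eq0 => /eqP e; have /q_inf : q ^ (b i - a i) = 1.
  by rewrite expfzDr // -invr_expz e mulfV // expfz_neq0.
by move/eqP; rewrite subr_eq0 (negPf bi).
Qed.

End Characters.

(** * Independence of the limit monomials *)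

Section Independence.
Variables (F : fieldType) (m' : nat).
Local Notation m := m'.+1.
Local Notation vec := {ffun 'I_m.+1 -> int}.
Local Notation idx := (vec * seq nat * vec)%type.
Variables (p0 : point m) (w : F).
Hypothesis w0 : w != 0.
Hypothesis w_inf : forall z : int, w ^ z = 1 -> z = 0.
Local Notation T := (opT p0 w 1).
Local Notation Y := (opY p0 w 1).
Local Notation Yi := (opYi p0 w 1).
Local Notation X := (opX p0 w).
Local Notation Xi := (opXi p0 w).

Definition coordv (p : point m) : vec := val p.

Lemma coordvE p (i : 'I_m.+1) : coordv p i = coord i p.
Proof. by rewrite /coord inord_val. Qed.

Definition chi (a : vec) (p : point m) : F := w ^ dotv (coordv p) a.

Lemma shiftpD b c p : shiftp b (shiftp c p) = shiftp (b + c) p :> point m.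
Proof.
apply: point_ext => i im; rewrite !coord_shiftp // ffunE.
by rewrite mulrDr [_ * b _ + _]addrC addrA.
Qed.

Lemma chiD a i p : chi (a + unitv i) p = coordX w i p * chi a p.
Proof. by rewrite /chi dotvD expfzDr // mulrC coordvE. Qed.

Lemma monomX_at1 a f p : monom X Xi a f p = chi a p * f p.
Proof.
have XXi i : (i < m.+1)%N -> X i * Xi i = 1 by move=> _; exact: opXXi.
have XiX i : (i < m.+1)%N -> Xi i * X i = 1 by move=> _; exact: opXiX.
have XX i j : (i < m.+1)%N -> (j < m.+1)%N -> X i * X j = X j * X i.
  by move=> _ _; exact: opXX.
elim/vec_ind: a => [|a i IH|a i IH].
- by rewrite monom0 endo1E /chi dotv0 expr0z mul1r.
- by rewrite -monomD // endoME opXE IH chiD mulrA.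
- rewrite -monomB // endoME opXiE IH -{1}(subrK (unitv i) a) chiD.
  by rewrite -mulrA mulKf // coordX_neq0.
Qed.

Lemma monomY_at1 b f p : monom Y Yi b f p = f (shiftp b p).
Proof.
have t1 := oner_neq0 F.
have YYi i : (i < m.+1)%N -> Y i * Yi i = 1 by exact: (opYYi p0 w0 w_inf t1).
have YiY i : (i < m.+1)%N -> Yi i * Y i = 1 by exact: (opYiY p0 w0 w_inf t1).
have YY i j : (i < m.+1)%N -> (j < m.+1)%N -> Y i * Y j = Y j * Y i.
  by move=> im jm; exact: (opYY p0 w0 w_inf t1).
elim/vec_ind: b p => [|b i IH|b i IH] p.
- rewrite monom0 endo1E; congr f; apply: point_ext => i im.
  by rewrite coord_shiftp // ffunE mulr0 addr0.
- by rewrite -monomD // endoME opY_at1 // IH shiftpD.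
- by rewrite -monomB // endoME opYi_at1 // IH shiftpD.
Qed.

(** The first letter acts first on the point, because pullbacks compose in the reverse order. *)
Fixpoint wordp (u : seq nat) (p : point m) : point m :=
  if u is k :: u' then wordp u' (swapp k p) else p.

Lemma actw_le u i : all (fun k => k < m)%N u -> (i <= m)%N -> (actw u i <= m)%N.
Proof. by elim: u => //= k u IH /andP[km uv] im; apply: swapn_le => //; exact: IH. Qed.

Lemma coord_wordp u i p : all (fun k => k < m)%N u -> (i <= m)%N ->
  coord i (wordp u p) = coord (actw u i) p.
Proof.
elim: u p => //= k u IH p /andP[km uv] im.
by rewrite IH // coord_swapp // actw_le.
Qed.

Lemma Tword_at1 u f p : Tword T u f p = f (wordp u p).
Proof.
elim: u p => [|k u IH] p; first by rewrite /Tword big_nil.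
by rewrite /Tword big_cons endoME opT_at1 // IH.
Qed.

(* At tau = 1 the algebra acts through a quantum torus extended by S_n. *)
Definition pbw_at1 (t : idx) : endo F p0 :=
  monom X Xi t.1.1 * (Tword T t.1.2 * monom Y Yi t.2).

Lemma pbw_at1E t f p :
  pbw_at1 t f p = chi t.1.1 p * f (shiftp t.2 (wordp t.1.2 p)).
Proof. by rewrite /pbw_at1 endoME monomX_at1 endoME Tword_at1 monomY_at1. Qed.

(** Modulo m+1 the shifts disappear and the coordinates of p have distinct residues. This recovers
    the permutation, hence its normal word, and then the shift. *)
Lemma shift_wordp_inj u u0 b b0 p : u \in nfwords m -> u0 \in nfwords m ->
  shiftp b (wordp u p) = shiftp b0 (wordp u0 p) -> u = u0 /\ b = b0.
Proof.
move=> um u0m e; have uv := nfwords_lt um; have u0v := nfwords_lt u0m.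
have eq i : (i <= m)%N -> coord (actw u i) p + m.+1%:Z * b (inord i) =
    coord (actw u0 i) p + m.+1%:Z * b0 (inord i).
  by move=> im; rewrite -!coord_wordp // -!coord_shiftp // e.
have uE : u = u0.
  apply: (nfwords_inj um u0m) => i im.
  apply: (@coord_distinct m _ _ p); [exact: actw_le|exact: actw_le|].
  apply/dvdzP; exists (b0 (inord i) - b (inord i)).
  have -> : coord (actw u i) p =
      coord (actw u0 i) p + m.+1%:Z * b0 (inord i) - m.+1%:Z * b (inord i).
    by rewrite -eq // addrK.
  by ring.
split=> //; apply/ffunP => i; have := eq i (ltn_ord i); rewrite uE inord_val.
by move/addrI/mulfI; apply.
Qed.

Lemma wexp_inf z : (w ^+ m.+1) ^ z = 1 -> z = 0.
Proof. by rewrite exprnP exprz_exp => /w_inf; lia. Qed.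

Lemma chi_shiftp a v p : chi a (shiftp v p) = chi a p * (w ^+ m.+1) ^ dotv a v.
Proof.
rewrite /chi exprnP exprz_exp -expfzDr //; congr (w ^ _).
rewrite /dotv mulr_sumr -big_split /=; apply: eq_bigr => i _.
rewrite !coordvE coord_shiftp; last exact: (ltn_ord i).
by rewrite inord_val; ring.
Qed.

(** Indices may repeat, because the list is later obtained by concatenating the expansions of the
    two sides of a commutation relation. *)
Lemma pbw_at1_independent (L : seq (F * idx)) :
  (forall t, t \in L -> t.2.1.2 \in nfwords m) ->
  \sum_(t <- L) t.1 *: pbw_at1 t.2 = 0 ->
  forall e, e.1.2 \in nfwords m -> \sum_(t <- L | t.2 == e) t.1 = 0.
Proof.
move=> Lv L0 [[a u] b] /= um.
pose L1 := [seq t <- L | (t.2.1.2 == u) && (t.2.2 == b)].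
have van p : \sum_(t <- L1) t.1 * chi t.2.1.1 p = 0.
  (* The delta function at this point isolates the terms with the given u and b. *)
  pose f (p' : point m) : F := (p' == shiftp b (wordp u p))%:R.
  have : (\sum_(t <- L) t.1 *: pbw_at1 t.2) f p = 0 by rewrite L0.
  rewrite endo_sumE => h; rewrite big_filter big_mkcond -[RHS]h.
  apply: eq_big_seq => t tL.
  rewrite endoZE pbw_at1E /f; case: (altP andP) => [[/eqP -> /eqP ->]|ne].
    by rewrite eqxx mulr1.
  case: eqP => [/shift_wordp_inj|_]; last by rewrite !mulr0.
  by move=> /(_ (Lv _ tL) um) [e1 e2]; rewrite e1 e2 !eqxx in ne.
pose q := w ^+ m.+1.
have q0 : q != 0 by rewrite expf_neq0.
(* Moving p along the shifts of [p0] by v multiplies the monomial x^a by q^(a.v), so the remaining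
   relation is one between characters of v. *)
have := @characters_independent F _ q q0 wexp_inf
  (map (fun t : F * idx => (t.1 * chi t.2.1.1 p0, t.2.1.1)) L1) _ a.
rewrite !big_map => h.
have : (\sum_(t <- L1 | t.2.1.1 == a) t.1) * chi a p0 = 0.
  rewrite mulr_suml -[RHS]h => [|v]; first by apply: eq_bigr => t /eqP ->.
  rewrite big_map -[RHS](van (shiftp v p0)).
  by apply: eq_bigr => t _; rewrite chi_shiftp mulrA.
move=> /eqP; rewrite mulf_eq0 => /orP[/eqP|]; last first.
  by rewrite (negPf (expfz_neq0 _ w0)).
rewrite big_filter_cond => {}h; rewrite -[RHS]h; apply: eq_bigl => t.
by case: t => c [[a' u'] b'] /=; rewrite !xpair_eqE; case: (a' == a); case: (u' == u); case: (b' == b).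
Qed.

End Independence.

Lemma nfwords_nil j : [::] \in nfwords j.
Proof.
elim: j => // j IH; apply/nfwordsSP; exists j.+1, [::].
by rewrite subnn.
Qed.

(** Iterating [next] stays in the finite list s while mu grows without bound. Applied to the support
    of the coefficients, it forbids endless propagation. *)
Lemma no_ascending_chain (I : eqType) (s : seq I) (Q : I -> Prop) (mu : I -> int)
    (next : I -> I) :
  (forall t, Q t -> t \in s) ->
  (forall t, Q t -> Q (next t) /\ mu t < mu (next t)) -> forall t, ~ Q t.
Proof.
move=> Qs Qnext t Qt.
have chain k : Q (iter k next t) /\ mu t + k%:Z <= mu (iter k next t).
  elim: k => [|k [IH1 IH2]] /=; first by rewrite addr0.
  by have [h1 h2] := Qnext _ IH1; split=> //; lia.
have bound t' : t' \in s -> mu t' <= (\sum_(x <- s) `|mu x|)%N%:Z.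
  move=> t's; suff : (`|mu t'| <= \sum_(x <- s) `|mu x|)%N by lia.
  by rewrite (big_rem t') //= leq_addr.
have [h1 h2] := chain (\sum_(x <- s) `|mu x| + `|mu t|).+1%N.
by have := bound _ (Qs _ h1); lia.
Qed.

Lemma sum_seq_pred1 (F : nmodType) (I : eqType) (s : seq I) (D : I -> F) t0 :
  uniq s -> (forall t, t \notin s -> D t = 0) ->
  \sum_(t <- s | t == t0) D t = D t0.
Proof.
move=> us D0; have [ts|ts] := boolP (t0 \in s).
  by rewrite -big_filter filter_pred1_uniq // big_seq1.
rewrite D0 // big_seq_cond big1 // => t /andP[t's /eqP e].
by rewrite e (negPf ts) in t's.
Qed.

(** * Coefficients of an element commuting with the limits of Y_i and e_ij *)

Section Coefficients.
Variables (F : fieldType) (m' : nat).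
Local Notation m := m'.+1.
Local Notation vec := {ffun 'I_m.+1 -> int}.
Local Notation idx := (vec * seq nat * vec)%type.
Variables (p0 : point m) (w : F).
Hypothesis w0 : w != 0.
Hypothesis w_inf : forall z : int, w ^ z = 1 -> z = 0.
Local Notation Y := (opY p0 w 1).
Local Notation Yi := (opYi p0 w 1).
Local Notation X := (opX p0 w).
Local Notation Xi := (opXi p0 w).
Local Notation op := (pbw_at1 p0 w).
Let q := w ^+ m.+1.

Let q0 : q != 0. Proof. by rewrite expf_neq0. Qed.
Let q_inf z : q ^ z = 1 -> z = 0. Proof. exact: wexp_inf. Qed.
Let opE a u b f p : op (a, u, b) f p = chi w a p * f (shiftp b (wordp u p)).
Proof. exact: pbw_at1E. Qed.

Let dotv_unit (a : vec) i : dotv a (unitv i) = a i.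
Proof. by rewrite -[unitv i]add0r dotvD dotv0 add0r. Qed.

(** The unit vector at the preimage of i under the permutation of u: the shift into which Y_i turns
    on crossing it. *)
Definition actv (u : seq nat) (i : 'I_m.+1) : vec :=
  [ffun j : 'I_m.+1 => (actw u j == i)%:Z].

Lemma op_Y a u b i : op (a, u, b) * Y (i : 'I_m.+1) = op (a, u, b + unitv i).
Proof.
apply: endoP => f p; rewrite endoME !opE opY_at1 //.
by rewrite shiftpD addrC.
Qed.

Lemma Y_op a u b i : u \in nfwords m ->
  Y (i : 'I_m.+1) * op (a, u, b) = q ^ a i *: op (a, u, b + actv u i).
Proof.
move=> um; apply: endoP => f p; rewrite endoME opY_at1 // endoZE !opE.
rewrite chi_shiftp // dotv_unit [chi w a p * _]mulrC -!mulrA; congr (_ * (_ * _)).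
rewrite -shiftpD; congr (f (shiftp b _)); apply: point_ext => j jm.
have uv := nfwords_lt um.
rewrite coord_wordp // !coord_shiftp ?actw_le // coord_wordp //.
by rewrite !ffunE -val_eqE /= !inordK // ltnS actw_le.
Qed.

Let coordX_shiftp (i : 'I_m.+1) b p :
  coordX w i (shiftp b p) = coordX w i p * q ^ b i.
Proof.
rewrite /coordX coord_shiftp; last exact: (ltn_ord i).
by rewrite inord_val expfzDr // /q exprnP exprz_exp.
Qed.

Let chi_unit (i j : 'I_m.+1) p :
  chi w (unitv i - unitv j) p = coordX w i p / coordX w j p.
Proof.
rewrite addrC chiD //; congr (_ * _).
have := chiD w0 (- unitv j) j p; rewrite addNr /chi dotv0 expr0z => e.
by apply: (mulfI (coordX_neq0 w0 j p)); rewrite -e mulfV // coordX_neq0.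
Qed.

(** Compared with [e_op], the only difference is the scalar: the shift by b multiplies x_i / x_j by
    q^(b_i - b_j). *)
Lemma op_e b (i j : 'I_m.+1) :
  op (0, [::], b) * (X i * Xi j * (Y j - Yi j)) = q ^ (b i - b j) *:
    (op (unitv i - unitv j, [::], b + unitv j) -
     op (unitv i - unitv j, [::], b - unitv j)).
Proof.
apply: endoP => f p.
rewrite endoME opE !endoME opXE opXiE endoDE endoNE endoZE endoDE endoNE !opE.
rewrite /= opY_at1 // opYi_at1 // !shiftpD [unitv j + b]addrC [- unitv j + b]addrC.
rewrite chi_unit !coordX_shiftp expfzDr // -invr_expz /chi dotv0 expr0z.
have := coordX_neq0 w0 j p; have := expfz_neq0 (b j) q0.
move: (coordX w i p) (coordX w j p) (q ^ b i) (q ^ b j) => x y u v v0 y0.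
by field; rewrite v0 y0.
Qed.

Lemma e_op b (i j : 'I_m.+1) :
  (X i * Xi j * (Y j - Yi j)) * op (0, [::], b) =
    (op (unitv i - unitv j, [::], b + unitv j) -
     op (unitv i - unitv j, [::], b - unitv j)).
Proof.
apply: endoP => f p.
rewrite 3!endoME opXE opXiE !endoDE !endoNE opY_at1 // opYi_at1 // !opE.
by rewrite /= !shiftpD chi_unit /chi !dotv0 !expr0z; ring.
Qed.

Variables (s : seq idx) (D : idx -> F).
Hypothesis s_uniq : uniq s.
Hypothesis s_nf : forall t, t \in s -> t.1.2 \in nfwords m.
Hypothesis D0 : forall t, t \notin s -> D t = 0.
Let z := \sum_(t <- s) D t *: op t.
Hypothesis zY : forall i : 'I_m.+1, z * Y i = Y i * z.
Hypothesis zE : forall i j : 'I_m.+1, i != j ->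
  z * (X i * Xi j * (Y j - Yi j)) = (X i * Xi j * (Y j - Yi j)) * z.

Let sum_shift (c : idx -> F) (g : idx -> idx) t0 e :
  (forall t, (g t == e) = (t == t0)) ->
  \sum_(t <- map (fun t : idx => (c t * D t, g t)) s | t.2 == e) t.1 = c t0 * D t0.
Proof.
move=> ge; rewrite big_map /= (eq_bigl _ _ ge).
apply: (sum_seq_pred1 (D := fun t => c t * D t)) => // t ts.
by rewrite D0 // mulr0.
Qed.

(** The coefficients at (a, u, b + e_i) on the two sides of z Y_i = Y_i z. *)
Lemma coef_shift a u b i : u \in nfwords m ->
  D (a, u, b) = q ^ a i * D (a, u, b + unitv i - actv u i).
Proof.
move=> um.
pose L1 := map (fun t : idx => (1 * D t, (t.1, t.2 + unitv i)) : F * idx) s.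
pose L2 := map (fun t : idx => (- q ^ t.1.1 i * D t, (t.1, t.2 + actv t.1.2 i)) : F * idx) s.
have L0 : \sum_(t <- L1 ++ L2) t.1 *: op t.2 = 0.
  rewrite big_cat !big_map /=; apply/eqP; rewrite addr_eq0 -sumrN; apply/eqP.
  transitivity (z * Y i).
    rewrite /z mulr_suml; apply: eq_bigr => -[[a' u'] b'] _.
    by rewrite -scalerAl op_Y mul1r.
  rewrite zY /z mulr_sumr; apply: eq_big_seq => -[[a' u'] b'] /s_nf /= um'.
  by rewrite -scalerAr Y_op // scalerA mulNr scaleNr opprK mulrC.
have := pbw_at1_independent w0 w_inf _ L0 (e := (a, u, b + unitv i)) um.
rewrite big_cat /= (@sum_shift _ _ (a, u, b) _); last first.
  by move=> [[a' u'] b']; rewrite !xpair_eqE /= (inj_eq (addIr _)).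
rewrite (@sum_shift _ _ (a, u, b + unitv i - actv u i) _); last first.
  move=> [[a' u'] b']; rewrite !xpair_eqE /=.
  have [->|] := eqVneq u' u; last by rewrite !andbF.
  by congr (_ && _); rewrite [RHS]eq_sym subr_eq eq_sym.
rewrite mul1r mulNr => h; apply/eqP; rewrite -subr_eq0; apply/eqP; apply: h.
by move=> t; rewrite mem_cat => /orP[] /mapP[t' /s_nf h ->].
Qed.

(** If u moves i, every application of [coef_shift] raises b_i by one and keeps the coefficient
    nonzero, which finite support excludes. *)
Lemma coef_word t : D t != 0 -> t.1.2 = [::].
Proof.
move=> Dt; have tm : t.1.2 \in nfwords m.
  by apply: s_nf; apply: contraNT Dt => /D0 ->.
case: t Dt tm => [[a u] b] Dt tm; have um : u \in nfwords m := tm.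
rewrite [_.1.2]/=; apply: contrapT => u0.
have [i iu] : exists i : 'I_m.+1, actw u i != i.
  apply: contrapT => h; apply: u0; apply: (nfwords_inj um (nfwords_nil m)) => i im.
  apply: contrapT => /eqP hi; apply: h; exists (inord i).
  by rewrite inordK.
pose Q (t : idx) := t.1.2 = u /\ D t != 0.
pose next (t : idx) : idx := (t.1, t.2 + unitv i - actv u i).
apply: (@no_ascending_chain _ s Q (fun t => t.2 i) next _ _ (a, u, b)) => //.
  by move=> t [_ h]; apply: contraNT h => /D0 ->.
move=> [[a' u'] b'] [/= -> h]; split; last first.
  by rewrite !ffunE eqxx (negPf iu) /=; lia.
split=> //; apply: contraNneq h => h.
by rewrite (coef_shift a' b' i um) /next /= in h *; rewrite h mulr0.
Qed.

(** For the trivial permutation [coef_shift] returns to the same index, so q^(a_i) = 1. *)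
Lemma coef_degX t : D t != 0 -> t.1.1 = 0.
Proof.
move=> Dt; have := coef_word Dt; move: t Dt => [[a u] b] /= Dt u0; subst u.
apply/ffunP => i; rewrite ffunE; apply: q_inf.
have := coef_shift a b i (nfwords_nil m).
have -> : b + unitv i - actv [::] i = b.
  by apply/ffunP => j; rewrite !ffunE /= val_eqE addrK.
by rewrite -[LHS]mul1r => /(mulIf Dt).
Qed.

(** The coefficients at (e_i - e_j, 1, b + e_j) in the commutation with the limit of e_ij show that
    (q^(b_i - b_j) - 1) D(b) is unchanged when b is replaced by b + 2 e_j. By finite support it is
    zero. *)
Lemma coef_degY t (i j : 'I_m.+1) : D t != 0 -> t.2 i = t.2 j.
Proof.
move=> Dt; have u0 := coef_word Dt; have a0 := coef_degX Dt.
have [->//|ij] := eqVneq i j.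
move: t Dt u0 a0 => [[a u] b] /= Dt u0 a0; subst u; subst a.
pose d (t : idx) := (q ^ (t.2 i - t.2 j) - 1) * D t.
suff /eqP : d (0, [::], b) = 0.
  rewrite /d mulf_eq0 (negPf Dt) orbF subr_eq0 => /eqP /q_inf /eqP.
  by rewrite subr_eq0 => /eqP.
have dD t : d t = (q ^ (t.2 i - t.2 j) - 1) * D t by [].
pose ev := unitv i - unitv j.
pose L1 := map (fun t : idx => ((q ^ (t.2 i - t.2 j) - 1) * D t, (t.1.1 + ev, t.1.2, t.2 + unitv j)) : F * idx) s.
pose L2 := map (fun t : idx => (- (q ^ (t.2 i - t.2 j) - 1) * D t, (t.1.1 + ev, t.1.2, t.2 - unitv j)) : F * idx) s.
have L0 : \sum_(t <- L1 ++ L2) t.1 *: op t.2 = 0.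
  rewrite big_cat !big_map /= -big_split /=.
  have := zE ij => /eqP; rewrite -subr_eq0 => /eqP h; rewrite -[RHS]h.
  rewrite /z mulr_suml mulr_sumr -sumrB; apply: eq_bigr => t _.
  rewrite -scalerAl -scalerAr.
  have [->|Dt'] := eqVneq (D t) 0; first by rewrite !mulr0 !scale0r addr0 subr0.
  have := coef_word Dt'; have := coef_degX Dt'; move: t Dt' => [[a u] b'] /= _ -> ->.
  rewrite add0r op_e e_op -scalerBr -{2}[op _ - op _]scale1r -scalerBl scalerA.
  by rewrite mulNr scaleNr -scalerBr mulrC.
have key b' : d (0, [::], b') = d (0, [::], b' + unitv j + unitv j).
  have := pbw_at1_independent w0 w_inf _ L0 (e := (ev, [::], b' + unitv j)) (nfwords_nil m).
  rewrite big_cat /= (@sum_shift _ _ (0, [::], b') _); last first.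
    move=> [[a' u'] b'']; rewrite !xpair_eqE /= (inj_eq (addIr _)).
    by rewrite -[X in _ == X]add0r (inj_eq (addIr _)).
  rewrite (@sum_shift _ _ (0, [::], b' + unitv j + unitv j) _); last first.
    move=> [[a' u'] b'']; rewrite !xpair_eqE /=.
    by rewrite -[_ == ev]subr_eq0 addrK subr_eq.
  rewrite /= mulNr => h; apply/eqP; rewrite -subr_eq0; apply/eqP; apply: h.
  by move=> t; rewrite mem_cat => /orP[] /mapP[t' /s_nf h ->].
apply: contrapT => /eqP db.
pose Q (t : idx) := t.1 = (0, [::]) /\ d t != 0.
pose next (t : idx) : idx := (t.1, t.2 + unitv j + unitv j).
apply: (@no_ascending_chain _ s Q (fun t => t.2 j) next _ _ (0, [::], b)) => //.
  by move=> t [_ h]; apply: contraNT h => /D0; rewrite dD => ->; rewrite mulr0.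
move=> [[a' u'] b'] [/= [-> ->] h]; split; last first.
  by rewrite !ffunE eqxx /=; lia.
by split=> //; rewrite /next /= -key.
Qed.

End Coefficients.

(** * The centre *)

Section Subalgebras.
Variables (K : comNzRingType) (A : algType K) (r : A -> A -> Prop).
Local Notation Q := (alg_quot r).

Lemma alg_quot_scaleM c (x y : Q) : (c *: x) * y = c *: (x * y).
Proof. by rewrite alg_quot_scalerAl. Qed.
Lemma alg_quot_Mscale c (x y : Q) : x * (c *: y) = c *: (x * y).
Proof. by rewrite alg_quot_scalerAr. Qed.

Lemma subalg_gen_prod (S : set Q) (I : Type) (s : seq I) (P : pred I) (F : I -> Q) :
  (forall i, P i -> subalg_gen S (F i)) -> subalg_gen S (\prod_(i <- s | P i) F i).
Proof.
move=> h; elim/big_ind: _ => // [|x y].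
  exact: subalg_gen1.
exact: subalg_genM.
Qed.

Lemma subalg_gen_sum (S : set Q) (I : Type) (s : seq I) (P : pred I) (F : I -> Q) :
  (forall i, P i -> subalg_gen S (F i)) -> subalg_gen S (\sum_(i <- s | P i) F i).
Proof.
move=> h; elim/big_ind: _ => // [|x y].
  by rewrite -(scale0r (1 : Q)); apply: subalg_genZ; exact: subalg_gen1.
exact: subalg_genD.
Qed.

Lemma subalg_gen_comm (S : set Q) (z : Q) :
  (forall x, S x -> z * x = x * z) ->
  forall x, subalg_gen S x -> z * x = x * z.
Proof.
move=> h x; elim=> {x} [x /h //||x y _ hx _ hy|x y _ hx _ hy|c x _ hx].
- by rewrite mulr1 mul1r.
- by rewrite mulrDr mulrDl hx hy.
- by rewrite mulrA hx -mulrA hy mulrA.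
- by rewrite alg_quot_Mscale alg_quot_scaleM hx.
Qed.

Lemma subalg_gen_centre (S B : set Q) :
  (forall x, S x -> centre_of (subalg_gen B) x) ->
  forall x, subalg_gen S x -> centre_of (subalg_gen B) x.
Proof.
move=> h x; elim=> {x} [x /h //||x y _ [bx cx] _ [By cy]
  |x y _ [bx cx] _ [By cy]|c x _ [bx cx]].
- by split=> [|y _]; [exact: subalg_gen1|rewrite mul1r mulr1].
- by split=> [|t Bt]; [exact: subalg_genD|rewrite mulrDl mulrDr cx // cy].
- split=> [|t Bt]; first exact: subalg_genM.
  by rewrite -mulrA cy // !mulrA cx.
- split=> [|t Bt]; first exact: subalg_genZ.
  by rewrite alg_quot_Mscale alg_quot_scaleM cx.
Qed.

End Subalgebras.

(** * Powers of Ytilde and the limit of a central element *)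

Section Centre.
Variables (F : fieldType) (m' : nat) (w : F).
Local Notation m := m'.+1.
Local Notation K := {fraction {poly F}}.
Hypothesis w0 : w != 0.
Hypothesis w_inf : forall z : int, w ^ z = 1 -> z = 0.
Local Notation W := (wfrac w).
Local Notation tau := (taufrac F).
Local Notation q := (W ^+ m.+1).
Local Notation H := (daha m.+1 q tau).
Local Notation vec := {ffun 'I_m.+1 -> int}.
Local Notation idx := (vec * seq nat * vec)%type.
Local Notation hT := (@natT K m' q tau).
Local Notation hX := (@natX K m' q tau).
Local Notation hXi := (@natXi K m' q tau).
Local Notation hY := (@natY K m' q tau).
Local Notation hYi := (@natYi K m' q tau).
Local Notation pbw := (@pbw_elt K m' q tau).
Local Notation Yt := (dahaYtilde m.+1 q tau : H).
Local Notation Yti := (dahaYtilde_inv m.+1 q tau : H).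
Local Notation B := (daha_gl m.+1 q tau).

Let W0 : W != 0. Proof. exact: wfrac_neq0. Qed.
Let q0 : q != 0. Proof. by rewrite expf_neq0. Qed.
Let tau0 : tau != 0. Proof. exact: taufrac_neq0. Qed.

Let Xh (i : 'I_m.+1) : dahaX q tau i = hX i. Proof. by rewrite /natX inord_val. Qed.
Let Xih (i : 'I_m.+1) : dahaXinv q tau i = hXi i. Proof. by rewrite /natXi inord_val. Qed.
Let Yh (i : 'I_m.+1) : dahaY q tau i = hY i. Proof. by rewrite /natY inord_val. Qed.
Let Yih (i : 'I_m.+1) : dahaYinv q tau i = hYi i. Proof. by rewrite /natYi inord_val. Qed.
Let Th (k : 'I_m) : @dahaT K m.+1 q tau k = hT k. Proof. by rewrite /natT inord_val. Qed.

Lemma Yt_Yti : Yt * Yti = 1. Proof. by have [] := dahaYtildeV m.+1 q tau. Qed.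
Lemma Yti_Yt : Yti * Yt = 1. Proof. by have [] := dahaYtildeV m.+1 q tau. Qed.

Lemma Yt_T k : (k < m)%N -> Yt * hT k = hT k * Yt.
Proof.
move=> km; rewrite hYtildeE; apply/esym.
apply: (T_prodY (Ti := natTi m' q tau) _ _ _ _ _ km).
- by move=> *; exact: hT_Ti.
- by move=> *; exact: hTi_T.
- exact: hTYT.
- exact: hTY.
- by move=> *; exact: hYY.
Qed.

Lemma Yt_Y i : Yt * hY i = hY i * Yt.
Proof.
by rewrite hYtildeE; apply/esym; apply: commr_prod_nat => k _; exact: hYY.
Qed.

Lemma Yt_Yi i : Yt * hYi i = hYi i * Yt.
Proof.
by apply: (commr_inverse (y := hY i)); rewrite ?hYYi ?hYiY // Yt_Y.
Qed.

Lemma Yt_Xi i : Yt * hXi i = q^-1 *: (hXi i * Yt).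
Proof.
have e : hXi i * Yt = q *: (Yt * hXi i).
  rewrite -[LHS]mulr1 -(@hXXi K m' q tau i) mulrA -[_ * Yt * _]mulrA hYX.
  by rewrite alg_quot_Mscale !alg_quot_scaleM !mulrA hXiX mul1r.
by rewrite e scalerA (mulVf q0) scale1r.
Qed.

Lemma Yt_D j : Yt * dahaD q tau (j : 'I_m.+1) = q^-1 *: (dahaD q tau j * Yt).
Proof.
rewrite /dahaD /dahaD_last Xih Yh Yih.
set P1 := \prod_(k < _ | _) _; set P2 := \prod_(k < _ | _) _.
have e1 : Yt * P1 = P1 * Yt.
  by apply: commr_prod => k _; rewrite Th; apply: Yt_T; exact: ltn_ord.
have e2 : Yt * P2 = P2 * Yt.
  by apply: commr_prod => k _; rewrite Th; apply: Yt_T; exact: ltn_ord.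
rewrite !alg_quot_Mscale !alg_quot_scaleM !alg_quot_Mscale.
rewrite [RHS]scalerA [_ * (_ - _)^-1]mulrC -scalerA; congr (_ *: _).
rewrite !mulrA e1 -(mulrA P1) Yt_Xi alg_quot_Mscale !alg_quot_scaleM; congr (_ *: _).
rewrite -!mulrA; congr (_ * (_ * _)); rewrite -e2 !mulrA; congr (_ * _).
by rewrite mulrBr mulrBl Yt_Y Yt_Yi.
Qed.

(** X_i contributes a factor q and D_j a factor q^-1. *)
Lemma Yt_e i j : Yt * daha_e q tau i j = daha_e q tau i j * Yt.
Proof.
rewrite /daha_e Xh mulrA hYX alg_quot_scaleM -mulrA Yt_D alg_quot_Mscale scalerA.
by rewrite (mulfV q0) scale1r mulrA.
Qed.

Lemma Yt_B x : B x -> Yt * x = x * Yt.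
Proof.
apply: subalg_gen_comm => y [[k ->]|[i ->]|[i ->]|[i [j [_ ->]]]].
- by rewrite Th; apply: Yt_T; exact: ltn_ord.
- by rewrite Yh Yt_Y.
- by rewrite Yih Yt_Yi.
- exact: Yt_e.
Qed.

Lemma Yt_in_B : B Yt.
Proof.
by apply: subalg_gen_prod => i _; apply: subalg_gen_mem; constructor 2; exists i.
Qed.

Lemma Yti_in_B : B Yti.
Proof.
by apply: subalg_gen_prod => i _; apply: subalg_gen_mem; constructor 3; exists i.
Qed.

Lemma Ytilde_central x : subalg_gen [set Yt; Yti]%classic x -> centre_of B x.
Proof.
apply: subalg_gen_centre => y [->|->]; split=> [|b Bb].
- exact: Yt_in_B.
- exact: Yt_B.
- exact: Yti_in_B.
- by apply/esym/(commr_inverse Yt_Yti Yti_Yt); apply/esym/Yt_B.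
Qed.

Definition central_idx (t : idx) :=
  (t.1 == (0, [::])) && [forall i, forall j, t.2 i == t.2 j].

(** The Y_i commute, so a Y-monomial with constant exponent is a power of Ytilde, or of its inverse
    when the exponent is negative. *)
Lemma pbw_central t : central_idx t -> subalg_gen [set Yt; Yti]%classic (pbw t).
Proof.
case: t => [[a u] b] /andP[/= /eqP[-> ->] /'forall_'forall_eqP bE].
rewrite /pbw_elt /= monom0 /Tword big_nil !mul1r.
have hYY' i j : (i < m.+1)%N -> (j < m.+1)%N -> hY i * hY j = hY j * hY i.
  by move=> _ _; exact: hYY.
have comm2 (G : 'I_m.+1 -> H) k : (forall i j, G i * G j = G j * G i) ->
    \prod_i (G i ^+ k) = (\prod_i G i) ^+ k.
  move=> GG; elim: k => [|k IH].
    by rewrite big1 // => i _; rewrite expr0.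
  rewrite [RHS]exprS -IH -prodrM_comm.
    by apply: eq_bigr => i _; exact: exprS.
  by move=> i j _ _; apply: commrX; exact: GG.
have hYiYi i j : hYi i * hYi j = hYi j * hYi i.
  have e : hY j * hYi i = hYi i * hY j.
    by apply: (commr_inverse (@hYYi K m' q tau i) (@hYiY K m' q tau i)); exact: hYY.
  by apply: (commr_inverse (@hYYi K m' q tau j) (@hYiY K m' q tau j)); rewrite e.
have -> : monom hY hYi b =
    match b ord0 with Posz k => Yt ^+ k | Negz k => Yti ^+ k.+1 end.
  transitivity (\prod_(i < m.+1) zpow (hY i) (hYi i) (b ord0)).
    by apply: eq_bigr => i _; rewrite (bE i ord0).
  case: (b ord0) => k /=.
    rewrite comm2 => [|i j]; last exact: hYY.
    by congr (_ ^+ _); apply: eq_bigr => i _; rewrite Yh.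
  rewrite comm2 => [|i j]; last exact: hYiYi.
  by congr (_ ^+ _); apply: eq_bigr => i _; rewrite Yih.
have pow x k : [set Yt; Yti]%classic x -> subalg_gen [set Yt; Yti]%classic (x ^+ k).
  move=> Sx; elim: k => [|k IH]; first exact: subalg_gen1.
  by rewrite [x ^+ _]exprS; apply: subalg_genM => //; exact: subalg_gen_mem.
by case: (b ord0) => k; apply: pow; [left|right].
Qed.

Let kap_neq0 : w ^+ m.+1 - (w ^+ m.+1)^-1 != 0.
Proof.
have wM0 : w ^+ m.+1 != 0 by rewrite expf_neq0.
apply/negP; rewrite subr_eq0 => /eqP e.
have : w ^ (m.+1 + m.+1)%N = 1 by rewrite -exprnP exprD {1}e mulVf.
by move/w_inf.
Qed.

Section Limit.
Variables (p0 : point m) (psi : {rmorphism H -> endo K p0}).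
Hypothesis psiZ : forall c x, psi (c *: x) = c *: psi x.
Hypothesis psiT : forall k, psi (dahaT _ _ k) = opT p0 W tau k.
Hypothesis psiX : forall i,
  psi (dahaX _ _ i) = opX p0 W i /\ psi (dahaXinv _ _ i) = opXi p0 W i.
Hypothesis psiY : forall i, psi (dahaY _ _ i) = opY p0 W tau i /\
  psi (dahaYinv _ _ i) = opYi p0 W tau i.

Let redop_psiY (i : 'I_m.+1) : redop (psi (hY i)) (opY p0 w 1 i).
Proof. by rewrite -Yh (psiY i).1; apply: redop_Y => //; exact: (ltn_ord i). Qed.

Let redop_psiYi (i : 'I_m.+1) : redop (psi (hYi i)) (opYi p0 w 1 i).
Proof. by rewrite -Yih (psiY i).2; apply: redop_Yi => //; exact: (ltn_ord i). Qed.

Let redop_psiX (i : 'I_m.+1) : redop (psi (hX i)) (opX p0 w i).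
Proof. by rewrite -Xh (psiX i).1; exact: redop_X. Qed.

Let redop_psiXi (i : 'I_m.+1) : redop (psi (hXi i)) (opXi p0 w i).
Proof. by rewrite -Xih (psiX i).2; exact: redop_Xi. Qed.

Lemma redop_pbw t : t.1.2 \in nfwords m -> redop (psi (pbw t)) (pbw_at1 p0 w t).
Proof.
move=> um; rewrite /pbw_elt !rmorphM /monom !rmorph_prod /=.
apply: redopM; [|apply: redopM].
- apply: redop_prod => i _.
  case: (t.1.1 i) => k; rewrite rmorphXn; apply: redopX.
    exact: redop_psiX.
  exact: redop_psiXi.
- apply: redop_prod => k ku; have km := allP (nfwords_lt um) _ ku.
  by rewrite psiT inordK //; exact: redop_T.
- apply: redop_prod => i _.
  case: (t.2 i) => k; rewrite rmorphXn; apply: redopX.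
    exact: redop_psiY.
  exact: redop_psiYi.
Qed.

Lemma redop_e (i j : 'I_m.+1) : redop (psi (daha_e q tau i j))
  ((w ^+ m.+1 - (w ^+ m.+1)^-1)^-1 *:
     (opX p0 w i * opXi p0 w j * (opY p0 w 1 j - opYi p0 w 1 j))).
Proof.
have w2 := kap_neq0; set kap := w ^+ m.+1 - _ in w2 *.
have redq : red q (w ^+ m.+1).
  by rewrite /wfrac -tofracXn -polyC_exp; exact: red_const.
have red_kap : red (q - q^-1)^-1 kap^-1.
  by apply: redV => //; apply: redB => //; apply: redV => //; rewrite expf_neq0.
have lm : (ord_last i : 'I_m.+1) = m :> nat by [].
rewrite /daha_e /dahaD /dahaD_last Xh Xih Yh Yih !rmorphM psiZ rmorphM rmorphB /=.
rewrite !rmorph_prod /=.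
have -> : \prod_(k < m | (j <= k)%N) psi (@dahaT K m.+1 q tau k) =
    \prod_(j <= k < m) opT p0 W tau k.
  by rewrite big_geq_mkord /=; apply: eq_bigr => k _; rewrite psiT.
have -> : \prod_(k < m | (j <= rev_ord k)%N) psi (@dahaT K m.+1 q tau (rev_ord k)) =
    \prod_(0 <= k < m - j) opT p0 W tau (m - k.+1)%N.
  (* [rev_ord k] is m - (k+1), so the condition that it be at least j cuts the range to k < m -
     j. *)
  rewrite (big_nat_widen _ _ m) ?leq_subr // big_mkord.
  apply: eq_big => [k|k _]; last by rewrite psiT.
  by have := ltn_ord k; rewrite /=; lia.
have jm : (j <= m)%N := ltn_ord j.
(* The limit is put back into the shape of the definition of D_j, so that the reduction can be
   checked factor by factor. *)
have ->: opX p0 w i * opXi p0 w j * (opY p0 w 1 j - opYi p0 w 1 j) =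
   opX p0 w i * (ascT (opT p0 w 1) j m *
     (opXi p0 w m * (opY p0 w 1 m - opYi p0 w 1 m)) *
     \prod_(0 <= k < m - j) opT p0 w 1 (m - k.+1)%N).
  have := conj_ascT_at1 p0 w0 (leq_subr j m); rewrite subKn // => ->.
  by rewrite mulrA.
rewrite -scalerAr -scalerAl -scalerAr; apply: redopZ => //.
apply: redopM; first exact: redop_psiX.
apply: redopM; first apply: redopM.
- by apply: redop_prod => k; rewrite mem_index_iota => kj; apply: redop_T => //; lia.
- apply: redopM; first exact: (redop_psiXi (ord_last j)).
  apply: redopD; first exact: (redop_psiY (ord_last j)).
  by apply: redopN; exact: (redop_psiYi (ord_last j)).
- by apply: redop_prod => k; rewrite mem_index_iota => kj; apply: redop_T => //; lia.
Qed.

End Limit.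

Lemma centre_sub z : centre_of B z -> subalg_gen [set Yt; Yti]%classic z.
Proof.
case=> _ zC; have [s [c [us sD zE]]] := daha_pbw tau0 q0 z.
pose zs := \sum_(t <- s | central_idx t) c t *: pbw t.
have zsS : subalg_gen [set Yt; Yti]%classic zs.
  by apply: subalg_gen_sum => t ct; apply: subalg_genZ; exact: pbw_central.
pose s' := [seq t <- s | ~~ central_idx t].
have zE' : z = zs + \sum_(t <- s') c t *: pbw t.
  by rewrite zE (bigID central_idx) /= big_filter.
have [/hasP [t0 t0s' c0]|/hasPn h] := boolP (has (fun t => c t != 0) s'); last first.
  rewrite zE' big_seq big1 ?addr0 // => t /h; rewrite negbK => /eqP ->.
  by rewrite scale0r.
have [l [d [dred [t1 t1s' dt1]]]] := normalise_family (ex_intro2 _ _ t0 t0s' c0).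
pose D t := if t \in s' then d t else 0.
have [p0 _] := point_exists m.
have [psi [psiZ psiT psiX psiY]] :=
  daha_representation p0 W0 (wfrac_inf w_inf) tau0.
pose zl := \sum_(t <- s') (l * c t) *: pbw t.
have zlC x : B x -> zl * x = x * zl.
  (* The rescaled remainder is a multiple of the difference of two elements commuting with the
     subalgebra. *)
  move=> Bx; have -> : zl = l *: (z - zs).
    by rewrite zE' addrAC subrr add0r scaler_sumr; apply: eq_bigr => t _; rewrite scalerA.
  rewrite alg_quot_scaleM alg_quot_Mscale mulrBl mulrBr zC //.
  by have [_ ->] := Ytilde_central zsS.
pose zb := \sum_(t <- s') D t *: pbw_at1 p0 w t.
have s'D t : t \in s' -> t.1.2 \in nfwords m.
  by rewrite mem_filter => /andP[_ /sD].
have red_zl : redop (psi zl) zb.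
  rewrite rmorph_sum /=; apply: redop_sum => t ts.
  rewrite psiZ; apply: redopZ; first by rewrite /D ts; exact: dred.
  by apply: redop_pbw => //; exact: s'D.
(* Both products are limits of one and the same operator, and limits are unique. *)
have comm_red x v : B x -> redop (psi x) v -> zb * v = v * zb.
  move=> Bx xv; apply: (@redop_inj _ _ _ (psi (zl * x))).
    by rewrite rmorphM; exact: redopM.
  by rewrite zlC // rmorphM; exact: redopM.
have zbY (i : 'I_m.+1) : zb * opY p0 w 1 i = opY p0 w 1 i * zb.
  apply: (comm_red (dahaY q tau i)); first by apply: subalg_gen_mem; constructor 2; exists i.
  by rewrite (psiY i).1; apply: redop_Y => //; exact: (ltn_ord i).
have zbE (i j : 'I_m.+1) : i != j ->
    zb * (opX p0 w i * opXi p0 w j * (opY p0 w 1 j - opYi p0 w 1 j)) =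
    (opX p0 w i * opXi p0 w j * (opY p0 w 1 j - opYi p0 w 1 j)) * zb.
  move=> ij; have := comm_red _ _ _ (redop_e psiZ psiT psiX psiY i j).
  rewrite -scalerAr -scalerAl => e; apply: (scalerI (invr_neq0 kap_neq0)).
  by apply: e; apply: subalg_gen_mem; constructor 4; exists i, j.
have us' : uniq s' by rewrite filter_uniq.
have D0 t : t \notin s' -> D t = 0 by rewrite /D => /negPf ->.
have Dt1 : D t1 != 0 by rewrite /D t1s'.
suff : central_idx t1 by move: t1s'; rewrite mem_filter => /andP[/negPf ->].
apply/andP; split.
  rewrite [t1.1]surjective_pairing.
  by rewrite (coef_degX w0 w_inf us' s'D D0 zbY Dt1) (coef_word w0 w_inf us' s'D D0 zbY Dt1).
apply/'forall_'forall_eqP => i j.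
exact: (coef_degY w0 w_inf us' s'D D0 zbY zbE i j Dt1).
Qed.

Theorem centre_daha_gl : centre_of B = subalg_gen [set Yt; Yti]%classic.
Proof.
apply/seteqP; split=> z; [exact: centre_sub|exact: Ytilde_central].
Qed.

End Centre.

Theorem theorem5p3 (R : realType) (n : nat) (q : R[i])
    (n_ge2 : (2 <= n)%N) (q_neq0 : q != 0)
    (q_not_root_of_unity : forall m : nat, (0 < m)%N -> q ^+ m != 1) :
  centre_of (daha_gl n (Cconst q) (tauvar R)) =
  subalg_gen [set dahaYtilde n (Cconst q) (tauvar R);
                  dahaYtilde_inv n (Cconst q) (tauvar R)]%classic.
Proof.
case: n n_ge2 => [|[|m]] // _.
(* The points x_i = w^(h_i) require an n-th root of q, with n = m+2 here. *)
have /closed_rootP [w] : size ('X^(m.+2) - q%:P : {poly R[i]}) != 1%N.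
  by rewrite size_XnsubC.
rewrite /root !hornerE subr_eq0 => /eqP wq.
have w0 : w != 0.
  by apply: contraNneq q_neq0 => w0; rewrite -wq w0 expr0n.
have w_inf z : w ^ z = 1 -> z = 0.
  move=> wz; apply/eqP; rewrite -absz_eq0; apply/eqP; apply: contrapT => /eqP z0.
  have := q_not_root_of_unity `|z|%N; rewrite lt0n z0 => /(_ isT) /eqP; apply.
  (* From w^|z| = 1 it follows that q^|z| = (w^|z|)^n = 1, which is excluded for nonzero z. *)
  rewrite -wq exprAC.
  have -> : w ^+ `|z| = 1; last by rewrite expr1n.
  case: z wz {z0} => k //= e; apply: invr_inj.
  by rewrite invr1 -[RHS]e.
have -> : Cconst q = wfrac w ^+ m.+2.
  by rewrite /wfrac /Cconst -tofracXn -polyC_exp wq.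
exact: (centre_daha_gl m w0 w_inf).
Qed.
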